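(* Let $a<b$ be real numbers, $m\ge1$ an integer, and let $\alpha\in(0,1)$, $1\le p\le\infty$ satisfy $0\le\frac1p<\alpha<1$. Let $L:[a,b]\times\mathbb{R}^m\times\mathbb{R}^m\to\mathbb{R}$, $(t,x,v)\mapsto L(t,x,v)$, be a Lagrangian (a continuous mapping of class $\mathscr{C}^1$ in its two last variables), and let $\ell:\mathbb{R}^m\times\mathbb{R}^m\to\mathbb{R}$, $(x_1,x_2)\mapsto\ell(x_1,x_2)$, be of class $\mathscr{C}^1$. Consider the Bolza functional $\Phi:\mathrm{AC}^{\alpha,p}_{a+}\to\mathbb{R}$, $$\Phi(q)=\int_a^b L(\tau,q(\tau),(D^\alpha_{a+}q)(\tau))\,d\tau+\ell\big((I^{1-\alpha}_{a+}q)(a),q(b)\big).$$ If $L$ has a quasi-polynomially controlled growth (with $\frac1\alpha<s\le\infty$ the exponent appearing in that definition) and if $q\in\mathrm{AC}^{\alpha,p}_{a+}$ is a critical point of $\Phi$, then $L_v(\cdot,q,D^\alpha_{a+}q)\in\mathrm{AC}^{\alpha,s}_{b-}$ and $$(D^\alpha_{b-}L_v(\cdot,q,D^\alpha_{a+}q))(t)=-L_x(t,q(t),(D^\alpha_{a+}q)(t)),\quad\text{for a.e. } t\in[a,b],$$ $$L_v(a,q(a),(D^\alpha_{a+}q)(a))=\ell_{x_1}\big((I^{1-\alpha}_{a+}q)(a),q(b)\big),$$ $$(I^{1-\alpha}_{b-}L_v(\cdot,q,D^\alpha_{a+}q))(b)=-\ell_{x_2}\big((I^{1-\alpha}_{a+}q)(a),q(b)\big).$$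 Here $L_v(a,q(a),(D^\alpha_{a+}q)(a))$ denotes the value at $t=a$ of the function $L_v(\cdot,q,D^\alpha_{a+}q)\in\mathrm{AC}^{\alpha,s}_{b-}$ under the pointwise identification of elements of $\mathrm{AC}^{\alpha,s}_{b-}$.
   Context: Convention $1/\infty=0$; $p'=\frac{p}{p-1}$ is the conjugate exponent; $\mathrm{L}^p=\mathrm{L}^p((a,b),\mathbb{R}^m)$; $L_x,L_v,\ell_{x_1},\ell_{x_2}$ are partial gradients; $\|\cdot\|$ is the Euclidean norm. For $\beta>0$ and $q\in\mathrm{L}^1$, for a.e. $t\in[a,b]$, $$(I^\beta_{a+}q)(t)=\frac1{\Gamma(\beta)}\int_a^t\frac{q(\tau)}{(t-\tau)^{1-\beta}}\,d\tau,\qquad (I^\beta_{b-}q)(t)=\frac1{\Gamma(\beta)}\int_t^b\frac{q(\tau)}{(\tau-t)^{1-\beta}}\,d\tau .$$ $q\in\mathrm{L}^1$ possesses a left-sided (resp. right-sided) Riemann-Liouville derivative of order $\alpha\in(0,1)$ if $I^{1-\alpha}_{a+}q$ (resp. $I^{1-\alpha}_{b-}q$) has an absolutely continuous representative on $[a,b]$; it is then identified with this representative, and $D^\alpha_{a+}q:=\frac{d}{dt}(I^{1-\alpha}_{a+}q)$ (resp. $D^\alpha_{b-}q:=-\frac{d}{dt}(I^{1-\alpha}_{b-}q)$). $\mathrm{AC}^{\alpha,p}_{a+}$ (resp. $\mathrm{AC}^{\alpha,p}_{b-}$) is the set of $q\in\mathrm{L}^1$ possessing a left-sided (resp. right-sided)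 Riemann-Liouville derivative of order $\alpha$ that belongs to $\mathrm{L}^p$. Pointwise identification when $0\le\frac1p<\alpha<1$: for $\varphi\in\mathrm{L}^p$, $I^\alpha_{a+}\varphi$ (resp. $I^\alpha_{b-}\varphi$) is identified with a continuous function on $[a,b]$ vanishing at $a$ (resp. $b$). Each $q\in\mathrm{AC}^{\alpha,p}_{a+}$ is identified with $q(t)=\frac{1}{\Gamma(\alpha)}\frac{c}{(t-a)^{1-\alpha}}+(I^\alpha_{a+}\varphi)(t)$, $t\in(a,b]$, where $c=(I^{1-\alpha}_{a+}q)(a)$, $\varphi=D^\alpha_{a+}q$; so $q(b)$ is well-defined. Each $q\in\mathrm{AC}^{\alpha,p}_{b-}$ is identified with $q(t)=\frac{1}{\Gamma(\alpha)}\frac{d}{(b-t)^{1-\alpha}}+(I^\alpha_{b-}\psi)(t)$, $t\in[a,b)$, where $d=(I^{1-\alpha}_{b-}q)(b)$, $\psi=D^\alpha_{b-}q$; so $q(a)$ is well-defined. Quasi-polynomial functions: for $1\le M\le\infty$, $\mathscr{P}^{\alpha,p}_M$ is the set of functions $P:[a,b]\times\mathbb{R}^m\times\mathbb{R}^m\to\mathbb{R}^+$ of the following form, where $N\in\mathbb{N}$, the $c_k$ are continuous with nonnegative values and $s_{1,k},s_{2,k}\geq 0$ are reals: (i) if $M<\infty$, $p<\infty$: $P(t,x,v)=\sum_{k=0}^N c_k(t)\|x\|^{s_{1,k}}\|v\|^{s_{2,k}}$ with $\frac{s_{2,k}}p\le\frac1M$ if $s_{1,k}=0$, and $(1-\alpha)s_{1,k}+\frac{s_{2,k}}p<\frac1M$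 if $s_{1,k}>0$; (ii) if $M<\infty$, $p=\infty$: $P(t,x,v)=\sum_{k=0}^N c_k(t,v)\|x\|^{s_{1,k}}$ with $(1-\alpha)s_{1,k}<\frac1M$; (iii) if $M=\infty$, $p<\infty$: $P(t,x,v)=c_0(t)$; (iv) if $M=\infty$, $p=\infty$: $P(t,x,v)=c_0(t,v)$. The growth of $L$ is quasi-polynomially controlled if there exist $P_0\in\mathscr{P}^{\alpha,p}_1$, $\frac1\alpha<s\le\infty$, $P_1\in\mathscr{P}^{\alpha,p}_s$ and $P_2\in\mathscr{P}^{\alpha,p}_{p'}$ such that $|L|\le P_0$, $\|L_x\|\le P_1$ and $\|L_v\|\le P_2$ on $[a,b]\times\mathbb{R}^m\times\mathbb{R}^m$. The first variation is $\delta\Phi(q,h):=\lim_{\lambda\to0}\frac{\Phi(q+\lambda h)-\Phi(q)}{\lambda}$ for $q,h\in\mathrm{AC}^{\alpha,p}_{a+}$. A critical point of $\Phi$ is a $q\in\mathrm{AC}^{\alpha,p}_{a+}$ with $\delta\Phi(q,h)=0$ for all $h\in\mathrm{AC}^{\alpha,p}_{a+}$. *)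

(* Defs.v *)
From mathcomp Require Import all_boot all_order all_algebra.
From mathcomp Require Import all_classical all_reals all_analysis.
Import Order.TTheory GRing.Theory Num.Theory.
Import numFieldNormedType.Exports.

Set Implicit Arguments.
Unset Strict Implicit.
Unset Printing Implicit Defensive.

Local Open Scope classical_set_scope.
Local Open Scope ring_scope.

(* Elements of L^1((a,b), R^m) are represented by total functions
   [q : R -> 'rV[R]_m]; only their values at almost every point of [a, b]
   matter in every definition below. *)

Section FractionalCalculus.
Context {R : realType}.
Local Notation mu := (@lebesgue_measure R).

(* The library norm on ['rV[R]_m] is the sup norm, hence this definition. *)
Definition enorm (m : nat) (x : 'rV[R]_m) : R :=
  Num.sqrt (\sum_(i < m) x ord0 i ^+ 2).

(* With the library's [+oo^-1 = 0]. *)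
Definition recip (p : \bar R) : R := fine (p^-1)%E.

Definition Gamma (x : R) : R :=
  \int[mu]_(t in `]0, +oo[) (t `^ (x - 1) * expR (- t)).

(* Library measurability on R is Borel measurability; allowing a modification
   on a null set makes membership a property of the a.e. class. *)
Definition in_Lp (m : nat) (a b : R) (p : \bar R) (f : R -> 'rV[R]_m) : Prop :=
  exists g : R -> 'rV[R]_m,
    [/\ forall i, measurable_fun `[a, b] (fun t => g t ord0 i),
        f = g %[ae mu in `[a, b]%classic]
      & ('N[mu]_p [EFin \o ((fun t => enorm (g t)) \_ `[a, b])] < +oo)%E].

Definition abs_cont (m : nat) (a b : R) (F : R -> 'rV[R]_m) : Prop :=
  forall e : R, 0 < e -> exists2 d : R, 0 < d &
    forall (n : nat) (s t : 'I_n -> R),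
      (forall i, a <= s i /\ s i <= t i /\ t i <= b) ->
      trivIset setT (fun i => `]s i, t i[%classic) ->
      \sum_(i < n) (t i - s i) < d ->
      \sum_(i < n) enorm (F (t i) - F (s i)) < e.

Definition RLint_left (m : nat) (a beta : R) (q : R -> 'rV[R]_m) (t : R) :
    'rV[R]_m :=
  \row_i ((Gamma beta)^-1 *
    \int[mu]_(tau in `[a, t]) (q tau ord0 i / (t - tau) `^ (1 - beta))).

Definition RLint_right (m : nat) (b beta : R) (q : R -> 'rV[R]_m) (t : R) :
    'rV[R]_m :=
  \row_i ((Gamma beta)^-1 *
    \int[mu]_(tau in `[t, b]) (q tau ord0 i / (tau - t) `^ (1 - beta))).

Definition is_AC_repr (m : nat) (a b : R) (f F : R -> 'rV[R]_m) : Prop :=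
  abs_cont a b F /\ F = f %[ae mu in `[a, b]%classic].

(* When [a < b], two absolutely continuous representatives agree on [a, b], so
   on [a, b] the result does not depend on the choice made by [xget]; it is
   [f] if there is no such representative. *)
Definition AC_repr (m : nat) (a b : R) (f : R -> 'rV[R]_m) : R -> 'rV[R]_m :=
  xget f [set F | is_AC_repr a b f F].

(* The fractional integrals of order [1 - alpha], identified with their
   absolutely continuous representatives. *)
Definition RLac_left (m : nat) (a b alpha : R) (q : R -> 'rV[R]_m) :=
  AC_repr a b (RLint_left a (1 - alpha) q).

Definition RLac_right (m : nat) (a b alpha : R) (q : R -> 'rV[R]_m) :=
  AC_repr a b (RLint_right b (1 - alpha) q).

Definition RLder_left (m : nat) (a b alpha : R) (q : R -> 'rV[R]_m) (t : R) :
    'rV[R]_m :=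
  derive1 (RLac_left a b alpha q) t.

Definition RLder_right (m : nat) (a b alpha : R) (q : R -> 'rV[R]_m) (t : R) :
    'rV[R]_m :=
  - derive1 (RLac_right a b alpha q) t.

Definition AC_left (m : nat) (a b alpha : R) (p : \bar R)
    (q : R -> 'rV[R]_m) : Prop :=
  [/\ in_Lp a b 1%:E q,
      exists F, is_AC_repr a b (RLint_left a (1 - alpha) q) F
    & in_Lp a b p (RLder_left a b alpha q)].

Definition AC_right (m : nat) (a b alpha : R) (p : \bar R)
    (q : R -> 'rV[R]_m) : Prop :=
  [/\ in_Lp a b 1%:E q,
      exists F, is_AC_repr a b (RLint_right b (1 - alpha) q) F
    & in_Lp a b p (RLder_right a b alpha q)].

(* The pointwise identification of elements of [AC_left a b alpha p] on ]a, b],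
   and of [AC_right a b alpha p] on [a, b[. When [1/p < alpha], Hoelder's
   inequality makes the integral in [RLint_left a alpha phi t] converge for
   every t in [a, b] and not only for almost every t, and these values form the
   continuous representative. *)
Definition RLval_left (m : nat) (a b alpha : R) (q : R -> 'rV[R]_m) (t : R) :
    'rV[R]_m :=
  ((Gamma alpha)^-1 / (t - a) `^ (1 - alpha)) *: RLac_left a b alpha q a
  + RLint_left a alpha (RLder_left a b alpha q) t.

Definition RLval_right (m : nat) (a b alpha : R) (q : R -> 'rV[R]_m) (t : R) :
    'rV[R]_m :=
  ((Gamma alpha)^-1 / (b - t) `^ (1 - alpha)) *: RLac_right a b alpha q b
  + RLint_right b alpha (RLder_right a b alpha q) t.

End FractionalCalculus.

Section Lagrangians.
Context {R : realType}.
Local Notation mu := (@lebesgue_measure R).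
Variable m : nat.
Local Notation V := 'rV[R]_m.

Definition gradient (f : V -> R) (x : V) : V :=
  \row_i derive f x (delta_mx ord0 i).

Definition is_C1 (f : V * V -> R) : Prop :=
  (forall z, differentiable f z) /\
  (forall h, continuous (fun z => 'd f z h)).

Definition lagrangian (a b : R) (L : R -> V -> V -> R) : Prop :=
  {within [set z : R * V * V | a <= z.1.1 <= b],
    continuous (fun z : R * V * V => L z.1.1 z.1.2 z.2)} /\
  forall t, a <= t <= b -> is_C1 (fun z : V * V => L t z.1 z.2).

Definition L_x (L : R -> V -> V -> R) (t : R) (x v : V) : V :=
  gradient (fun y => L t y v) x.

Definition L_v (L : R -> V -> V -> R) (t : R) (x v : V) : V :=
  gradient (fun w => L t x w) v.

Definition ell_1 (ell : V -> V -> R) (x1 x2 : V) : V :=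
  gradient (fun y => ell y x2) x1.

Definition ell_2 (ell : V -> V -> R) (x1 x2 : V) : V :=
  gradient (fun y => ell x1 y) x2.

Definition coef_t (a b : R) (c : R -> R) : Prop :=
  {within `[a, b], continuous c} /\ forall t, a <= t <= b -> 0 <= c t.

Definition coef_tv (a b : R) (c : R -> V -> R) : Prop :=
  {within [set z : R * V | a <= z.1 <= b],
    continuous (fun z : R * V => c z.1 z.2)} /\
  forall t v, a <= t <= b -> 0 <= c t v.

(* Note that [0 `^ 0 = 1], so a zero exponent means that the factor is
   absent. *)
Definition quasipoly (a b alpha : R) (p M : \bar R) (P : R -> V -> V -> R) :
    Prop :=
  if (M < +oo)%E then
    if (p < +oo)%E then
      exists (N : nat) (c : 'I_N.+1 -> R -> R) (s1 s2 : 'I_N.+1 -> R),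
      [/\ forall k, coef_t a b (c k),
          forall k, 0 <= s1 k /\ 0 <= s2 k,
          forall k, s1 k = 0 -> s2 k * recip p <= recip M,
          forall k, 0 < s1 k ->
            (1 - alpha) * s1 k + s2 k * recip p < recip M
        & forall t x v, a <= t <= b ->
            P t x v =
            \sum_(k < N.+1) c k t * enorm x `^ s1 k * enorm v `^ s2 k]
    else
      exists (N : nat) (c : 'I_N.+1 -> R -> V -> R) (s1 : 'I_N.+1 -> R),
      [/\ forall k, coef_tv a b (c k),
          forall k, 0 <= s1 k,
          forall k, (1 - alpha) * s1 k < recip M
        & forall t x v, a <= t <= b ->
            P t x v = \sum_(k < N.+1) c k t v * enorm x `^ s1 k]
  else
    if (p < +oo)%E then
      exists2 c : R -> R, coef_t a b c
        & forall t x v, a <= t <= b -> P t x v = c t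
    else
      exists2 c : R -> V -> R, coef_tv a b c
        & forall t x v, a <= t <= b -> P t x v = c t v.

(* Quasi-polynomially controlled growth with exponent [s] for [L_x]. *)
Definition qp_controlled (a b alpha : R) (p s : \bar R)
    (L : R -> V -> V -> R) : Prop :=
  (alpha^-1%:E < s)%E /\
  exists P0 P1 P2 : R -> V -> V -> R,
  [/\ quasipoly a b alpha p 1%:E P0,
      quasipoly a b alpha p s P1,
      quasipoly a b alpha p (hoelder_conjugate p) P2
    & forall t x v, a <= t <= b ->
      [/\ `|L t x v| <= P0 t x v,
          enorm (L_x L t x v) <= P1 t x v
        & enorm (L_v L t x v) <= P2 t x v]].

Definition bolza (a b alpha : R) (L : R -> V -> V -> R) (ell : V -> V -> R)
    (q : R -> V) : R :=
  \int[mu]_(tau in `[a, b]) L tau (q tau) (RLder_left a b alpha q tau)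
  + ell (RLac_left a b alpha q a) (RLval_left a b alpha q b).

Definition is_first_variation (Phi : (R -> V) -> R) (q h : R -> V) (d : R) :
    Prop :=
  (Phi (fun t => q t + lambda *: h t) - Phi q) / lambda
    @[lambda --> (0 : R)^'] --> d.

Definition critical_point (a b alpha : R) (p : \bar R)
    (Phi : (R -> V) -> R) (q : R -> V) : Prop :=
  AC_left a b alpha p q /\
  forall h, AC_left a b alpha p h -> is_first_variation Phi q h 0.

End Lagrangians.

(* Main.v *)
(* Write [q = c (t - a)^(alpha - 1) / Gamma alpha + I^alpha_{a+} f] and let the
   test curves [h] be given in the same way by [(d, phi)] with [phi] bounded.
   Condition [1/p < alpha] makes [I^alpha_{a+} f] bounded, so [q] and its
   perturbations are at most a multiple of [(t - a)^(alpha - 1)] on ]a, b]; the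
   growth conditions then dominate [L], [L_x] and [L_v] along such curves by
   functions in L^1, L^s and L^p', and dominated convergence gives
     int (L_x . h + L_v . phi) + ell_1 . d + ell_2 . h(b) = 0.
   Taking [d = 0] and [phi] the indicator of a subinterval, fractional
   integration by parts (Fubini) yields, almost everywhere,
     L_v = - ell_2 (b - t)^(alpha - 1) / Gamma alpha - I^alpha_{b-} L_x,
   which is the representation of an element of AC^{alpha,s}_{b-} with
   derivative [- L_x] and boundary value [- ell_2]; taking [phi = 0] identifies
   the value at [a] with [ell_1]. *)

From HB Require Import structures.
Require Import Defs.
From mathcomp Require Import all_boot all_order all_algebra.
From mathcomp Require Import all_classical all_reals all_analysis.
From mathcomp Require Import measurable_realfun.
From mathcomp Require Import ring lra.
Import Order.TTheory GRing.Theory Num.Theory.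
Import numFieldNormedType.Exports.

Set Implicit Arguments.
Unset Strict Implicit.
Unset Printing Implicit Defensive.

Local Open Scope classical_set_scope.
Local Open Scope ring_scope.

(** * The Riemann-Liouville kernel *)

(** The operators of the statement integrate over [[a, t]] curves that may be nonmeasurable on null
    sets, and pick representatives through [xget]. They are replaced by convolutions on the whole
    line with densities vanishing outside [[a, b]], so that Fubini applies without moving bounds;
    the special-function fact then required is the Beta integral for two orders adding up to 1. The
    representation of [q] is itself a theorem here: that an absolutely continuous function is a
    primitive comes from Radon-Nikodym applied to Stieltjes measures, and [q] is recovered from
    [I^(1 - alpha) q] by inverting Abel's equation. Each [L t] is of class C^1, but no continuity of
    [L_x] or [L_v] in [t] is given: they are measurable along curves because differentials are
    limits of difference quotients of [L], which is jointly continuous. Dominated convergence being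
    about sequences, the first variation is taken along the steps [1/(n+1)]. Pairing [L_x], of class
    L^s, with the singular kernel is what calls for [1/s < alpha]. *)

Section AffineChange.
Context {R : realType}.
Local Notation mu := (@lebesgue_measure R).

Lemma measurable_affine (s c : R) (D : set R) :
  measurable_fun D (fun x : R => s * x + c).
Proof.
by apply: measurable_funD => //; apply: measurable_funM.
Qed.

(** The pushforward under [x => s * x + c], scaled by [s], is a measure giving each []x, y]] its
    length, and Lebesgue measure is the only such measure. *)
Lemma lebesgue_measure_affine (s c : R) (A : set R) : 0 < s ->
  measurable A -> (s%:E * mu ((fun x => s * x + c)%R @^-1` A) = mu A)%E.
Proof.
move=> s0 mA.
pose phi := (fun x => s * x + c) : measurableTypeR R -> measurableTypeR R.
have mphi : measurable_fun setT phi by exact: measurable_affine.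
pose s' : {nonneg R} := NngNum (ltW s0).
have [nu nuE] : exists nu : {measure set (measurableTypeR R) -> \bar R},
    forall X, nu X = (s%:E * mu (phi @^-1` X))%E.
  unshelve eexists (mscale s' (pushforward mu phi) : {measure set _ -> \bar R}) => //.
rewrite -nuE; apply/esym/(@lebesgue_measure_unique R nu) => // X [[x y] _ <-].
rewrite nuE.
have -> : phi @^-1` `]x, y]%classic = `](x - c) / s, (y - c) / s]%classic.
  by apply/seteqP; split => z; rewrite /phi /= !in_itv/= ltr_pdivrMr// ler_pdivlMr//
    ltrBlDr lerBrDr mulrC.
rewrite !lebesgue_measure_itv/= !lte_fin ltr_pM2r ?invr_gt0// ltrD2r.
case: ifPn => xy; last by rewrite mule0.
rewrite -EFinD -EFinM -mulrBl mulrCA divff ?gt_eqF// mulr1.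
by congr EFin; ring.
Qed.

Lemma ge0_integral_affine (f : R -> \bar R) (s c : R) : 0 < s ->
  measurable_fun setT f -> (forall x, 0 <= f x)%E ->
  (s%:E * \int[mu]_x f (s * x + c)%R = \int[mu]_x f x)%E.
Proof.
move=> s0 mf f0.
pose phi := (fun x => s * x + c) : measurableTypeR R -> measurableTypeR R.
have mphi : measurable_fun setT phi by exact: measurable_affine.
have := ge0_integral_pushforward mphi mu measurableT mf (fun y _ => f0 y).
rewrite preimage_setT => <-.
pose s' : {nonneg R} := NngNum (ltW s0).
rewrite -[s%:E]/(s'%:num%:E) -ge0_integral_mscale//.
apply: eq_measure_integral => A mA _.
exact: lebesgue_measure_affine.
Qed.

Lemma ge0_integral_translation (f : R -> \bar R) (c : R) :
  measurable_fun setT f -> (forall x, 0 <= f x)%E ->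
  (\int[mu]_x f (x + c)%R = \int[mu]_x f x)%E.
Proof.
move=> mf f0; rewrite -(@ge0_integral_affine f 1 c)// mul1e.
by apply: eq_integral => x _; rewrite mul1r.
Qed.

Lemma ge0_integral_opp (f : R -> \bar R) :
  measurable_fun setT f -> (forall x, 0 <= f x)%E ->
  (\int[mu]_x f (- x)%R = \int[mu]_x f x)%E.
Proof.
move=> mf f0.
have mphi : measurable_fun setT (-%R : measurableTypeR R -> measurableTypeR R) by [].
have := ge0_integral_pushforward mphi mu measurableT mf (fun y _ => f0 y).
rewrite preimage_setT => <-.
by apply: eq_measure_integral => A mA _; exact: lebesgue_measureN.
Qed.

Lemma ge0_integral_reflection (f : R -> \bar R) (c : R) :
  measurable_fun setT f -> (forall x, 0 <= f x)%E ->
  (\int[mu]_x f (c - x)%R = \int[mu]_x f x)%E.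
Proof.
move=> mf f0; rewrite -(@ge0_integral_translation f c)// -[RHS]ge0_integral_opp//.
  by apply: eq_integral => x _; rewrite addrC.
by apply: measurableT_comp mf _; apply: measurable_funD.
Qed.

Lemma tonelliR (f : R -> R -> \bar R) :
  measurable_fun setT (fun z : R * R => f z.1 z.2) -> (forall x y, 0 <= f x y)%E ->
  (\int[mu]_x \int[mu]_y f x y = \int[mu]_y \int[mu]_x f x y)%E.
Proof.
move=> mf f0.
exact: (@fubini_tonelli _ _ _ _ _ mu mu (fun z : R * R => f z.1 z.2) mf).
Qed.

End AffineChange.

(** * The kernel, the Gamma function and the Beta integral *)

Section Kernel.
Context {R : realType}.
Local Notation mu := (@lebesgue_measure R).
Implicit Types (be x : R).

(* The fractional integrals are handled as convolutions on the whole line of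
   functions vanishing outside [a, b] with the kernel [x_+^(be - 1)]. *)
Definition ker be x : R := if 0 < x then x `^ (be - 1) else 0.

Lemma ker_ge0 be x : 0 <= ker be x.
Proof. by rewrite /ker; case: ifP => // _; exact: powR_ge0. Qed.

Lemma ker_le0 be x : x <= 0 -> ker be x = 0.
Proof. by move=> x0; rewrite /ker ltNge x0. Qed.

Lemma measurable_ker be : measurable_fun setT (ker be).
Proof.
rewrite /ker; apply: measurable_fun_ifT => //.
exact: measurable_fun_ltr.
Qed.

Lemma measurableT_ker d (T : measurableType d) (D : set T) be (f : T -> R) :
  measurable_fun D f -> measurable_fun D (fun y => ker be (f y)).
Proof. by move=> mf; apply: measurableT_comp mf; exact: measurable_ker. Qed.

Lemma integral_powR_itvcc be (a c : R) : 0 < be -> 0 < a -> a < c ->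
  (\int[mu]_(x in `[a, c]) (x `^ (be - 1))%:E =
   (c `^ be / be)%:E - (a `^ be / be)%:E)%E.
Proof.
move=> be0 a0 ac.
have dF (x : R) : 0 < x -> is_derive x 1 (fun x => x `^ be / be) (x `^ (be - 1)).
  move=> x0.
  have -> : (fun x => x `^ be / be) = be^-1 \*: (fun y : R => y `^ be).
    by apply/funext => y; rewrite /= mulrC.
  have -> : x `^ (be - 1) = be^-1 *: (be * x `^ (be - 1)).
    by rewrite /GRing.scale /= mulrA mulVf ?gt_eqF// mul1r.
  apply: is_deriveZ; apply: DeriveDef.
    by apply: derivable_powR; rewrite in_itv/= x0.
  by rewrite -derive1E powR_derive1// in_itv/= x0.
have cF (be' x : R) : 0 < x -> {for x, continuous (fun y : R => y `^ be')}.
  move=> x0; apply: differentiable_continuous; apply/derivable1_diffP.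
  by apply: derivable_powR; rewrite in_itv/= x0.
apply: (@continuous_FTC2 _ (fun x => x `^ (be - 1)) (fun x => x `^ be / be)) => //.
- apply: continuous_in_subspaceT => x; rewrite inE/= in_itv/= => /andP[ax _].
  by apply: cF; exact: lt_le_trans ax.
- split.
  + by move=> x; rewrite in_itv/= => /andP[ax _]; have [] := dF x (lt_trans a0 ax).
  + apply: cvg_at_right_filter; apply: cvgMl; exact: cF.
  + apply: cvg_at_left_filter; apply: cvgMl; apply: cF; exact: lt_trans ac.
- move=> x; rewrite in_itv/= => /andP[ax _].
  by have [_ h] := dF x (lt_trans a0 ax); rewrite derive1E h.
Qed.

(** Only finiteness is wanted, so []0, c]] is exhausted by [[c / (n + 1), c]], away from the
    singularity at 0; the primitive bounds each of these integrals by the same [c ^ be / be]. *)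
Lemma integral_powR_lty be (c : R) : 0 < be ->
  (\int[mu]_(x in `]0%R, c]) (x `^ (be - 1))%:E < +oo)%E.
Proof.
move=> be0; have [c0|c0] := leP c 0.
  by rewrite set_itv_ge ?integral_set0 ?ltry// bnd_simp -leNgt.
pose F (n : nat) : set R := `[c / n.+1%:R, c]%classic.
have -> : `]0, c]%classic = \bigcup_n F n.
  apply/seteqP; split => x /=; last first.
    move=> [n _]; rewrite /F /= !in_itv/= => /andP[h ->]; rewrite andbT.
    by apply: lt_le_trans h; rewrite divr_gt0.
  rewrite in_itv/= => /andP[x0 xc].
  exists (Num.truncn (c / x)) => //; rewrite /F /= in_itv/= xc andbT.
  rewrite ler_pdivrMr// mulrC -ler_pdivrMr//.
  by apply/ltW; exact: truncnS_gt.
have mp D : measurable_fun D (fun x : R => (x `^ (be - 1))%:E).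
  by apply/measurable_EFinP/measurable_funTS; exact: measurable_powR.
have cv : (\int[mu]_(x in F n) (x `^ (be - 1))%:E @[n --> \oo] -->
    \int[mu]_(x in \bigcup_n F n) (x `^ (be - 1))%:E)%E.
  apply: ge0_nondecreasing_set_cvg_integral => //.
  - move=> m n mn; rewrite subsetEset => x; rewrite /F /= !in_itv/= => /andP[h ->].
    rewrite andbT; apply: le_trans h; rewrite ler_pM2l// lef_pV2 ?posrE//.
    by rewrite ler_nat.
  - by move=> n; exact: measurable_itv.
  - by move=> n; exact: mp.
  - by move=> n x _; rewrite lee_fin powR_ge0.
rewrite -(cvg_lim _ cv)//.
apply: (@le_lt_trans _ _ (c `^ be / be)%:E); last exact: ltry.
apply: lime_le; first by apply/cvg_ex; eexists; exact: cv.
apply: nearW => n; rewrite /F.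
have cn0 : 0 < c / n.+1%:R by rewrite divr_gt0.
have [cn|cn] := ltP (c / n.+1%:R) c.
  rewrite integral_powR_itvcc//.
  by rewrite -EFinB lee_fin gerBl divr_ge0// ?powR_ge0// ltW.
(* Only [n = 0] remains, where the interval shrinks to the point [c]. *)
rewrite (_ : `[_, _]%classic = [set c] `&` `[c / n.+1%:R, c]%classic); last first.
  apply/seteqP; split => x /=; rewrite in_itv/=; last by case.
  move=> /andP[h1 h2]; split; last by rewrite h1.
  by apply: (@le_anti _ R); rewrite h2 (le_trans cn h1).
rewrite (@integral_Sset1 _ _ _ c); last exact: subIsetl.
by rewrite lee_fin divr_ge0// ?powR_ge0// ltW.
Qed.

Lemma integral_kerE be (D : set R) : measurable D ->
  (\int[mu]_(x in D) (ker be x)%:E =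
   \int[mu]_(x in D `&` `]0%R, +oo[) (x `^ (be - 1))%:E)%E.
Proof.
move=> mD; rewrite integral_mkcondr; apply: eq_integral => x _.
rewrite patchE mem_setE in_itv/= andbT /ker.
by case: ifP.
Qed.

Lemma integral_ker_lty be c : 0 < be ->
  (\int[mu]_(x in `]-oo, c]) (ker be x)%:E < +oo)%E.
Proof.
move=> be0; rewrite integral_kerE//.
rewrite (_ : _ `&` _ = `]0, c]%classic); first exact: integral_powR_lty.
by apply/seteqP; split => x /=; rewrite !in_itv/= ?andbT; [case=> -> ->|case/andP=> -> ->].
Qed.

Lemma measurable_ker_expR be :
  measurable_fun setT (fun x => (ker be x * expR (- x))%:E).
Proof.
apply/measurable_EFinP; apply: measurable_funM; first exact: measurable_ker.
exact: measurableT_comp.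
Qed.

Lemma integral_expRN : (\int[mu]_(x in `[0%R, +oo[) (expR (- x))%:E = 1)%E.
Proof.
rewrite (@ge0_continuous_FTC2y _ _ (fun x => - expR (- x)) 0 0)//.
- by rewrite oppr0 expR0 sub0e EFinN oppeK.
- apply: continuous_subspaceT => x; apply: continuous_comp; last exact: continuous_expR.
  exact: opp_continuous.
- rewrite -[X in _ --> X]oppr0; apply: cvgN; exact: cvgr_expR.
- apply: cvg_at_right_filter; apply: cvgN.
  apply: continuous_comp; last exact: continuous_expR.
  exact: opp_continuous.
- move=> x _; rewrite derive1E; apply: derive_val.
  rewrite -[X in is_derive _ _ _ X]opprK; apply: is_deriveN.
  rewrite -mulrN1; exact: is_derive1_comp.
Qed.

(** [Gamma] is a real-valued integral, which would be 0 by default if the extended one were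
    infinite, so finiteness must come first: up to 1 the integrand is below the kernel, beyond 1 it
    is below [expR (- x)] because [be < 1]. *)
Lemma integral_ker_expR be : 0 < be < 1 ->
  (\int[mu]_x (ker be x * expR (- x))%:E = (Gamma be)%:E)%E.
Proof.
move=> /andP[be0 be1].
have mf := measurable_ker_expR be.
have f0 x : (0 <= (ker be x * expR (- x))%:E)%E.
  by rewrite lee_fin mulr_ge0 ?ker_ge0 ?expR_ge0.
have E : (\int[mu]_x (ker be x * expR (- x))%:E =
  \int[mu]_(x in `]0%R, +oo[) (x `^ (be - 1) * expR (- x))%:E)%E.
  rewrite [RHS]integral_mkcond; apply: eq_integral => x _.
  by rewrite patchE mem_setE in_itv/= andbT /ker; case: ifP => // _; rewrite mul0r.
rewrite /Gamma /Rintegral -E fineK// ge0_fin_numE; last exact: integral_ge0.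
rewrite -(setUv `]-oo, 1%R]%classic) ge0_integral_setU//=; last 3 first.
- exact: measurableC.
- by rewrite setUv.
- by apply/disj_setPCl.
rewrite setCitvl; apply: lte_add_pinfty.
- apply: le_lt_trans (integral_ker_lty 1 be0); apply: ge0_le_integral => //.
  + exact: measurable_funTS.
  + by apply/measurable_EFinP; apply: measurable_funTS; exact: measurable_ker.
  + move=> x _; rewrite lee_fin; have [x0|x0] := leP x 0.
      by rewrite ker_le0// mul0r.
    by rewrite ler_piMr ?ker_ge0// -expR0 ler_expR lerNl oppr0 ltW.
- have h : (1 < +oo :> \bar R)%E by exact: ltry.
  apply: le_lt_trans h; rewrite -integral_expRN.
  apply: (@le_trans _ _ (\int[mu]_(x in `]1%R, +oo[) (expR (- x))%:E)%E); last first.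
    apply: ge0_subset_integral => //.
    + by apply/measurable_EFinP; apply: measurable_funTS; exact: measurableT_comp.
    + by move=> x /=; rewrite !in_itv/= !andbT => /ltW; exact: le_trans.
  apply: ge0_le_integral => //.
  + exact: measurable_funTS.
  + by apply/measurable_EFinP; apply: measurable_funTS; exact: measurableT_comp.
  + move=> x; rewrite /= in_itv/= andbT => x1; rewrite lee_fin ler_piMl ?expR_ge0//.
    rewrite /ker (lt_trans _ x1)// -[leRHS](powRr0 x); apply: ler_powR; first exact: ltW.
    by rewrite subr_le0 ltW.
Qed.

(** On []0, 1]] the integrand is at least [expR (-1)], as [be < 1]. *)
Lemma Gamma_gt0 be : 0 < be < 1 -> 0 < Gamma be.
Proof.
move=> be01; rewrite -lte_fin -integral_ker_expR//; have /andP[be0 be1] := be01.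
apply: (@lt_le_trans _ _ (\int[mu]_(x in `]0%R, 1%R]) (expR (-1))%:E)%E).
  rewrite integral_cst//= lebesgue_measure_itv/= lte_fin ltr01 sube0 mule1.
  by rewrite lte_fin expR_gt0.
apply: (@le_trans _ _ (\int[mu]_(x in `]0%R, 1%R]) (ker be x * expR (- x))%:E)%E).
  apply: ge0_le_integral => //.
  - by apply: measurable_funTS; exact: measurable_ker_expR.
  - move=> x; rewrite /= in_itv/= => /andP[x0 x1]; rewrite lee_fin.
    apply: (@le_trans _ _ (expR (- x))); first by rewrite ler_expR lerN2.
    rewrite ler_peMl ?expR_ge0// /ker x0 -[leLHS](powRr0 x).
    by apply: ger_powR; rewrite ?x0// subr_le0 ltW.
apply: ge0_subset_integral => //; first exact: measurable_ker_expR.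
by move=> x _; rewrite lee_fin mulr_ge0 ?ker_ge0 ?expR_ge0.
Qed.

(** The Beta integral B(be, 1 - be). Because the two orders add up to 1, its value does not depend
    on [t - s > 0]; weighting it by [expR (- z)] and integrating over [z > 0] reproduces it on one
    side, while Tonelli gives the two Gamma integrals on the other. *)
Lemma integral_ker_ker be (t s : R) : 0 < be < 1 ->
  (\int[mu]_x (ker be (t - x) * ker (1 - be) (x - s))%:E =
   (if s < t then Gamma be * Gamma (1 - be) else 0)%:E)%E.
Proof.
move=> be01; have /andP[be0 be1] := be01.
have be01' : 0 < 1 - be < 1 by rewrite subr_gt0 be1/= ltrBlDr ltrDl.
have [st|ts] := ltP s t; last first.
  apply: integral0_eq => x _; have [xs|xs] := leP x s.
    by rewrite [X in _ * X]ker_le0 ?mulr0// subr_le0.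
  by rewrite ker_le0 ?mul0r// subr_le0 (le_trans ts)// ltW.
pose B r := (\int[mu]_x (ker be (r - x) * ker (1 - be) x)%:E)%E.
have mB r : measurable_fun setT (fun x => (ker be (r - x) * ker (1 - be) x)%:E).
  apply/measurable_EFinP; apply: measurable_funM; last exact: measurable_ker.
  by apply: measurableT_ker; exact: measurable_funB.
have B0 r x : (0 <= (ker be (r - x) * ker (1 - be) x)%:E)%E.
  by rewrite lee_fin mulr_ge0 ?ker_ge0.
transitivity (B (t - s)).
  rewrite /B -(@ge0_integral_translation _ (fun x => (ker be (t - x) * ker (1 - be) (x - s))%:E) s).
  - by apply: eq_integral => x _; rewrite addrK opprD addrA addrAC.
  - apply/measurable_EFinP; apply: measurable_funM; apply: measurableT_ker; exact: measurable_funB.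
  - by move=> x; rewrite lee_fin mulr_ge0 ?ker_ge0.
(* Scaling by [r] contributes [r] from the measure, [r ^ (be - 1)] and [r ^ (- be)] from the
   kernels: the exponents cancel. *)
have scale r : 0 < r -> B r = B 1.
  move=> r0; rewrite /B -(@ge0_integral_affine _ (fun x => (ker be (r - x) * ker (1 - be) x)%:E) r 0)// -ge0_integralZl//; last 2 first.
  - apply/measurable_EFinP; apply: measurable_funM; apply: measurableT_ker.
      by apply: measurable_funB => //; exact: measurable_affine.
    exact: measurable_affine.
  - by rewrite lee_fin ltW.
  apply: eq_integral => x _; rewrite addr0 -EFinM; congr EFin.
  have -> : r - r * x = r * (1 - x) by ring.
  rewrite /ker !pmulr_rgt0//.
  case: ifPn => x1; last by rewrite !mul0r mulr0.
  case: ifPn => x0; last by rewrite !mulr0.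
  rewrite !powRM ?(ltW r0) ?(ltW x0) ?(ltW x1)//.
  have E : r * r `^ (be - 1) * r `^ (1 - be - 1) = 1.
    rewrite -{1}(powRr1 (ltW r0)) -!powRD ?(gt_eqF r0) ?implybT//.
    by rewrite (_ : _ + _ = 0) ?powRr0//; ring.
  transitivity (r * r `^ (be - 1) * r `^ (1 - be - 1) *
    ((1 - x) `^ (be - 1) * x `^ (1 - be - 1))); first by ring.
  by rewrite E mul1r.
rewrite scale ?subr_gt0// EFinM -!integral_ker_expR//.
have G1 : (\int[mu]_x (ker (1 - be) x * expR (- x))%:E < +oo)%E.
  by rewrite integral_ker_expR// ltry.
rewrite muleC.
(* For fixed [x], translating [z] by [x] splits [expR (- z)] into one factor for each kernel. *)
transitivity (\int[mu]_x \int[mu]_z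
    (ker be (z - x) * ker (1 - be) x * expR (- z))%:E)%E; last first.
  have mbe := measurable_ker_expR be.
  rewrite -ge0_integralZr//; last 3 first.
  - exact: measurable_ker_expR.
  - by move=> x _; rewrite lee_fin mulr_ge0 ?ker_ge0 ?expR_ge0.
  - by apply: integral_ge0 => x _; rewrite lee_fin mulr_ge0 ?ker_ge0 ?expR_ge0.
  apply: eq_integral => x _.
  rewrite -(@ge0_integral_translation _ (fun y => (ker be y * expR (- y))%:E) (- x))//; last first.
    by move=> y; rewrite lee_fin mulr_ge0 ?ker_ge0 ?expR_ge0.
  rewrite -ge0_integralZl//; last 3 first.
  - by apply: measurableT_comp mbe _; exact: measurable_funD.
  - by move=> y _; rewrite lee_fin mulr_ge0 ?ker_ge0 ?expR_ge0.
  - by rewrite lee_fin mulr_ge0 ?ker_ge0 ?expR_ge0.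
  apply: eq_integral => z _; rewrite -EFinM; congr EFin.
  have -> : expR (- z) = expR (- (z - x)) * expR (- x) by rewrite -expRD; congr expR; ring.
  by ring.
rewrite (tonelliR (f := fun x z => (ker be (z - x) * ker (1 - be) x * expR (- z))%:E)); last 2 first.
- apply/measurable_EFinP; apply: measurable_funM.
    apply: measurable_funM; apply: measurableT_ker => //.
    by apply: measurable_funB.
  by apply: measurableT_comp => //; apply: measurableT_comp.
- by move=> x z; rewrite lee_fin !mulr_ge0 ?ker_ge0 ?expR_ge0.
transitivity (\int[mu]_z (B 1%R * (if 0 < z then expR (- z) else 0)%:E))%E.
  rewrite ge0_integralZl//; last 3 first.
  - apply/measurable_EFinP; apply: measurable_fun_ifT => //; first exact: measurable_fun_ltr.
    exact: measurableT_comp.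
  - by move=> z _; rewrite lee_fin; case: ifP => // _; exact: expR_ge0.
  - by apply: integral_ge0.
  rewrite (_ : \int[mu]_z _ = 1)%E ?mule1//.
  rewrite -integral_expRN -(integral_itv_obnd_cbnd); last first.
    by apply/measurable_EFinP; apply: measurable_funTS; exact: measurableT_comp.
  rewrite [RHS]integral_mkcond; apply: eq_integral => x _.
  by rewrite patchE mem_setE in_itv/= andbT; case: ifP.
apply: eq_integral => z _.
transitivity (B z * (expR (- z))%:E)%E; last first.
  rewrite /B -ge0_integralZr//.
  exact: mB.
case: ifPn => [z0|]; first by rewrite -(scale z).
rewrite -leNgt => z0; rewrite mule0; apply/esym.
rewrite /B integral0_eq ?mul0e// => x _.
have [x0|x0] := leP x 0; first by rewrite [X in _ * X]ker_le0 ?mulr0.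
by rewrite ker_le0 ?mul0r// subr_le0 (le_trans z0)// ltW.
Qed.

End Kernel.

(** * Fractional integrals on the line *)

Section NonMeasurableIntegral.
Context d (T : measurableType d) (R : realType).
Variable mu : {measure set T -> \bar R}.
Local Open Scope ereal_scope.
Import HBNNSimple.

(** The integral of a nonnegative function, measurable or not, is a supremum over simple functions
    below it. A simple function below [f], set to 0 on a measurable null set containing the
    exceptions, is below [g] and keeps its integral. This covers curves that are only almost
    everywhere equal to measurable ones. *)
Lemma ae_le_ge0_integralT (f g : T -> \bar R) : (forall x, 0 <= f x) ->
  (forall x, 0 <= g x) -> {ae mu, forall x, f x <= g x} ->
  \int[mu]_x f x <= \int[mu]_x g x.
Proof.
move=> f0 g0 [N [mN N0 fgN]].
rewrite [leLHS]ge0_integralTE// [leRHS]ge0_integralTE//.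
apply: ge_ereal_sup => _ [h /= hf <-].
have mCN : measurable (~` N) by exact: measurableC.
pose h' : {nnsfun T >-> R} := mul_nnsfun h (indic_nnsfun R mCN).
apply: (@le_trans _ _ (sintegral mu h')); last first.
  apply: ereal_sup_ubound; exists h' => //= x.
  rewrite /= /mindic indicE; have [xN|xN] := pselect (N x).
    by rewrite memNset ?mulr0//=; apply.
  rewrite mem_set// mulr1; apply: le_trans (hf x) _.
  by apply: contrapT => nfg; apply: xN; exact: fgN.
rewrite -!integralT_nnsfun le_eqVlt; apply/orP; left; apply/eqP.
apply: ae_eq_integral => //; [exact/measurable_EFinP..|].
exists N; split => // x; apply: contra_notP => xN _ /=.
by rewrite /mindic indicE mem_set// mulr1.
Qed.

Lemma ae_eq_ge0_integralT (f g : T -> \bar R) : (forall x, 0 <= f x) ->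
  (forall x, 0 <= g x) -> {ae mu, forall x, f x = g x} ->
  \int[mu]_x f x = \int[mu]_x g x.
Proof.
move=> f0 g0 fg; apply/eqP; rewrite eq_le !ae_le_ge0_integralT//.
- by apply: filterS fg => x ->.
- by apply: filterS fg => x ->.
Qed.

Lemma ae_eq_integral_any (D : set T) (f g : T -> \bar R) :
  ae_eq mu D f g -> \int[mu]_(x in D) f x = \int[mu]_(x in D) g x.
Proof.
move=> fg; rewrite integral_mkcond [RHS]integral_mkcond.
rewrite integralE [RHS]integralE.
have h : {ae mu, forall x, (f \_ D) x = (g \_ D) x}.
  by apply: filterS fg => x; rewrite !patchE; case: ifPn => // /set_mem xD ->.
congr (_ - _); apply: ae_eq_ge0_integralT => //; apply: filterS h => x;
  by rewrite ?funeposE ?funenegE => ->.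
Qed.

Lemma ae_eq_Rintegral (D : set T) (f g : T -> R) :
  ae_eq mu D f g -> Rintegral mu D f = Rintegral mu D g.
Proof.
move=> fg; congr fine; apply: ae_eq_integral_any.
by apply: filterS fg => x + Dx => /(_ Dx) ->.
Qed.

(** The extended integral is then infinite, and [fine] sends it to 0. *)
Lemma Rintegral_eq0 (D : set T) (f : T -> R) : measurable D ->
  measurable_fun D f -> ~ mu.-integrable D (EFin \o f) -> Rintegral mu D f = 0%R.
Proof.
move=> mD mf nf; rewrite /Rintegral.
have mf' : measurable_fun D (EFin \o f) by exact/measurable_EFinP.
have : ~~ (\int[mu]_(x in D) (f x)%:E \is a fin_num).
  apply/negP => h; apply: nf; apply/integrableP; split => //.
  by rewrite integral_fin_num_abs.
by case: (\int[mu]_(x in D) (f x)%:E).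
Qed.

(** Non-integrable [f] are covered too: for nonzero [c], [f] and [c * f] fail to be integrable
    together, and both sides are then 0 by default. *)
Lemma RintegralMl (D : set T) (f : T -> R) (c : R) : measurable D ->
  measurable_fun D f ->
  Rintegral mu D (fun x => c * f x)%R = (c * Rintegral mu D f)%R.
Proof.
move=> mD mf; have [->|c0] := eqVneq c 0%R.
  rewrite mul0r /Rintegral; under eq_integral do rewrite mul0r.
  by rewrite integral0.
have [fi|nf] := pselect (mu.-integrable D (EFin \o f)).
  exact: RintegralZl.
rewrite !Rintegral_eq0 ?mulr0//; first exact: measurable_funM.
move=> h; apply: nf.
have := integrableZl mD c^-1 h; apply: eq_integrable => // x _ /=.
by rewrite -EFinM mulrA mulVf// mul1r.
Qed.

Lemma RintegralMr (D : set T) (f : T -> R) (c : R) : measurable D ->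
  measurable_fun D f ->
  Rintegral mu D (fun x => f x * c)%R = (Rintegral mu D f * c)%R.
Proof.
move=> mD mf; rewrite mulrC -RintegralMl//; congr fine.
by apply: eq_integral => x _; rewrite mulrC.
Qed.

End NonMeasurableIntegral.

(** * Fubini and the fractional integrals as convolutions *)

Section FractionalIntegral.
Context {R : realType}.
Local Notation mu := (@lebesgue_measure R).

Lemma ae_imp (P Q : R -> Prop) : (forall x, P x -> Q x) ->
  {ae mu, forall x, P x} -> {ae mu, forall x, Q x}.
Proof.
by move=> PQ; apply: filterS => //; exact: (ae_filter_ringOfSetsType mu).
Qed.

Lemma ae_imp2 (P Q S : R -> Prop) : (forall x, P x -> Q x -> S x) ->
  {ae mu, forall x, P x} -> {ae mu, forall x, Q x} -> {ae mu, forall x, S x}.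
Proof.
by move=> PQS; apply: filterS2 => //; exact: (ae_filter_ringOfSetsType mu).
Qed.

(** The inner integrals are finite only for almost every parameter; at the others the real integral
    takes a default value, which the outer integral does not see. *)
Lemma fubiniR (F : R -> R -> R) :
  measurable_fun setT (fun z : R * R => F z.1 z.2) ->
  (\int[mu]_x \int[mu]_y (`|F x y|)%:E < +oo)%E ->
  \int[mu]_x \int[mu]_y F x y = \int[mu]_y \int[mu]_x F x y.
Proof.
move=> mF fF.
have mF' : measurable_fun setT (fun z : R * R => (F z.1 z.2)%:E).
  exact/measurable_EFinP.
have iF : (mu \x mu)%E.-integrable setT (fun z : R * R => (F z.1 z.2)%:E).
  exact/integrable12ltyP.
have E1 : (\int[mu]_x ((\int[mu]_y F x y)%:E) = \int[mu]_x \int[mu]_y (F x y)%:E)%E.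
  apply: ae_eq_integral_any.
  apply: filterS (ae_integrable1 iF) => x ix _.
  by rewrite /Rintegral fineK//; exact: integrable_fin_num.
have E2 : (\int[mu]_y ((\int[mu]_x F x y)%:E) = \int[mu]_y \int[mu]_x (F x y)%:E)%E.
  apply: ae_eq_integral_any.
  apply: filterS (ae_integrable2 iF) => x ix _.
  by rewrite /Rintegral fineK//; exact: integrable_fin_num.
rewrite /Rintegral E1 E2; congr fine.
exact: (Fubini iF).
Qed.

(** Tonelli is applied to the positive and negative parts separately, so that parameters with a
    divergent integral are included. *)
Lemma measurable_Rintegral_param (F : R -> R -> R) :
  measurable_fun setT (fun z : R * R => F z.1 z.2) ->
  measurable_fun setT (fun x => \int[mu]_y F x y).
Proof.
move=> mF; have mF' : measurable_fun setT (fun z : R * R => (F z.1 z.2)%:E).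
  exact/measurable_EFinP.
rewrite /Rintegral; apply: measurableT_comp => //.
have E x : (\int[mu]_y (F x y)%:E =
    \int[mu]_y maxe (F x y)%:E 0 - \int[mu]_y maxe (- (F x y)%:E) 0)%E.
  rewrite integralE; congr (_ - _)%E; apply: eq_integral => y _.
    by rewrite funeposE.
  by rewrite funenegE.
under eq_fun do rewrite E.
apply: emeasurable_funB.
- apply: (@measurable_fun_fubini_tonelli_F _ _ _ _ _ mu
    (fun z : R * R => maxe (F z.1 z.2)%:E 0)%E).
    exact: measurable_maxe.
  by move=> z; rewrite le_max lexx orbT.
- apply: (@measurable_fun_fubini_tonelli_F _ _ _ _ _ mu
    (fun z : R * R => maxe (- (F z.1 z.2)%:E) 0)%E).
    by apply: measurable_maxe => //; exact: measurableT_comp.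
  by move=> z; rewrite le_max lexx orbT.
Qed.

(** * Composition of two nonnegative kernels *)

Section ComposeKernel.
Variables (K1 : R -> R) (K2 : R -> R -> R) (c f : R -> R) (C : R).
Hypotheses (mK1 : measurable_fun setT K1) (K10 : forall x, 0 <= K1 x).
Hypotheses (mK2 : measurable_fun setT (fun z : R * R => K2 z.1 z.2)).
Hypotheses (K20 : forall x y, 0 <= K2 x y) (cC : forall y, c y <= C).
Hypothesis cE : (forall y, \int[mu]_x (K1 x * K2 x y)%:E = (c y)%:E)%E.
Hypothesis fi : mu.-integrable setT (EFin \o f).

Let mf : measurable_fun setT f.
Proof. by have /measurable_EFinP := measurable_int mu fi. Qed.

Let mK2x x : measurable_fun setT (fun y => K2 x y * f y).
Proof.
apply: measurable_funM => //.
exact: (measurable_fun_pair2 (f := fun z : R * R => K2 z.1 z.2)).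
Qed.

Let mK1y y : measurable_fun setT (fun x => K1 x * K2 x y).
Proof.
apply: measurable_funM => //.
exact: (measurable_fun_pair1 (f := fun z : R * R => K2 z.1 z.2)).
Qed.

Let mF : measurable_fun setT (fun z : R * R => K1 z.1 * (K2 z.1 z.2 * f z.2)).
Proof.
apply: measurable_funM; first exact: measurableT_comp.
by apply: measurable_funM => //; exact: measurableT_comp.
Qed.

(** Tonelli puts the integral over [x] inside, where it is the composed kernel [c]; the bound [C]
    leaves at most [C] times the L^1 norm of [f]. *)
Let K1K2_lty : (\int[mu]_x \int[mu]_y (`|K1 x * (K2 x y * f y)|)%:E < +oo)%E.
Proof.
have c0 y : 0 <= c y.
  by rewrite -lee_fin -cE; apply: integral_ge0 => x _; rewrite lee_fin mulr_ge0.
rewrite tonelliR//; last by apply/measurable_EFinP; exact: measurableT_comp.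
apply: (@le_lt_trans _ _ (\int[mu]_y (C%:E * `|(f y)%:E|))%E); last first.
  rewrite ge0_integralZl//; last 2 first.
  - by apply: measurableT_comp => //; exact/measurable_EFinP.
  - by rewrite lee_fin (le_trans (c0 0) (cC 0)).
  rewrite lte_mul_pinfty//; first by rewrite lee_fin (le_trans (c0 0) (cC 0)).
  by case/integrableP : fi.
apply: ae_le_ge0_integralT.
- by move=> y; apply: integral_ge0.
- by move=> y; rewrite mule_ge0// lee_fin (le_trans (c0 0) (cC 0)).
apply: nearW => y.
have -> : (\int[mu]_x `|K1 x * (K2 x y * f y)|%:E)%E = ((c y)%:E * `|f y|%:E)%E.
  rewrite -cE -ge0_integralZr//; last 2 first.
  - by apply/measurable_EFinP; exact: mK1y.
  - by move=> x _; rewrite lee_fin mulr_ge0.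
  apply: eq_integral => x _; rewrite -EFinM mulrA normrM ger0_norm// mulr_ge0//.
by rewrite -EFinM lee_fin ler_wpM2r.
Qed.

Lemma integral_compose_kernel :
  \int[mu]_x (K1 x * \int[mu]_y (K2 x y * f y)) = \int[mu]_y (c y * f y).
Proof.
transitivity (\int[mu]_x \int[mu]_y (K1 x * (K2 x y * f y))).
  by apply: eq_Rintegral => x _; rewrite RintegralMl//; exact: mK2x.
rewrite (@fubiniR (fun x y => K1 x * (K2 x y * f y)))//.
apply: eq_Rintegral => y _.
transitivity (\int[mu]_x (K1 x * K2 x y * f y)).
  by apply: eq_Rintegral => x _; rewrite mulrA.
by rewrite RintegralMr//; [rewrite /Rintegral cE|exact: mK1y].
Qed.

Lemma integrable_compose_kernel :
  mu.-integrable setT (fun x => (K1 x * \int[mu]_y (K2 x y * f y))%:E).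
Proof.
have mF' : measurable_fun setT (fun z : R * R => (K1 z.1 * (K2 z.1 z.2 * f z.2))%:E).
  exact/measurable_EFinP.
have iF : (mu \x mu)%E.-integrable setT (fun z : R * R => (K1 z.1 * (K2 z.1 z.2 * f z.2))%:E).
  exact/integrable12ltyP.
have mG : measurable_fun setT (fun x => K1 x * \int[mu]_y (K2 x y * f y)).
  apply: measurable_funM => //.
  apply: (measurable_Rintegral_param (F := fun x y => K2 x y * f y)).
  by apply: measurable_funM => //; exact: measurableT_comp.
apply/integrableP; split; first exact/measurable_EFinP.
have /integrableP[_] := integrable_fubini_F iF; apply: le_lt_trans.
apply: ae_le_ge0_integralT => //.
apply: ae_imp (ae_integrable1 iF) => x ix /=.
rewrite -(RintegralMl mu _ measurableT (mK2x x)).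
have E : (\int[mu]_y (K1 x * (K2 x y * f y)))%:E =
    fubini_F mu (fun z : R * R => (K1 z.1 * (K2 z.1 z.2 * f z.2))%:E) x.
  by rewrite /Rintegral fineK//; exact: (integrable_fin_num measurableT ix).
have := lexx (`|(\int[mu]_y (K1 x * (K2 x y * f y)))%:E|)%E.
by rewrite [X in (_ <= `|X|)%E]E; exact.
Qed.

End ComposeKernel.

(** No base point appears: the kernel cuts the integral at [t], and a density vanishing to the left
    of [a] cuts it at [a]. *)
Definition Il (be : R) (f : R -> R) (t : R) : R :=
  (Gamma be)^-1 * \int[mu]_x (ker be (t - x) * f x).

Definition Ir (be : R) (f : R -> R) (t : R) : R :=
  (Gamma be)^-1 * \int[mu]_x (ker be (x - t) * f x).

Lemma measurable_kerB d (T : measurableType d) (D : set T) be (f g : T -> R) :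
  measurable_fun D f -> measurable_fun D g ->
  measurable_fun D (fun z => ker be (f z - g z)).
Proof. by move=> mf mg; apply: measurableT_ker; exact: measurable_funB. Qed.

Lemma measurable_Il be (f : R -> R) : measurable_fun setT f ->
  measurable_fun setT (Il be f).
Proof.
move=> mf; apply: measurable_funM => //.
apply: (measurable_Rintegral_param (F := fun t x => ker be (t - x) * f x)).
by apply: measurable_funM; [exact: measurable_kerB|exact: measurableT_comp].
Qed.

Lemma measurable_Ir be (f : R -> R) : measurable_fun setT f ->
  measurable_fun setT (Ir be f).
Proof.
move=> mf; apply: measurable_funM => //.
apply: (measurable_Rintegral_param (F := fun t x => ker be (x - t) * f x)).
by apply: measurable_funM; [exact: measurable_kerB|exact: measurableT_comp].
Qed.

Lemma ae_eq_Il be (f g : R -> R) t : ae_eq mu setT f g -> Il be f t = Il be g t.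
Proof.
move=> fg; congr (_ * _); apply: ae_eq_Rintegral.
by apply: filterS fg => x -> .
Qed.

Lemma ae_eq_Ir be (f g : R -> R) t : ae_eq mu setT f g -> Ir be f t = Ir be g t.
Proof.
move=> fg; congr (_ * _); apply: ae_eq_Rintegral.
by apply: filterS fg => x -> .
Qed.

(** The composed kernel is constant for [y < t] and 0 beyond, so the two operators compose to a
    plain primitive, at every [t]. This inverts Abel's equation. *)
Lemma Il_Il be (f : R -> R) t : 0 < be < 1 -> mu.-integrable setT (EFin \o f) ->
  Il be (Il (1 - be) f) t = \int[mu]_(x in `]-oo, t[) f x.
Proof.
move=> be01 fi; have be01' : 0 < 1 - be < 1 by lra.
have /measurable_EFinP mf := measurable_int mu fi.
have G1 := gt_eqF (Gamma_gt0 be01); have G2 := gt_eqF (Gamma_gt0 be01').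
set g := Gamma be * Gamma (1 - be).
have h := @integral_compose_kernel (fun x => ker be (t - x))
  (fun x y => ker (1 - be) (x - y)) (fun y => if y < t then g else 0) f g.
transitivity ((Gamma be)^-1 * \int[mu]_x ((Gamma (1 - be))^-1 * (ker be (t - x) *
   \int[mu]_y (ker (1 - be) (x - y) * f y)))).
  by congr (_ * _); apply: eq_Rintegral => x _; rewrite /Il mulrCA.
rewrite RintegralMl//; last first.
  apply: measurable_funM; first exact: measurable_kerB.
  apply: (measurable_Rintegral_param (F := fun t x => ker (1 - be) (t - x) * f x)).
  by apply: measurable_funM; [exact: measurable_kerB|exact: measurableT_comp].
rewrite h//; last 6 first.
- exact: measurable_kerB.
- by move=> x; exact: ker_ge0.
- exact: measurable_kerB.
- by move=> x y; exact: ker_ge0.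
- by move=> y; case: ifP => // _; rewrite ltW// mulr_gt0// Gamma_gt0.
- by move=> y; exact: integral_ker_ker.
rewrite mulrA -invfM -/g.
transitivity (g^-1 * \int[mu]_x (g * (f \_ `]-oo, t[) x)).
  congr (_ * _); apply: eq_Rintegral => x _.
  by rewrite patchE mem_setE in_itv/=; case: ifP => _; rewrite ?mul0r ?mulr0.
rewrite RintegralMl//; last by apply/(measurable_restrictT _ (measurable_itv _)); exact: measurable_funTS.
by rewrite -Rintegral_mkcond mulrA mulVf ?mul1r// mulf_eq0 G1 G2.
Qed.

Lemma Ir_Ir be (f : R -> R) t : 0 < be < 1 -> mu.-integrable setT (EFin \o f) ->
  Ir be (Ir (1 - be) f) t = \int[mu]_(x in `]t, +oo[) f x.
Proof.
move=> be01 fi; have be01' : 0 < 1 - be < 1 by lra.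
have /measurable_EFinP mf := measurable_int mu fi.
have G1 := gt_eqF (Gamma_gt0 be01); have G2 := gt_eqF (Gamma_gt0 be01').
set g := Gamma be * Gamma (1 - be).
have h := @integral_compose_kernel (fun x => ker be (x - t))
  (fun x y => ker (1 - be) (y - x)) (fun y => if t < y then g else 0) f g.
transitivity ((Gamma be)^-1 * \int[mu]_x ((Gamma (1 - be))^-1 * (ker be (x - t) *
   \int[mu]_y (ker (1 - be) (y - x) * f y)))).
  by congr (_ * _); apply: eq_Rintegral => x _; rewrite /Ir mulrCA.
rewrite RintegralMl//; last first.
  apply: measurable_funM; first exact: measurable_kerB.
  apply: (measurable_Rintegral_param (F := fun t x => ker (1 - be) (x - t) * f x)).
  by apply: measurable_funM; [exact: measurable_kerB|exact: measurableT_comp].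
rewrite h//; last 6 first.
- exact: measurable_kerB.
- by move=> x; exact: ker_ge0.
- exact: measurable_kerB.
- by move=> x y; exact: ker_ge0.
- by move=> y; case: ifP => // _; rewrite ltW// mulr_gt0// Gamma_gt0.
- move=> y; have := @integral_ker_ker R (1 - be) y t be01'.
  rewrite opprB addrCA subrr addr0 /g [Gamma be * _]mulrC => <-.
  by apply: eq_integral => x _; rewrite mulrC.
rewrite mulrA -invfM -/g.
transitivity (g^-1 * \int[mu]_x (g * (f \_ `]t, +oo[) x)).
  congr (_ * _); apply: eq_Rintegral => x _.
  by rewrite patchE mem_setE in_itv/= andbT; case: ifP => _; rewrite ?mul0r ?mulr0.
rewrite RintegralMl//; last by apply/(measurable_restrictT _ (measurable_itv _)); exact: measurable_funTS.
by rewrite -Rintegral_mkcond mulrA mulVf ?mul1r// mulf_eq0 G1 G2.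
Qed.

(** The Beta integral again: the singular term of a curve becomes constant under [I^(1 - be)], and
    this constant is the initial value of the absolutely continuous representative. *)
Lemma Il_ker be (t s : R) : 0 < be < 1 -> s < t ->
  Il (1 - be) (fun x => ker be (x - s)) t = Gamma be.
Proof.
move=> be01 st; have be01' : 0 < 1 - be < 1 by lra.
have := @integral_ker_ker R (1 - be) t s be01'.
rewrite st opprB addrCA subrr addr0 /Il /Rintegral => -> /=.
by rewrite mulrA mulVf ?mul1r// gt_eqF// Gamma_gt0.
Qed.

Lemma Ir_ker be (t s : R) : 0 < be < 1 -> t < s ->
  Ir (1 - be) (fun x => ker be (s - x)) t = Gamma be.
Proof.
move=> be01 ts; have be01' : 0 < 1 - be < 1 by lra.
have := @integral_ker_ker R be s t be01.
rewrite ts /Ir /Rintegral; under eq_integral do rewrite mulrC.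
by move=> -> /=; rewrite mulrCA mulVf ?mulr1// gt_eqF// Gamma_gt0.
Qed.

(** A reflection or a translation carries [[a, b]] into []-oo, b - a]], so the integral of the
    kernel up to [b - a] serves for all [t]. *)
Lemma integral_ker_itvcc (a b be : R) : 0 < be -> exists2 C : R, 0 <= C &
  (forall t, t <= b -> (\int[mu]_(x in `[a, b]) (ker be (t - x))%:E <= C%:E)%E) /\
  (forall t, a <= t -> (\int[mu]_(x in `[a, b]) (ker be (x - t))%:E <= C%:E)%E).
Proof.
move=> be0; have := integral_ker_lty (b - a) be0.
set I := (\int[mu]_(x in _) _)%E => Ioo.
have I0 : (0 <= I)%E by apply: integral_ge0 => x _; rewrite lee_fin ker_ge0.
have Ifin : I \is a fin_num by rewrite ge0_fin_numE.
have mk : measurable_fun setT (fun x : R => (ker be x)%:E).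
  by apply/measurable_EFinP; exact: measurable_ker.
have mk' : measurable_fun setT ((fun x : R => (ker be x)%:E) \_ `]-oo, b - a]).
  by apply/(measurable_restrictT _ (measurable_itv _)); exact: measurable_funTS.
have k0 x : (0 <= ((fun x : R => (ker be x)%:E) \_ `]-oo, (b - a)%R]) x)%E.
  by rewrite patchE; case: ifP => // _; rewrite lee_fin ker_ge0.
exists (fine I); first exact: fine_ge0.
rewrite fineK//; split => t tab; rewrite /I [leRHS]integral_mkcond.
- rewrite -(ge0_integral_reflection t)// integral_mkcond.
  apply: ae_le_ge0_integralT => //.
    by move=> x; rewrite patchE; case: ifP => // _; rewrite lee_fin ker_ge0.
  apply: nearW => x; rewrite !patchE !mem_setE !in_itv/=.
  case: ifPn => [/andP[ax xb]|_]; first by rewrite ifT// lerB.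
  by case: ifP => // _; rewrite lee_fin ker_ge0.
- rewrite -(ge0_integral_translation (- t))// integral_mkcond.
  apply: ae_le_ge0_integralT => //.
    by move=> x; rewrite patchE; case: ifP => // _; rewrite lee_fin ker_ge0.
  apply: nearW => x; rewrite !patchE !mem_setE !in_itv/=.
  case: ifPn => [/andP[ax xb]|_]; first by rewrite ifT// lerB.
  by case: ifP => // _; rewrite lee_fin ker_ge0.
Qed.

(** Fractional integration by parts, for [w] in L^1 against a bounded [phi]: the double integral
    converges absolutely, being at most [B * C] times the L^1 norm of [w], with [C] the uniform
    bound on integrals of the kernel. *)
Lemma Il_Ir_duality (a b be B : R) (w phi : R -> R) : 0 < be ->
  mu.-integrable setT (EFin \o w) -> (forall x, x \notin `[a, b] -> w x = 0) ->
  measurable_fun setT phi -> (forall x, x \notin `[a, b] -> phi x = 0) ->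
  (forall x, `|phi x| <= B) ->
  \int[mu]_x (w x * Il be phi x) = \int[mu]_x (Ir be w x * phi x).
Proof.
move=> be0 wi w0 mphi phi0 phiB.
have /measurable_EFinP mw := measurable_int mu wi.
have [C C0 [kC _]] := @integral_ker_itvcc a b be be0.
have B0 : 0 <= B by apply: le_trans (phiB 0).
have mkp x : measurable_fun setT (fun y : R => ker be (x - y) * phi y).
  by apply: measurable_funM => //; exact: measurable_kerB.
have mkw y : measurable_fun setT (fun x : R => ker be (x - y) * w x).
  by apply: measurable_funM => //; exact: measurable_kerB.
have mF : measurable_fun setT (fun z : R * R => w z.1 * (ker be (z.1 - z.2) * phi z.2)).
  apply: measurable_funM; first exact: measurableT_comp.
  by apply: measurable_funM; [exact: measurable_kerB|exact: measurableT_comp].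
transitivity (\int[mu]_x ((Gamma be)^-1 * \int[mu]_y (w x * (ker be (x - y) * phi y)))).
  by apply: eq_Rintegral => x _; rewrite (RintegralMl mu _ measurableT (mkp x)) /Il mulrCA.
rewrite RintegralMl//; last first.
  exact: (measurable_Rintegral_param (F := fun x y => w x * (ker be (x - y) * phi y))).
rewrite (@fubiniR (fun x y => w x * (ker be (x - y) * phi y)))//; last first.
  apply: (@le_lt_trans _ _ (\int[mu]_x (`|(w x)%:E| * (B * C)%:E))%E); last first.
    case/integrableP : wi => mw' wi.
    rewrite ge0_integralZr//; last 2 first.
    - exact: measurableT_comp.
    - by rewrite lee_fin mulr_ge0.
    by rewrite muleC lte_mul_pinfty// lee_fin mulr_ge0.
  apply: ae_le_ge0_integralT.
  - by move=> y; apply: integral_ge0.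
  - by move=> y; rewrite mule_ge0// lee_fin mulr_ge0.
  apply: nearW => x.
  have [xab|xab] := boolP (x \in `[a, b]); last first.
    rewrite integral0_eq; first by rewrite mule_ge0// lee_fin mulr_ge0.
    by move=> y _; rewrite w0// mul0r normr0.
  rewrite EFinM muleA -EFinM.
  apply: (@le_trans _ _ ((`|w x| * B)%:E * \int[mu]_(y in `[a, b]) (ker be (x - y))%:E))%E; last first.
    rewrite [leRHS]EFinM lee_wpmul2l ?lee_fin ?mulr_ge0//.
    by apply: kC; move: xab; rewrite in_itv/= => /andP[].
  rewrite -ge0_integralZl//; last 3 first.
  - apply/measurable_EFinP; apply: measurable_funTS; exact: measurable_kerB.
  - by move=> y _; rewrite lee_fin ker_ge0.
  - by rewrite lee_fin mulr_ge0.
  rewrite [leRHS]integral_mkcond; apply: ae_le_ge0_integralT => //.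
    move=> y; rewrite patchE; case: ifP => // _.
    by rewrite -EFinM lee_fin !mulr_ge0 ?ker_ge0.
  apply: nearW => y; rewrite patchE mem_setE; case: ifPn => [yab|yab].
    rewrite -EFinM lee_fin !normrM [ `|ker _ _|]ger0_norm ?ker_ge0//.
    by rewrite mulrCA [leRHS]mulrC ler_wpM2l ?ker_ge0// ler_wpM2l.
  by rewrite phi0// mulr0 mulr0 normr0.
rewrite -RintegralMl//; last first.
  apply: (measurable_Rintegral_param (F := fun y x => w x * (ker be (x - y) * phi y))).
  apply: measurable_funM; first exact: measurableT_comp.
  by apply: measurable_funM; [exact: measurable_kerB|exact: measurableT_comp].
apply: eq_Rintegral => y _; rewrite /Ir -mulrA; congr (_ * _).
rewrite -RintegralMr//; last exact: mkw.
by apply: eq_Rintegral => x _; rewrite mulrCA mulrA.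
Qed.

Lemma integrable_itvS (f : R -> R) (D : set R) : measurable D ->
  mu.-integrable setT (EFin \o f) -> mu.-integrable D (EFin \o f).
Proof. by move=> mD; apply: integrableS. Qed.

Lemma derive1_Rintegral (f : R -> R) : mu.-integrable setT (EFin \o f) ->
  {ae mu, forall x, derivable (fun t : R => \int[mu]_(y in `]-oo, t[) f y) x 1 /\
     derive1 (fun t : R => \int[mu]_(y in `]-oo, t[) f y) x = f x}.
Proof.
move=> fi.
have -> : (fun t : R => \int[mu]_(y in `]-oo, t[) f y) = (fun t : R => \int[mu]_(y in `]-oo, t]) f y).
  apply/funext => t; rewrite Rintegral_itv_bndo_bndc//.
  exact: integrable_itvS.
apply: FTC1Ny; first by move=> y; exact: integrable_itvS.
by have := integrable_locally measurableT fi; rewrite patch_setT.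
Qed.

(** By Lebesgue differentiation [f] is almost everywhere the derivative of its primitive. This plays
    the part of the fundamental lemma of the calculus of variations. *)
Lemma ae_eq0_Rintegral (f : R -> R) : mu.-integrable setT (EFin \o f) ->
  (forall t, \int[mu]_(y in `]-oo, t[) f y = 0) -> {ae mu, forall x, f x = 0}.
Proof.
move=> fi f0; apply: ae_imp (derive1_Rintegral fi) => x [_ <-].
rewrite (_ : (fun t => _) = cst 0); first by rewrite derive1_cst.
exact/funext.
Qed.

Lemma Rintegral_abs_cont (f : R -> R) : mu.-integrable setT (EFin \o f) ->
  forall e, 0 < e -> exists2 d : R, 0 < d & forall A, measurable A ->
    (mu A < d%:E)%E -> \int[mu]_(x in A) `|f x| < e.
Proof.
move=> fi e e0; have [d [d0 h]] := integral_normr_continuous fi e0.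
by exists d.
Qed.

End FractionalIntegral.

(** * Absolutely continuous functions are integrals *)

Section AbsolutelyContinuous.
Context {R : realType}.
Local Notation mu := (@lebesgue_measure R).
Implicit Types (a b : R) (F : R -> R).

(* Any finite index type is allowed, so that the partitions of finitely many
   intervals can be used together. *)
Definition ac1 a b F : Prop :=
  forall e : R, 0 < e -> exists2 d : R, 0 < d &
    forall (I : finType) (s t : I -> R),
      (forall i, a <= s i /\ s i <= t i /\ t i <= b) ->
      trivIset setT (fun i => `]s i, t i[%classic) ->
      \sum_i (t i - s i) < d -> \sum_i `|F (t i) - F (s i)| < e.

Lemma ac1_of_ord a b F :
  (forall e : R, 0 < e -> exists2 d : R, 0 < d &
    forall (n : nat) (s t : 'I_n -> R),
      (forall i, a <= s i /\ s i <= t i /\ t i <= b) ->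
      trivIset setT (fun i => `]s i, t i[%classic) ->
      \sum_(i < n) (t i - s i) < d -> \sum_(i < n) `|F (t i) - F (s i)| < e) ->
  ac1 a b F.
Proof.
move=> acF e /acF[d d0 h]; exists d => // I s t st tr sd.
rewrite (reindex_onto (@enum_val I predT) (@enum_rank I))/=; last first.
  by move=> i _; rewrite enum_rankK.
under eq_bigl do rewrite enum_valK eqxx.
apply: (h #|I| (s \o enum_val) (t \o enum_val)) => /=.
- by move=> i; exact: st.
- move=> i j _ _ ij; apply/enum_val_inj/tr => //.
- move: sd; rewrite (reindex_onto (@enum_val I predT) (@enum_rank I))/=; last first.
    by move=> i _; rewrite enum_rankK.
  by under eq_bigl do rewrite enum_valK eqxx.
Qed.

Lemma ac1B a b F G : ac1 a b F -> ac1 a b G -> ac1 a b (F \- G).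
Proof.
move=> aF aG e e0; have e2 : 0 < e / 2 by rewrite divr_gt0.
have [d d0 hF] := aF _ e2; have [d' d0' hG] := aG _ e2.
exists (Num.min d d'); first by rewrite lt_min d0.
move=> I s t st tr; rewrite lt_min => /andP[sd sd'].
rewrite [e]splitr; apply: le_lt_trans (ltrD (hF I s t st tr sd) (hG I s t st tr sd')).
rewrite -big_split/=; apply: ler_sum => i _.
have -> : (F \- G) (t i) - (F \- G) (s i) = (F (t i) - F (s i)) - (G (t i) - G (s i)).
  by rewrite /=; ring.
exact: ler_normB.
Qed.

(** The cells of all the partitions, indexed by pairs (interval, rank), form again a disjoint family
    with the same total length. *)
Lemma ac1_variation a b F : ac1 a b F -> forall e, 0 < e ->
  exists2 d : R, 0 < d & forall (I : finType) (s t : I -> R) (p : I -> seq R),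
    (forall i, a <= s i /\ t i <= b) ->
    (forall i, itv_partition (s i) (t i) (p i)) ->
    trivIset setT (fun i => `]s i, t i[%classic) ->
    \sum_i (t i - s i) < d -> \sum_i variation (s i) (t i) F (p i) < e.
Proof.
move=> aF e /aF[d d0 h]; exists d => // I s t p st hp tr sd.
pose J := {i : I & 'I_(size (p i))}.
pose x (i : I) (k : nat) := nth (t i) (s i :: p i) k.
pose S (j : J) := x (tag j) (tagged j); pose T (j : J) := x (tag j) (tagged j).+1.
have xlt i k : (k < size (p i))%N -> x i k < x i k.+1.
  by move=> kp; have [/(pathP (t i)) + _] := hp i; exact.
have xle i k l : (k <= l)%N -> (l <= size (p i))%N -> x i k <= x i l.
  move=> /subnK <-; elim: (l - k)%N => [|n ih]; first by rewrite add0n.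
  rewrite addSn => lp; apply: le_trans (ih (ltnW lp)) _.
  exact/ltW/xlt.
have x0 i : x i 0%N = s i by [].
have xs i : x i (size (p i)) = t i by rewrite /x (itv_partition_nth_size _ (hp i)).
have SE (G : R -> R -> R) : \sum_(j : J) G (T j) (S j) =
    \sum_i \sum_(0 <= k < size (p i)) G (x i k.+1) (x i k).
  under [RHS]eq_bigr do rewrite big_mkord.
  by rewrite sig_big_dep.
have := h J S T; rewrite (SE (fun u v => `|F u - F v|)); apply.
- move=> [i k]; rewrite /S /T /=; have [ai ib] := st i.
  have kp := ltn_ord k; split; last split.
  + by rewrite (le_trans ai)// -x0 xle// ltnW.
  + exact/ltW/xlt.
  + by rewrite (le_trans _ ib)// -xs xle.
- move=> [i k] [j l] _ _ [z []]; rewrite /S /T /= !in_itv/= => /andP[z1 z2] /andP[z3 z4].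
  have ij : i = j.
    apply: tr => //; exists z; split; rewrite /= in_itv/=; apply/andP; split.
    + by apply: le_lt_trans z1; rewrite -x0 xle// ltnW.
    + by apply: lt_le_trans z2 _; rewrite -xs xle.
    + by apply: le_lt_trans z3; rewrite -x0 xle// ltnW.
    + by apply: lt_le_trans z4 _; rewrite -xs xle.
  subst j; congr (existT _ _ _); apply: val_inj => /=.
  have [kl|lk|//] := ltngtP k l.
  + have := lt_trans z3 z2; rewrite ltNge xle// ltnW//.
  + have := lt_trans z1 z4; rewrite ltNge xle// ltnW//.
- rewrite (SE (fun u v => u - v)); under eq_bigr do rewrite telescope_sumr// xs x0.
  exact: sd.
Qed.

(** A partition of each interval that is optimal up to [eta / (#|I| + 1)] reduces total variations
    to partition sums, with an error of at most [eta] altogether. *)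
Lemma ac1_total_variation a b F : ac1 a b F -> forall e, 0 < e ->
  exists2 d : R, 0 < d & forall (I : finType) (s t : I -> R),
    (forall i, a <= s i /\ s i <= t i /\ t i <= b) ->
    trivIset setT (fun i => `]s i, t i[%classic) ->
    \sum_i (t i - s i) < d ->
    (forall i, total_variation (s i) (t i) F \is a fin_num) ->
    \sum_i fine (total_variation (s i) (t i) F) <= e.
Proof.
move=> aF e e0; have [d d0 h] := ac1_variation aF e0.
exists d => // I s t st tr sd fTV.
apply/ler_addgt0Pr => eta eta0.
pose eta' := eta / (#|I|.+1)%:R.
have eta'0 : 0 < eta' by rewrite divr_gt0.
have /choice[p hp] i : exists p, itv_partition (s i) (t i) p /\
    fine (total_variation (s i) (t i) F) - eta' <= variation (s i) (t i) F p.
  have := ub_ereal_sup_adherent eta'0 (fTV i).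
  move=> [_ [_ [p sp <-] <-]]; rewrite -/(total_variation _ _ _) -(fineK (fTV i)).
  by rewrite -EFinB lte_fin => /ltW hh; exists p.
apply: (@le_trans _ _ (\sum_i (variation (s i) (t i) F (p i) + eta'))).
  by apply: ler_sum => i _; rewrite -lerBlDr; have [] := hp i.
rewrite big_split/= sumr_const lerD//.
  apply/ltW/h => //; first by move=> i; have [? []] := st i.
  by move=> i; have [] := hp i.
rewrite -mulr_natr /eta' mulrAC -mulrA ler_piMr// ?(ltW eta0)//.
by rewrite ler_pdivrMr// mul1r ler_nat.
Qed.

(** With [d] attached to the tolerance 1, an interval shorter than [d] has variation at most 1;
    finitely many steps of length [d / 2] reach [b]. *)
Lemma ac1_total_variation_fin a b F : a <= b -> ac1 a b F ->
  total_variation a b F \is a fin_num.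
Proof.
move=> ab aF; have [d d0 h] := ac1_variation aF ltr01.
have small x y : a <= x -> x <= y -> y <= b -> y - x < d ->
    total_variation x y F \is a fin_num.
  move=> ax xy yb xyd; apply/bounded_variationP => //.
  exists 1 => _ [p xyp <-].
  have := h unit (fun=> x) (fun=> y) (fun=> p).
  rewrite !big_const /= !card_unit /= !addr0 => hh; apply/ltW/hh => //.
  by move=> [] [].
have steps n x : a <= x -> x <= b -> x - a < d / 2 *+ n -> total_variation a x F \is a fin_num.
  elim: n x => [|n ih] x ax xb; first by rewrite mulr0n subr_lt0 ltNge ax.
  have [xd _|xd] := ltP (x - a) d; first exact: small.
  rewrite mulrS => xn; rewrite (@total_variationD _ _ _ (x - d / 2)); last 2 first.
  - by rewrite lerBrDr -lerBrDl (le_trans _ xd)// ler_pdivrMr// ler_pMr// ler1n.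
  - by rewrite gerBl divr_ge0// ltW.
  rewrite fin_numD ih/= ?small//.
  - by rewrite lerBrDr -lerBrDl (le_trans _ xd)// ler_pdivrMr// ler_pMr// ler1n.
  - by rewrite gerBl divr_ge0// ltW.
  - by rewrite opprB addrC subrK ltr_pdivrMr// ltr_pMr// ltr1n.
  - by rewrite lerBrDr -lerBrDl (le_trans _ xd)// ler_pdivrMr// ler_pMr// ler1n.
  - by rewrite (le_trans _ xb)// gerBl divr_ge0// ltW.
  - by rewrite addrAC ltrBlDl.
apply: (steps (Num.truncn ((b - a) / (d / 2))).+1) => //.
rewrite -mulr_natr -ltr_pdivrMl ?divr_gt0// mulrC.
exact: truncnS_gt.
Qed.

Lemma ac1_uniform_continuous a b F : ac1 a b F -> forall e, 0 < e ->
  exists2 d : R, 0 < d & forall x y, a <= x <= b -> a <= y <= b ->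
    `|x - y| < d -> `|F x - F y| < e.
Proof.
move=> aF e /aF[d d0 h]; exists d => // x y.
wlog xy : x y / y <= x.
  move=> hw xab yab xyd; have [yx|/ltW xy] := leP y x; first exact: hw.
  by rewrite distrC hw// distrC.
move=> /andP[ax xb] /andP[ay yb]; rewrite (ger0_norm (_ : 0 <= x - y)) ?subr_ge0// => xyd.
have := h unit (fun=> y) (fun=> x).
rewrite !big_const /= !card_unit /= !addr0; apply => //.
by move=> [] [].
Qed.

Lemma mesh_between (f : nat -> R) (x : R) (n : nat) : f 0%N < x -> x <= f n ->
  exists2 j, (j < n)%N & f j < x <= f j.+1.
Proof.
elim: n => [|n ih] f0 fn; first by have := lt_le_trans f0 fn; rewrite ltxx.
have [xn|nx] := leP x (f n); last by exists n => //; rewrite nx fn.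
by have [j jn jx] := ih f0 xn; exists j => //; exact: ltnW.
Qed.

(** An open [U] is approximated from inside by the cells of a uniform mesh that lie in [U]: finitely
    many disjoint intervals of total length below [d], to which the absolute continuity of [G]
    applies. Refining the mesh captures every point of [U] in []a, b]]. *)
Lemma ac1_open_small a b G (nu : {measure set (measurableTypeR R) -> \bar R}) : a < b ->
  ac1 a b G ->
  (forall x y, a <= x -> x <= y -> y <= b -> nu `]x, y]%classic = (G y - G x)%:E) ->
  forall e, 0 < e -> exists2 d : R, 0 < d & forall U : set R, open U ->
    (mu U < d%:E)%E -> (nu (U `&` `]a, b]) <= e%:E)%E.
Proof.
move=> ab aG nuE e /aG[d d0 h]; exists d => // U oU Ud.
have mU : measurable U by exact: open_measurable.
pose x n j : R := a + (b - a) * (j%:R / n.+1%:R).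
have xle n j l : (j <= l)%N -> x n j <= x n l.
  by move=> jl; rewrite lerD2l ler_wpM2l ?subr_ge0 ?(ltW ab)// ler_pM2r// ler_nat.
have x0 n : x n 0%N = a by rewrite /x mul0r mulr0 addr0.
have xn n : x n n.+1 = b by rewrite /x divff// mulr1 addrC subrK.
pose c n (j : 'I_n.+1) := `]x n j, x n j.+1]%classic.
pose P n (j : 'I_n.+1) := `[< c n j `<=` U >].
pose U_ n := \big[setU/set0]_(j < n.+1 | P n j) c n j.
have mc n j : measurable (c n j) by exact: measurable_itv.
have cx n (j k : 'I_n.+1) z : c n j z -> c n k z -> (j <= k)%N.
  rewrite /c /= !in_itv/= => /andP[z1 z2] /andP[z3 z4]; rewrite leqNgt; apply/negP => jk.
  by have := lt_le_trans z1 z4; rewrite ltNge xle.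
have tc n : trivIset setT (c n).
  move=> j k _ _ [z [zj zk]]; apply/val_inj/eqP.
  by rewrite eqn_leq (cx n j k z)// (cx n k j z).
have mU_ n : measurable (U_ n) by apply: bigsetU_measurable => j _; exact: mc.
have U_U n : U_ n `<=` U.
  by move=> z; rewrite /U_ -bigcup_seq_cond => -[j /= /andP[_ /asboolP]]; apply.
have nuU_ n : (nu (U_ n) <= e%:E)%E.
  rewrite measure_bigsetU_ord//; last by move=> j; exact: measurable_itv.
  have cE (j : 'I_n.+1) : nu (c n j) = (G (x n j.+1) - G (x n j))%:E.
    rewrite nuE//; first by rewrite -[X in X <= _](x0 n) xle.
    - exact: xle.
    - by rewrite -[X in _ <= X](xn n) xle.
  rewrite (eq_bigr (fun j : 'I_n.+1 => (G (x n j.+1) - G (x n j))%:E)); last first.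
    by move=> j _; exact: cE.
  rewrite sumEFin lee_fin.
  (* Rejected cells become the empty interval at [a], so that the full index type can be kept. *)
  pose s (j : 'I_n.+1) := if P n j then x n j else a.
  pose t (j : 'I_n.+1) := if P n j then x n j.+1 else a.
  apply: (@le_trans _ _ (\sum_j `|G (t j) - G (s j)|)).
    rewrite big_mkcond; apply: ler_sum => j _; rewrite /s /t.
    by case: ifP => _; rewrite ?ler_norm.
  apply/ltW/h.
  - move=> j; rewrite /s /t; case: ifP => _; last by rewrite lexx ltW.
    split; first by rewrite -[X in X <= _](x0 n) xle.
    by split; [exact: xle|rewrite -[X in _ <= X](xn n) xle].
  - move=> j k _ _ [z []]; rewrite /s /t.
    case: ifP => _; last by rewrite /= in_itv/= => /andP[/lt_trans zz /zz]; rewrite ltxx.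
    case: ifP => _; last by move=> _; rewrite /= in_itv/= => /andP[/lt_trans zz /zz]; rewrite ltxx.
    rewrite /= !in_itv/= => /andP[z1 z2] /andP[z3 z4]; apply: (tc n) => //.
    by exists z; split; rewrite /c /= in_itv/=; apply/andP; split => //; exact: ltW.
  - rewrite -lte_fin; apply: le_lt_trans Ud.
    apply: le_trans (le_measure mu _ _ (U_U n)); rewrite ?inE//.
    2: exact: mU_.
    rewrite measure_bigsetU_ord//; last by move=> j; exact: measurable_itv.
    rewrite -sumEFin [leRHS]big_mkcond; apply: lee_sum => j _.
    rewrite /s /t; case: ifP => _; last by rewrite subrr.
    have xj : x n j < x n j.+1.
      by rewrite ltrD2l ltr_pM2l ?subr_gt0// ltr_pM2r// ltr_nat.
    by have := @lebesgue_measure_itv R `]x n j, x n j.+1]; rewrite /= lte_fin xj => ->.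
(* The meshes are not nested, so [U_ n] need not increase with [n]; intersecting over [n >= N]
   restores monotonicity. *)
pose V N := \bigcap_(n in [set n | (N <= n)%N]) U_ n.
have mV N : measurable (V N) by apply: bigcap_measurable => //; exists N => /=.
have mbV : measurable (\bigcup_N V N) by apply: bigcup_measurable => k _; exact: mV.
have cvV : nu \o V @ \oo --> nu (\bigcup_N V N).
  apply: nondecreasing_cvg_mu => //.
  move=> N M NM; rewrite subsetEset => z Vz n /= Mn; apply: Vz => /=.
  exact: leq_trans Mn.
apply: (@le_trans _ _ (nu (\bigcup_N V N))).
  apply: le_measure; rewrite ?inE//.
  - by apply: measurableI => //; exact: measurable_itv.
  move=> z [Uz]; rewrite /= in_itv/= => /andP[az zb].
  have /nbhs_ballP[r /= r0 rU] : nbhs z U by exact: open_nbhs_nbhs.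
  (* From this rank on the cells are shorter than [r], so the one containing [z] stays in the ball
     around [z]. *)
  exists (Num.truncn ((b - a) / r)) => // n /= Nn.
  have hr : (b - a) / n.+1%:R < r.
    rewrite ltr_pdivrMr// mulrC -ltr_pdivrMr//.
    by apply: lt_le_trans (truncnS_gt _) _; rewrite ler_nat ltnS.
  have [j jn jz] : exists2 j, (j < n.+1)%N & x n j < z <= x n j.+1.
    by apply: mesh_between; rewrite ?x0 ?xn.
  rewrite /U_ -bigcup_seq_cond; exists (Ordinal jn) => /=; last by rewrite /c /= in_itv.
  rewrite mem_index_enum /=; apply/asboolP => y; rewrite /c /= in_itv/= => /andP[y1 y2]; apply: rU.
  move: jz => /andP[z1 z2]; rewrite /ball/= ltr_norml.
  have xx : x n j.+1 = x n j + (b - a) / n.+1%:R.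
    by rewrite /x -[j.+1%:R]natr1 [(_ + 1) / _]mulrDl mul1r mulrDr addrA.
  rewrite xx in y2 z2.
  have key (u v w k : R) : u < v -> u < w -> v <= u + k -> w <= u + k -> k < r ->
    - r < v - w < r by move=> *; apply/andP; split; lra.
  exact: key z1 y1 z2 y2 hr.
rewrite -(cvg_lim _ cvV)//; apply: lime_le; first by apply/cvg_ex; eexists; exact: cvV.
apply: nearW => N /=; apply: le_trans (nuU_ N); apply: le_measure; rewrite ?inE//.
- exact: mV.
- exact: mU_.
- by move=> z Vz; exact: (Vz N (leqnn N)).
Qed.

(* The Stieltjes measure of [G] is absolutely continuous: Radon-Nikodym. *)
Lemma ac1_nondecreasing_integral a b G : a < b ->
  (forall x y, a <= x -> x <= y -> y <= b -> G x <= G y) -> ac1 a b G ->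
  exists f : R -> R, [/\ mu.-integrable setT (EFin \o f),
    forall x, x \notin `[a, b] -> f x = 0 &
    forall t, a <= t <= b -> G t = G a + \int[mu]_(x in `]-oo, t[) f x].
Proof.
move=> ab ndG aG.
(* A cumulative function lives on the whole line: [G] is extended by its two end values, which
   preserves monotonicity and continuity. *)
pose clamp (x : R) := Num.max a (Num.min x b).
have clampP x : a <= clamp x <= b.
  by rewrite /clamp le_max lexx/= ge_max (ltW ab) ge_min lexx orbT.
have clamp_id x : a <= x <= b -> clamp x = x.
  by move=> /andP[ax xb]; rewrite /clamp min_l// max_r.
have clamp_nd x y : x <= y -> clamp x <= clamp y.
  by move=> xy; rewrite /clamp ge_max !le_max lexx/= !le_min !ge_min lexx xy !orbT.
have clamp_lip x y : `|clamp x - clamp y| <= `|x - y|.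
  wlog xy : x y / y <= x.
    move=> hw; have [yx|/ltW xy] := leP y x; first exact: hw.
    by rewrite distrC [leRHS]distrC hw.
  rewrite !ger0_norm ?subr_ge0 ?clamp_nd// /clamp.
  have mx (u v : R) : v <= u -> Num.max a u - Num.max a v <= u - v.
    by move=> vu; case: (leP a u) => h1; case: (leP a v) => h2; lra.
  have mn (u v : R) : v <= u -> Num.min v b <= Num.min u b /\ Num.min u b - Num.min v b <= u - v.
    by move=> vu; case: (leP u b) => h1; case: (leP v b) => h2; split; lra.
  have [h1 h2] := mn _ _ xy; exact: le_trans (mx _ _ h1) h2.
pose g0 x := G (clamp x).
have g0nd : nondecreasing g0.
  move=> x y xy; rewrite /g0; have /andP[? _] := clampP x; have /andP[_ ?] := clampP y.
  by apply: ndG => //; exact: clamp_nd.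
have g0c : right_continuous g0.
  apply: right_continuousW => x; apply/cvgrPdist_lt => e e0.
  have [d d0 h] := ac1_uniform_continuous aG e0.
  near=> y; apply: h => //; apply: le_lt_trans (clamp_lip _ _) _.
  by near: y; exact: cvgr_dist_lt.
pose g : cumulative R R := HB.pack g0 (isCumulative.Build R _ R g0 g0nd g0c).
pose nu : {measure set (measurableTypeR R) -> \bar R} := lebesgue_stieltjes_measure g.
have nuE x y : a <= x -> x <= y -> y <= b -> nu `]x, y]%classic = (G y - G x)%:E.
  move=> ax xy yb; rewrite /nu /lebesgue_stieltjes_measure /measure_extension.
  transitivity (wlength g `]x, y]%classic).
    by apply: measurable_mu_extE; exact: is_ocitv.
  rewrite wlength_itv_bnd// /g /= /g0 !clamp_id// ?ax ?(le_trans xy yb)//.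
  by rewrite (le_trans ax xy).
have mab : measurable (`]a, b]%classic : set (measurableTypeR R)) by exact: measurable_itv.
have nufin : (nu `]a, b]%classic < +oo)%E by rewrite nuE ?ltry// ltW.
pose nu' : {finite_measure set (measurableTypeR R) -> \bar R} := mfrestr mab nufin.
(* By outer regularity a null set lies in an open set of measure below [d], so smallness on open
   sets suffices. *)
have dom : nu' `<< mu.
  apply/null_content_dominatesP => A mA A0.
  apply/eqP; rewrite eq_le measure_ge0 andbT; apply/lee_addgt0Pr => e e0.
  rewrite add0e; have [d d0 h] := ac1_open_small ab aG nuE e0.
  have Aoo : (mu A < +oo)%E by rewrite A0.
  have [U [oU AU UA]] := lebesgue_regularity_outer mA Aoo d0.
  have mU : measurable U by exact: open_measurable.
  apply: (@le_trans _ _ (nu (U `&` `]a, b]))); last first.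
    apply: h => //; apply: le_lt_trans UA.
    have -> : mu U = (mu (U `\` A) + mu (U `&` A))%E by exact: measureDI.
    by rewrite (setIidr AU) [X in (_ + X)%E]A0 adde0.
  rewrite /nu' /= /mfrestr /mrestr; apply: le_measure; rewrite ?inE.
  - exact: measurableI.
  - exact: measurableI.
  - exact: setSI.
pose f0 := Radon_Nikodym_SigmaFinite.f nu' mu.
have f0i : mu.-integrable setT f0 by exact: Radon_Nikodym_SigmaFinite.f_integrable.
have f0fin x : f0 x \is a fin_num by exact: Radon_Nikodym_SigmaFinite.f_fin_num.
have f0E A : measurable A -> nu' A = (\int[mu]_(x in A) f0 x)%E.
  by move=> mA; exact: Radon_Nikodym_SigmaFinite.f_integral.
have fi : mu.-integrable setT (EFin \o ((fine \o f0) \_ `]a, b])).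
  rewrite -restrict_EFin; apply/integrable_restrict => //.
  rewrite setTI; apply: (integrableS measurableT) => //.
  by apply: eq_integrable f0i => // x _ /=; rewrite fineK.
exists ((fine \o f0) \_ `]a, b]); split => //.
- move=> x; rewrite in_itv/= patchE mem_setE in_itv/=; case: ifP => // /andP[ax xb].
  by rewrite xb ltW.
- move=> t /andP[at_ tb].
  have := nuE a t (lexx a) at_ tb.
  have -> : nu `]a, t]%classic = nu' `]a, t]%classic.
    rewrite /nu' /= /mfrestr /mrestr; congr (nu _).
    apply/seteqP; split => x /=; last by case.
    by rewrite !in_itv/= => /andP[-> xt]; rewrite xt (le_trans xt tb).
  rewrite f0E// => E.
  have -> : \int[mu]_(x in `]-oo, t[) ((fine \o f0) \_ `]a, b]) x = G t - G a; last first.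
    by rewrite addrC subrK.
  rewrite Rintegral_itv_bndo_bndc//; last exact: integrable_itvS.
  rewrite /Rintegral -[RHS]/(fine (G t - G a)%:E) -E; congr fine.
  rewrite integral_mkcond [RHS]integral_mkcond; apply: eq_integral => x _.
  rewrite !patchE !mem_setE !in_itv/=.
  case: (leP x t) => xt; rewrite ?andbF//= andbT.
  case: (ltP a x) => ax //=; rewrite ifT ?fineK//.
  exact: le_trans tb.
Unshelve. all: by end_near. Qed.

(* [F] is the difference of its total variation [T] and of [T - F], which are
   nondecreasing and absolutely continuous. *)
Lemma ac1_integral a b F : a < b -> ac1 a b F ->
  exists f : R -> R, [/\ mu.-integrable setT (EFin \o f),
    forall x, x \notin `[a, b] -> f x = 0 &
    forall t, a <= t <= b -> F t = F a + \int[mu]_(x in `]-oo, t[) f x].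
Proof.
move=> ab aF.
have fTV x y : a <= x -> x <= y -> y <= b -> total_variation x y F \is a fin_num.
  move=> ax xy yb; have := ac1_total_variation_fin (ltW ab) aF.
  rewrite (total_variationD _ (le_trans ax xy) yb) (total_variationD _ ax xy).
  by rewrite !fin_numD => /andP[/andP[_ ->]].
pose T x := fine (total_variation a x F).
have TB x y : a <= x -> x <= y -> y <= b -> T y - T x = fine (total_variation x y F).
  move=> ax xy yb; rewrite /T (total_variationD _ ax xy) fineD ?fTV// ?(le_trans xy yb)//.
  by rewrite addrC addKr.
have Tnd x y : a <= x -> x <= y -> y <= b -> T x <= T y.
  move=> ax xy yb; rewrite -subr_ge0 TB// fine_ge0//.
  exact: total_variation_ge0.
have FT x y : a <= x -> x <= y -> y <= b -> `|F y - F x| <= T y - T x.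
  move=> ax xy yb; rewrite TB// -lee_fin fineK ?fTV//.
  exact: total_variation_ge.
have aT : ac1 a b T.
  move=> e e0; have e2 : 0 < e / 2 by rewrite divr_gt0.
  have [d d0 h] := ac1_total_variation aF e2.
  exists d => // I s t st tr sd.
  apply: (@le_lt_trans _ _ (e / 2)); last by rewrite ltr_pdivrMr// ltr_pMr// ltr1n.
  apply: le_trans (h I s t st tr sd _); last by move=> i; have [? []] := st i; exact: fTV.
  apply: ler_sum => i _; have [asi [sti tib]] := st i.
  by rewrite -TB// ger0_norm// subr_ge0 Tnd.
have [f [fi f0 fE]] := ac1_nondecreasing_integral ab Tnd aT.
have TFnd x y : a <= x -> x <= y -> y <= b -> (T \- F) x <= (T \- F) y.
  move=> ax xy yb /=; have := FT _ _ ax xy yb; rewrite ler_norml => /andP[_].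
  lra.
have [g [gi g0 gE]] := ac1_nondecreasing_integral ab TFnd (ac1B aT aF).
exists (f \- g); split.
- by have := integrableB measurableT fi gi; apply: eq_integrable.
- by move=> x xab /=; rewrite f0// g0// subrr.
- move=> t tab; have := fE t tab; have := gE t tab => /= E1 E2.
  rewrite RintegralB//; [lra|exact: integrable_itvS..].
Qed.

End AbsolutelyContinuous.

(** * From coordinates to vectors, and the absolutely continuous representatives *)

Section Vectors.
Context {R : realType}.
Local Notation mu := (@lebesgue_measure R).
Variable m : nat.

Lemma enorm_ge0 (x : 'rV[R]_m) : 0 <= enorm x.
Proof. exact: sqrtr_ge0. Qed.

Lemma coord_le_enorm (x : 'rV[R]_m) i : `|x ord0 i| <= enorm x.
Proof.
rewrite /enorm -sqrtr_sqr ler_wsqrtr// (bigD1 i)//= lerDl.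
by apply: sumr_ge0 => j _; exact: sqr_ge0.
Qed.

Lemma enorm_le_sum (x : 'rV[R]_m) : enorm x <= \sum_i `|x ord0 i|.
Proof.
have s0 : 0 <= \sum_i `|x ord0 i| by apply: sumr_ge0.
rewrite -(ger0_norm s0) -sqrtr_sqr /enorm ler_wsqrtr//.
rewrite expr2 mulr_sumr; apply: ler_sum => i _.
rewrite -real_normK ?num_real// expr2 ler_wpM2r// (bigD1 i)//= lerDl.
by apply: sumr_ge0.
Qed.

Lemma abs_cont_ac1 a b (F : R -> 'rV[R]_m) i : abs_cont a b F ->
  ac1 a b (fun t => F t ord0 i).
Proof.
move=> aF; apply: ac1_of_ord => e /aF[d d0 h]; exists d => // n s t st tr sd.
apply: le_lt_trans (h n s t st tr sd); apply: ler_sum => j _.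
by apply: le_trans (coord_le_enorm _ i); rewrite !mxE.
Qed.

Lemma ac1_abs_cont a b (F : R -> 'rV[R]_m) : (forall i, ac1 a b (fun t => F t ord0 i)) ->
  abs_cont a b F.
Proof.
move=> aF e e0; pose e' := e / m.+1%:R.
have e'0 : 0 < e' by rewrite divr_gt0.
have /choice[d hd] i : exists d : R, 0 < d /\ forall (I : finType) (s t : I -> R),
      (forall i, a <= s i /\ s i <= t i /\ t i <= b) ->
      trivIset setT (fun i => `]s i, t i[%classic) ->
      \sum_i (t i - s i) < d -> \sum_j `|F (t j) ord0 i - F (s j) ord0 i| < e'.
  by have [d d0 h] := aF i e' e'0; exists d.
exists (\big[Num.min/1]_i d i).
  by elim/big_ind : _ => // [x y x0 y0|i _]; [rewrite lt_min x0|have [] := hd i].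
move=> n s t st tr sd.
apply: (@le_lt_trans _ _ (\sum_(j < n) \sum_i `|F (t j) ord0 i - F (s j) ord0 i|)).
  apply: ler_sum => j _; apply: le_trans (enorm_le_sum _) _.
  by apply: ler_sum => i _; rewrite !mxE.
rewrite exchange_big/=.
apply: (@le_lt_trans _ _ (\sum_(i < m) e')).
  apply: ler_sum => i _; have [_ h] := hd i; apply/ltW/h => //.
  by apply: lt_le_trans sd _; exact: bigmin_le_cond.
rewrite sumr_const card_ord -mulr_natr /e' mulrAC ltr_pdivrMr// ltr_pM2l// ltr_nat.
exact: ltnSn.
Qed.

Lemma ac1_Rintegral a b c (f : R -> R) : mu.-integrable setT (EFin \o f) ->
  ac1 a b (fun t => c + \int[mu]_(x in `]-oo, t[) f x).
Proof.
move=> fi e e0; have [d d0 h] := Rintegral_abs_cont fi e0.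
have mf := measurable_int mu fi.
exists d => // I s t st tr sd.
pose A := \big[setU/set0]_i `]s i, t i[%classic : set R.
have [mA muA] : measurable A /\ (mu A <= (\sum_i (t i - s i))%:E)%E.
  apply: (big_ind2 (fun X r => measurable X /\ (mu X <= r%:E)%E)).
  - by split => //; rewrite measure0.
  - move=> X r Y r' [mX hX] [mY hY]; split; first exact: measurableU.
    by apply: le_trans (measureU2 _ _ _) _ => //; rewrite EFinD leeD.
  - move=> i _; split; first exact: measurable_itv.
    have [_ [sti _]] := st i.
    rewrite lebesgue_measure_itv/= lte_fin; case: ifP => // _.
    by rewrite lee_fin subr_ge0.
have Ad : (mu A < d%:E)%E by apply: le_lt_trans muA _; rewrite lte_fin.
apply: le_lt_trans (h A mA Ad).
have nfi := integrable_norm fi.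
have nfiD D : measurable D -> mu.-integrable D (EFin \o (fun x => `|f x|)).
  by move=> mD; exact: integrable_itvS.
have -> : \int[mu]_(x in A) `|f x| = \sum_i \int[mu]_(x in `]s i, t i[) `|f x|.
  apply: EFin_inj; rewrite -sumEFin /Rintegral fineK; last first.
    by apply: integrable_fin_num => //; exact: nfiD.
  rewrite integral_bigsetU_EFin//; last 3 first.
  - by rewrite index_enum_uniq.
  - by apply: sub_trivIset tr.
  - by apply: measurable_funTS; exact: measurable_int nfi.
  apply: eq_bigr => i _; rewrite fineK//.
  by apply: integrable_fin_num => //; exact: nfiD.
apply: ler_sum => i _; have [_ [sti _]] := st i.
have [->|/eqP stne] := eqVneq (t i) (s i).
  by rewrite subrr normr0 Rintegral_ge0.
have stlt : s i < t i by rewrite lt_neqAle sti andbT eq_sym; apply/eqP.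
rewrite opprD addrACA subrr add0r [X in _ - X]Rintegral_itv_bndo_bndc; last exact: integrable_itvS.
rewrite Rintegral_itvB//; last exact: integrable_itvS.
by apply: le_normr_Rintegral => //; exact: integrable_itvS.
Qed.

Lemma Rintegral_gtE (f : R -> R) t : mu.-integrable setT (EFin \o f) ->
  \int[mu]_(x in `]t, +oo[) f x = \int[mu]_x f x - \int[mu]_(x in `]-oo, t[) f x.
Proof.
move=> fi; rewrite [X in _ - X]Rintegral_itv_bndo_bndc; last exact: integrable_itvS.
rewrite -set_itvNyy Rintegral_itvB// set_itvNyy; exact: fi.
Qed.

Lemma ac1_gt_Rintegral a b c (f : R -> R) : mu.-integrable setT (EFin \o f) ->
  ac1 a b (fun t => c + \int[mu]_(x in `]t, +oo[) f x).
Proof.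
move=> fi e e0; have [d d0 h] := @ac1_Rintegral a b 0 f fi e e0.
exists d => // I s t st tr sd; apply: le_lt_trans (h I s t st tr sd).
apply: ler_sum => i _; rewrite !Rintegral_gtE//.
by rewrite le_eqVlt -normrN; apply/orP; left; apply/eqP; congr (`|_|); ring.
Qed.

Lemma derive1_cstD (c x : R) (G : R -> R) : derivable G x 1 ->
  derivable (fun t => c + G t) x 1 /\ derive1 (fun t => c + G t) x = derive1 G x.
Proof.
move=> dG; have -> : (fun t => c + G t) = cst c + G by [].
split; first by apply: derivableD => //; exact: derivable_cst.
by rewrite derive1E deriveD// derive_cst add0r derive1E.
Qed.

Lemma derive1_cstB (c x : R) (G : R -> R) : derivable G x 1 ->
  derivable (fun t => c - G t) x 1 /\ derive1 (fun t => c - G t) x = - derive1 G x.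
Proof.
move=> dG; have -> : (fun t => c - G t) = cst c - G by [].
split; first by apply: derivableB => //; exact: derivable_cst.
by rewrite derive1E deriveB// derive_cst sub0r derive1E.
Qed.

Lemma derive1_gt_Rintegral c (f : R -> R) : mu.-integrable setT (EFin \o f) ->
  {ae mu, forall x, derivable (fun t : R => c + \int[mu]_(y in `]t, +oo[) f y) x 1 /\
     derive1 (fun t : R => c + \int[mu]_(y in `]t, +oo[) f y) x = - f x}.
Proof.
move=> fi; have := derive1_Rintegral fi.
set G := (fun t : R => \int[mu]_(y in `]-oo, t[) f y).
have -> : (fun t : R => c + \int[mu]_(y in `]t, +oo[) f y) =
  (fun t => (c + \int[mu]_x f x) - G t).
  by apply/funext => t; rewrite Rintegral_gtE// addrA.
move: G (c + _) => G k; apply: ae_imp => x [dx <-].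
exact: derive1_cstB.
Qed.

Lemma derive1_lt_Rintegral c (f : R -> R) : mu.-integrable setT (EFin \o f) ->
  {ae mu, forall x, derivable (fun t : R => c + \int[mu]_(y in `]-oo, t[) f y) x 1 /\
     derive1 (fun t : R => c + \int[mu]_(y in `]-oo, t[) f y) x = f x}.
Proof.
move=> fi; have := derive1_Rintegral fi.
set G := (fun t : R => \int[mu]_(y in `]-oo, t[) f y).
have -> : (fun t : R => c + \int[mu]_(y in `]-oo, t[) f y) = (fun t => c + G t) by [].
by move: G => G; apply: ae_imp => x [dx <-]; exact: derive1_cstD.
Qed.

Lemma ae_itv_point (a b c d : R) (P : R -> Prop) : a <= c -> c < d -> d <= b ->
  {ae mu, forall x, x \in `[a, b] -> P x} -> exists2 x, c < x < d & P x.
Proof.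
move=> ac cd db [N [mN N0 NP]]; apply: contrapT => nP.
have : (mu `]c, d[ <= mu N)%E.
  apply: le_measure; rewrite ?inE// => x; rewrite /= in_itv/= => xcd.
  apply: NP => /= xP; apply: nP; exists x => //; apply: xP.
  by move: xcd => /andP[cx xd]; rewrite in_itv/=; apply/andP; split; lra.
by rewrite N0 lebesgue_measure_itv/= lte_fin cd -EFinB lee_fin; lra.
Qed.

Lemma ac1_ae_eq0 a b (F : R -> R) : a < b -> ac1 a b F ->
  {ae mu, forall x, x \in `[a, b] -> F x = 0} -> forall t, a <= t <= b -> F t = 0.
Proof.
move=> ab aF F0 t tab; apply/eqP/negP => /negP Ft.
have Ft0 : 0 < `|F t| by rewrite normr_gt0.
have [d d0 h] := ac1_uniform_continuous aF Ft0.
(* The interval close to [t] must stay inside [[a, b]]: it is taken to the right of [t], except at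
   [t = b]. *)
have : exists c e, [/\ a <= c, c < e, e <= b & forall x, c < x < e -> `|t - x| < d].
  have /andP[at_ tb] := tab.
  have [tb'|tb'] := ltP t b.
    exists t, (Num.min b (t + d)).
    have m1 : t < Num.min b (t + d) by rewrite lt_min tb' ltrDl.
    have m2 : Num.min b (t + d) <= b by rewrite ge_min lexx.
    have m3 : Num.min b (t + d) <= t + d by rewrite ge_min lexx orbT.
    by split => // x /andP[x1 x2]; rewrite ltr_norml; apply/andP; split; lra.
  exists (Num.max a (t - d)), t.
  have m1 : Num.max a (t - d) < t by rewrite gt_max; apply/andP; split; lra.
  have m2 : a <= Num.max a (t - d) by rewrite le_max lexx.
  have m3 : t - d <= Num.max a (t - d) by rewrite le_max lexx orbT.
  by split => // x /andP[x1 x2]; rewrite ltr_norml; apply/andP; split; lra.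
move=> [c [e [ac ce eb he]]].
have [x xce Fx] := ae_itv_point ac ce eb F0.
have xab : a <= x <= b by move: xce => /andP[x1 x2]; apply/andP; split; lra.
by have := h t x tab xab (he x xce); rewrite Fx subr0 ltxx.
Qed.

Lemma is_AC_repr_uniq a b (f F G : R -> 'rV[R]_m) : a < b ->
  is_AC_repr a b f F -> is_AC_repr a b f G -> forall t, a <= t <= b -> F t = G t.
Proof.
move=> ab [aF Ff] [aG Gf] t tab; apply/rowP => i; apply/eqP; rewrite -subr_eq0; apply/eqP.
have /(ac1_ae_eq0 ab) := ac1B (abs_cont_ac1 i aF) (abs_cont_ac1 i aG).
apply; last exact: tab.
apply: ae_imp2 Ff Gf => x Fx Gx xab /=.
by rewrite Fx// Gx// subrr.
Qed.

Lemma AC_reprP a b (f F : R -> 'rV[R]_m) : is_AC_repr a b f F ->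
  is_AC_repr a b f (AC_repr a b f).
Proof. by move=> h; rewrite /AC_repr; case: xgetP => [G _ //|/(_ F)]. Qed.

Lemma AC_reprE a b (f F : R -> 'rV[R]_m) : a < b -> is_AC_repr a b f F ->
  forall t, a <= t <= b -> AC_repr a b f t = F t.
Proof. by move=> ab h; exact: is_AC_repr_uniq (AC_reprP h) h. Qed.

Lemma derive1_row (F : R -> 'rV[R]_m) (t : R) :
  (forall i, derivable (fun x => F x ord0 i) t 1) ->
  derive1 F t = \row_i derive1 (fun x => F x ord0 i) t.
Proof.
move=> dF; rewrite derive1E derive_mx; last first.
  by apply/derivable_mxP => i j; rewrite (ord1 i).
by apply/rowP => i; rewrite !mxE derive1E.
Qed.

Lemma derive1_near_eq (F G : R -> 'rV[R]_m) a b t : a < t < b ->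
  (forall x, a <= x <= b -> F x = G x) -> derive1 F t = derive1 G t.
Proof.
move=> tab FG; rewrite !derive1E; apply: near_eq_derive.
have : t \in `]a, b[ by rewrite in_itv.
move=> /near_in_itvoo; apply: filterS => x; rewrite in_itv/= => /andP[x1 x2].
by apply: FG; rewrite (ltW x1) (ltW x2).
Qed.

Lemma ae_forall_fin (I : finType) (P : I -> R -> Prop) :
  (forall i, {ae mu, forall x, P i x}) -> {ae mu, forall x, forall i, P i x}.
Proof.
move=> h; have : {ae mu, forall x, forall i, i \in enum I -> P i x}.
  elim: (enum I) => [|j s ih]; first exact: aeW.
  apply: ae_imp2 (h j) ih => x Pj Ps i; rewrite inE => /orP[/eqP->//|]; exact: Ps.
by apply: ae_imp => x hx i; apply: hx; rewrite mem_enum.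
Qed.

Lemma ae_neq (c : R) : {ae mu, forall x, x != c}.
Proof.
exists [set c]; split => //; first exact: lebesgue_measure_set1.
by move=> x /= /negP; rewrite negbK => /eqP.
Qed.

Lemma ae_eq_patch (a b : R) (f g : R -> R) :
  {ae mu, forall x, x \in `[a, b] -> f x = g x} ->
  ae_eq mu setT (f \_ `[a, b]) (g \_ `[a, b]).
Proof.
by apply: ae_imp => x fg _; rewrite !patchE mem_setE; case: ifP => // /fg.
Qed.

(** At [x = 0] both sides are 0 by convention, the inverse of 0 being 0; for [be = 1] the left-hand
    side would be 1 there. *)
Lemma ker_powR (be x : R) : be != 1 -> 0 <= x -> (x `^ (1 - be))^-1 = ker be x.
Proof.
move=> be1 x0; rewrite -powRN opprB /ker; case: ltP => // x0'.
have -> : x = 0 by apply/le_anti; rewrite x0 x0'.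
by rewrite powR0// subr_eq0.
Qed.

Lemma RLint_leftE (a b be : R) (q : R -> 'rV[R]_m) t i : be != 1 -> t <= b ->
  RLint_left a be q t ord0 i = Il be ((fun tau => q tau ord0 i) \_ `[a, b]) t.
Proof.
move=> be1 tb; rewrite mxE /Il; congr (_ * _).
rewrite Rintegral_mkcond; apply: eq_Rintegral => x _.
rewrite !patchE !mem_setE !in_itv/=; case: (leP a x) => ax /=; last by rewrite mulr0.
case: (leP x t) => xt; last by rewrite ker_le0 ?mul0r// subr_le0 ltW.
by rewrite ifT ?(le_trans xt tb)// ker_powR ?subr_ge0// mulrC.
Qed.

Lemma RLint_rightE (a b be : R) (q : R -> 'rV[R]_m) t i : be != 1 -> a <= t ->
  RLint_right b be q t ord0 i = Ir be ((fun tau => q tau ord0 i) \_ `[a, b]) t.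
Proof.
move=> be1 ta; rewrite mxE /Ir; congr (_ * _).
rewrite Rintegral_mkcond; apply: eq_Rintegral => x _.
rewrite !patchE !mem_setE !in_itv/= [a <= x <= b]andbC.
case: (leP x b) => xb /=; last by rewrite andbF mulr0.
case: (leP t x) => xt /=; last by rewrite ker_le0 ?mul0r// subr_le0 ltW.
by rewrite ifT ?(le_trans ta xt)// ker_powR ?subr_ge0// mulrC.
Qed.

Lemma Il_patch (a b be : R) (g : R -> R) t : (forall x, x < a -> g x = 0) -> t <= b ->
  Il be (g \_ `[a, b]) t = Il be g t.
Proof.
move=> g0 tb; congr (_ * _); apply: eq_Rintegral => x _.
rewrite patchE mem_setE in_itv/=; case: (leP a x) => ax /=; last by rewrite g0.
case: (leP x b) => xb //=; rewrite ker_le0 ?mul0r// subr_le0 (le_trans tb)// ltW//.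
Qed.

Lemma Ir_patch (a b be : R) (g : R -> R) t : (forall x, b < x -> g x = 0) -> a <= t ->
  Ir be (g \_ `[a, b]) t = Ir be g t.
Proof.
move=> g0 ta; congr (_ * _); apply: eq_Rintegral => x _.
rewrite patchE mem_setE in_itv/= andbC; case: (leP x b) => xb /=; last by rewrite g0.
case: (leP a x) => ax //=; rewrite ker_le0 ?mul0r// subr_le0 (le_trans _ ta)// ltW//.
Qed.

Lemma Il_lt0 (a be : R) (f : R -> R) t : (forall x, x < a -> f x = 0) -> t <= a -> Il be f t = 0.
Proof.
move=> f0 ta; rewrite /Il /Rintegral integral0_eq ?mulr0// => x _.
have [xa|ax] := ltP x a; first by rewrite f0 ?mulr0.
by rewrite ker_le0 ?mul0r// subr_le0 (le_trans ta).
Qed.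

Lemma Ir_gt0 (b be : R) (f : R -> R) t : (forall x, b < x -> f x = 0) -> b <= t -> Ir be f t = 0.
Proof.
move=> f0 ta; rewrite /Ir /Rintegral integral0_eq ?mulr0// => x _.
have [xa|ax] := ltP b x; first by rewrite f0 ?mulr0.
by rewrite ker_le0 ?mul0r// subr_le0 (le_trans ax).
Qed.

Lemma integrable_ker_ker be (t s : R) : 0 < be < 1 ->
  mu.-integrable setT (fun x => (ker be (t - x) * ker (1 - be) (x - s))%:E).
Proof.
move=> be01; apply/integrableP; split.
  by apply/measurable_EFinP; apply: measurable_funM; apply: measurable_kerB.
under eq_integral do rewrite gee0_abs ?lee_fin ?mulr_ge0 ?ker_ge0//.
by rewrite integral_ker_ker// ltry.
Qed.

(** [Il_ker] turns the singular term into [c] and [Il_Il] turns the other into a primitive.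
    Splitting the integral requires each summand to be integrable, which kernel composition
    provides. *)
Lemma Il_frac_sum al c a t (f : R -> R) : 0 < al < 1 -> a < t ->
  mu.-integrable setT (EFin \o f) ->
  Il (1 - al) (fun x => c / Gamma al * ker al (x - a) + Il al f x) t =
  c + \int[mu]_(x in `]-oo, t[) f x.
Proof.
move=> al01 at_ fi; have al01' : 0 < 1 - al < 1 by lra.
have G1 := gt_eqF (Gamma_gt0 al01); have G2 := gt_eqF (Gamma_gt0 al01').
transitivity (c / Gamma al * Il (1 - al) (fun x => ker al (x - a)) t +
    Il (1 - al) (Il al f) t); last first.
  have := Il_Il t al01' fi; rewrite subKr => ->.
  by rewrite Il_ker// divfK// G1.
rewrite /Il mulrCA -mulrDr; congr (_ * _).
have i1 : mu.-integrable setT (fun x => (ker (1 - al) (t - x) * ker al (x - a))%:E).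
  by have := integrable_ker_ker t a al01'; rewrite subKr.
have /measurable_EFinP m1 := measurable_int mu i1.
rewrite -RintegralMl//.
have i1' : mu.-integrable setT (fun x => (c / Gamma al * (ker (1 - al) (t - x) * ker al (x - a)))%:E).
  by have := integrableZl measurableT (c / Gamma al) i1; apply: eq_integrable.
have i2 : mu.-integrable setT (fun x => (ker (1 - al) (t - x) *
    ((Gamma al)^-1 * \int[mu]_y (ker al (x - y) * f y)))%:E).
  have := @integrable_compose_kernel R (fun x => ker (1 - al) (t - x))
    (fun x y => ker al (x - y)) (fun y => if y < t then Gamma (1 - al) * Gamma al else 0) f
    (Gamma (1 - al) * Gamma al).
  move=> h; have {}h : mu.-integrable setT (fun x => (ker (1 - al) (t - x) *
      \int[mu]_y (ker al (x - y) * f y))%:E); last first.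
    have := integrableZl measurableT ((Gamma al)^-1) h.
    by apply: eq_integrable => // x _; rewrite -EFinM mulrCA.
  apply: h; last exact: fi.
  - exact: measurable_kerB.
  - by move=> x; exact: ker_ge0.
  - exact: measurable_kerB.
  - by move=> x y; exact: ker_ge0.
  - by move=> y; case: ifP => // _; rewrite ltW// mulr_gt0// Gamma_gt0.
  - by move=> y; have := @integral_ker_ker R (1 - al) t y al01'; rewrite subKr.
rewrite -RintegralD//; apply: eq_Rintegral => x _.
by rewrite mulrDr; congr (_ + _); ring.
Qed.

Lemma Ir_frac_sum al c b t (f : R -> R) : 0 < al < 1 -> t < b ->
  mu.-integrable setT (EFin \o f) ->
  Ir (1 - al) (fun x => c / Gamma al * ker al (b - x) + Ir al f x) t =
  c + \int[mu]_(x in `]t, +oo[) f x.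
Proof.
move=> al01 at_ fi; have al01' : 0 < 1 - al < 1 by lra.
have G1 := gt_eqF (Gamma_gt0 al01); have G2 := gt_eqF (Gamma_gt0 al01').
transitivity (c / Gamma al * Ir (1 - al) (fun x => ker al (b - x)) t +
    Ir (1 - al) (Ir al f) t); last first.
  have := Ir_Ir t al01' fi; rewrite subKr => ->.
  by rewrite Ir_ker// divfK// G1.
rewrite /Ir mulrCA -mulrDr; congr (_ * _).
have i1 : mu.-integrable setT (fun x => (ker (1 - al) (x - t) * ker al (b - x))%:E).
  have := integrable_ker_ker b t al01.
  by apply: eq_integrable => // x _; rewrite mulrC.
have /measurable_EFinP m1 := measurable_int mu i1.
rewrite -RintegralMl//.
have i1' : mu.-integrable setT (fun x => (c / Gamma al * (ker (1 - al) (x - t) * ker al (b - x)))%:E).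
  by have := integrableZl measurableT (c / Gamma al) i1; apply: eq_integrable.
have i2 : mu.-integrable setT (fun x => (ker (1 - al) (x - t) *
    ((Gamma al)^-1 * \int[mu]_y (ker al (y - x) * f y)))%:E).
  have := @integrable_compose_kernel R (fun x => ker (1 - al) (x - t))
    (fun x y => ker al (y - x)) (fun y => if t < y then Gamma al * Gamma (1 - al) else 0) f
    (Gamma al * Gamma (1 - al)).
  move=> h; have {}h : mu.-integrable setT (fun x => (ker (1 - al) (x - t) *
      \int[mu]_y (ker al (y - x) * f y))%:E); last first.
    have := integrableZl measurableT ((Gamma al)^-1) h.
    by apply: eq_integrable => // x _; rewrite -EFinM mulrCA.
  apply: h; last exact: fi.
  - exact: measurable_kerB.
  - by move=> x; exact: ker_ge0.
  - exact: measurable_kerB.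
  - by move=> x y; exact: ker_ge0.
  - by move=> y; case: ifP => // _; rewrite ltW// mulr_gt0// Gamma_gt0.
  - move=> y; have := @integral_ker_ker R al y t al01.
    by move=> <-; apply: eq_integral => x _; rewrite mulrC.
rewrite -RintegralD//; apply: eq_Rintegral => x _.
by rewrite mulrDr; congr (_ + _); ring.
Qed.

End Vectors.

(** * Representation of the fractional spaces *)

Section Representation.
Context {R : realType}.
Local Notation mu := (@lebesgue_measure R).
Variables (m : nat) (a b al : R).
Hypotheses (ab : a < b) (al01 : 0 < al < 1).
Local Notation V := 'rV[R]_m.
Implicit Types (q h : R -> V) (c : V) (f : 'I_m -> R -> R).

(** Vanishing outside [[a, b]] is what allows whole-line convolutions to stand for integrals based
    at [a] or [b]. *)
Definition zint f : Prop := forall i,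
  mu.-integrable setT (EFin \o f i) /\ (forall x, x \notin `[a, b] -> f i x = 0).

(** Whatever [xget] selects, the values of [RLac_left], [RLder_left] and [RLval_left] needed later
    are computed from this relation. *)
Definition left_rep q c f : Prop := zint f /\ forall i,
  {ae mu, forall t, t \in `[a, b] ->
    q t ord0 i = c ord0 i / Gamma al * ker al (t - a) + Il al (f i) t}.

Definition right_rep q c f : Prop := zint f /\ forall i,
  {ae mu, forall t, t \in `[a, b] ->
    q t ord0 i = c ord0 i / Gamma al * ker al (b - t) + Ir al (f i) t}.

Let al_neq1 : 1 - al != 1.
Proof. by have /andP[al0 _] := al01; rewrite lt_eqF// gtrBl. Qed.

Let al_neq1' : al != 1.
Proof. by have /andP[_ al1] := al01; rewrite lt_eqF. Qed.

Lemma zint_lt f i x : zint f -> x < a -> f i x = 0.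
Proof. by move=> zf xa; apply: (zf i).2; rewrite in_itv/= leNgt xa. Qed.

Lemma zint_gt f i x : zint f -> b < x -> f i x = 0.
Proof. by move=> zf xa; apply: (zf i).2; rewrite in_itv/= andbC leNgt xa. Qed.

Lemma left_rep_AC q c f : left_rep q c f ->
  is_AC_repr a b (RLint_left a (1 - al) q)
    (fun t => \row_i (c ord0 i + \int[mu]_(x in `]-oo, t[) f i x)).
Proof.
move=> [zf qE]; split.
  apply: ac1_abs_cont => i; under eq_fun do rewrite mxE.
  exact: ac1_Rintegral (zf i).1.
(* At [t = a] the raw integral runs over a single point and is 0, whereas the representative takes
   the value [c]. *)
apply: ae_imp (ae_neq a) => t ta; rewrite /= in_itv/= => /andP[at_ tb].
apply/rowP => i; rewrite mxE; apply/esym; rewrite (@RLint_leftE _ _ a b)//.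
rewrite (ae_eq_Il _ _ (ae_eq_patch (qE i))) Il_patch//.
  by rewrite Il_frac_sum//; [rewrite lt_neqAle eq_sym ta|exact: (zf i).1].
move=> x xa; rewrite ker_le0 ?subr_le0 ?(ltW xa)// mulr0 add0r.
by apply: (@Il_lt0 _ a); [move=> y; exact: zint_lt|exact: ltW].
Qed.

Lemma right_rep_AC q c f : right_rep q c f ->
  is_AC_repr a b (RLint_right b (1 - al) q)
    (fun t => \row_i (c ord0 i + \int[mu]_(x in `]t, +oo[) f i x)).
Proof.
move=> [zf qE]; split.
  apply: ac1_abs_cont => i; under eq_fun do rewrite mxE.
  exact: ac1_gt_Rintegral (zf i).1.
apply: ae_imp (ae_neq b) => t ta; rewrite /= in_itv/= => /andP[at_ tb].
apply/rowP => i; rewrite mxE; apply/esym; rewrite (@RLint_rightE _ _ a b)//.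
rewrite (ae_eq_Ir _ _ (ae_eq_patch (qE i))) Ir_patch//.
  by rewrite Ir_frac_sum//; [rewrite lt_neqAle ta|exact: (zf i).1].
move=> x xa; rewrite ker_le0 ?subr_le0 ?(ltW xa)// mulr0 add0r.
by apply: (@Ir_gt0 _ b); [move=> y; exact: zint_gt|exact: ltW].
Qed.

Lemma Rintegral_lt_a f i t : zint f -> t <= a -> \int[mu]_(x in `]-oo, t[) f i x = 0.
Proof.
move=> zf ta; rewrite /Rintegral integral0_eq// => x; rewrite /= in_itv/= => xt.
by rewrite zint_lt// (lt_le_trans xt).
Qed.

Lemma Rintegral_gt_b f i t : zint f -> b <= t -> \int[mu]_(x in `]t, +oo[) f i x = 0.
Proof.
move=> zf ta; rewrite /Rintegral integral0_eq// => x; rewrite /= in_itv/= andbT => xt.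
by rewrite zint_gt// (le_lt_trans ta).
Qed.

Lemma left_rep_RLac q c f : left_rep q c f -> RLac_left a b al q a = c.
Proof.
move=> qr; rewrite /RLac_left (AC_reprE ab (left_rep_AC qr)) ?lexx ?ltW//.
by apply/rowP => i; rewrite mxE Rintegral_lt_a ?addr0//; case: qr.
Qed.

Lemma right_rep_RLac q c f : right_rep q c f -> RLac_right a b al q b = c.
Proof.
move=> qr; rewrite /RLac_right (AC_reprE ab (right_rep_AC qr)) ?lexx ?ltW//.
by apply/rowP => i; rewrite mxE Rintegral_gt_b ?addr0//; case: qr.
Qed.

Lemma left_rep_RLder q c f : left_rep q c f ->
  {ae mu, forall t, t \in `[a, b] -> RLder_left a b al q t = \row_i f i t}.
Proof.
move=> qr; have [zf _] := qr.
have dFae := ae_forall_fin (fun i => derive1_lt_Rintegral (c ord0 i) (zf i).1).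
(* The selected representative is known on [[a, b]] only, so its two-sided derivative can be
   computed only in the interior. *)
have neq_ab := ae_imp2 (fun x => @conj (x != a) (x != b)) (ae_neq a) (ae_neq b).
apply: ae_imp2 neq_ab dFae => t [ta tb] dF; rewrite in_itv/= => /andP[at_ tb'].
have tab : a < t < b by rewrite !lt_neqAle eq_sym ta tb at_ tb'.
rewrite /RLder_left (derive1_near_eq tab (AC_reprE ab (left_rep_AC qr))).
rewrite derive1_row => [|i].
  by apply/rowP => i; rewrite !mxE; under eq_fun do rewrite mxE; case: (dF i).
by under eq_fun do rewrite mxE; case: (dF i).
Qed.

Lemma right_rep_RLder q c f : right_rep q c f ->
  {ae mu, forall t, t \in `[a, b] -> RLder_right a b al q t = \row_i f i t}.
Proof.
move=> qr; have [zf _] := qr.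
have dFae := ae_forall_fin (fun i => derive1_gt_Rintegral (c ord0 i) (zf i).1).
have neq_ab := ae_imp2 (fun x => @conj (x != a) (x != b)) (ae_neq a) (ae_neq b).
apply: ae_imp2 neq_ab dFae => t [ta tb] dF; rewrite in_itv/= => /andP[at_ tb'].
have tab : a < t < b by rewrite !lt_neqAle eq_sym ta tb at_ tb'.
rewrite /RLder_right (derive1_near_eq tab (AC_reprE ab (right_rep_AC qr))).
rewrite derive1_row => [|i].
  apply/rowP => i; rewrite !mxE; under eq_fun do rewrite mxE.
  by case: (dF i) => _ ->; rewrite opprK.
by under eq_fun do rewrite mxE; case: (dF i).
Qed.

Lemma zint_patch f i : zint f -> (f i) \_ `[a, b] = f i.
Proof.
move=> zf; apply/funext => x; rewrite patchE mem_setE; case: ifPn => // xab.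
by rewrite (zf i).2.
Qed.

Lemma left_rep_RLval q c f : left_rep q c f ->
  RLval_left a b al q b =
  \row_i (c ord0 i / Gamma al * ker al (b - a) + Il al (f i) b).
Proof.
move=> qr; have [zf _] := qr; apply/rowP => i; rewrite mxE [RHS]mxE.
rewrite (left_rep_RLac qr) (@RLint_leftE _ _ a b)// mxE; congr (_ + _).
  rewrite -(@ker_powR _ al (b - a))// ?subr_ge0 ?ltW//.
  by rewrite mulrC mulrA.
rewrite -(zint_patch i zf); apply: ae_eq_Il; apply: ae_eq_patch.
by apply: ae_imp (left_rep_RLder qr) => t h /h ->; rewrite mxE.
Qed.

Lemma right_rep_RLval q c f : right_rep q c f ->
  RLval_right a b al q a =
  \row_i (c ord0 i / Gamma al * ker al (b - a) + Ir al (f i) a).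
Proof.
move=> qr; have [zf _] := qr; apply/rowP => i; rewrite mxE [RHS]mxE.
rewrite (right_rep_RLac qr) (@RLint_rightE _ _ a b)// mxE; congr (_ + _).
  rewrite -(@ker_powR _ al (b - a))// ?subr_ge0 ?ltW//.
  by rewrite mulrC mulrA.
rewrite -(zint_patch i zf); apply: ae_eq_Ir; apply: ae_eq_patch.
by apply: ae_imp (right_rep_RLder qr) => t h /h ->; rewrite mxE.
Qed.

Lemma in_Lp_ae (p : \bar R) q h :
  {ae mu, forall t, t \in `[a, b] -> q t = h t} -> in_Lp a b p h -> in_Lp a b p q.
Proof.
move=> qh [g [mg hg gp]]; exists g; split => //.
by apply: ae_imp2 qh hg => t E1 E2 tab; rewrite E1// E2.
Qed.

Lemma left_rep_AC_left p q c f : left_rep q c f -> in_Lp a b 1%:E q ->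
  in_Lp a b p (fun t => \row_i f i t) -> AC_left a b al p q.
Proof.
move=> qr q1 fp; split => //; first by eexists; exact: left_rep_AC qr.
exact: in_Lp_ae (left_rep_RLder qr) fp.
Qed.

Lemma right_rep_AC_right p q c f : right_rep q c f -> in_Lp a b 1%:E q ->
  in_Lp a b p (fun t => \row_i f i t) -> AC_right a b al p q.
Proof.
move=> qr q1 fp; split => //; first by eexists; exact: right_rep_AC qr.
exact: in_Lp_ae (right_rep_RLder qr) fp.
Qed.

Lemma in_Lp1_zint q : in_Lp a b 1%:E q -> exists f, zint f /\
  forall i, {ae mu, forall t, t \in `[a, b] -> q t ord0 i = f i t}.
Proof.
move=> [g [mg qg]]; rewrite Lnorm1 => goo.
exists (fun i => (fun t => g t ord0 i) \_ `[a, b]); split => [i|i]; last first.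
  apply: ae_imp qg => t h tab; rewrite patchE mem_setE tab.
  by rewrite h.
have mgi : measurable_fun setT ((fun t => g t ord0 i) \_ `[a, b]).
  by apply/(measurable_restrictT _ (measurable_itv _)).
split; last by move=> x xab; rewrite patchE mem_setE (negbTE xab).
apply/integrableP; split; first exact/measurable_EFinP.
apply: le_lt_trans goo; apply: ae_le_ge0_integralT => //.
apply: nearW => t /=; rewrite lee_fin !patchE; case: ifP => _ //.
by rewrite [leRHS]ger0_norm ?enorm_ge0// coord_le_enorm.
Qed.

Lemma zint_in_Lp1 q f : zint f ->
  (forall i, {ae mu, forall t, t \in `[a, b] -> q t ord0 i = f i t}) ->
  in_Lp a b 1%:E q.
Proof.
move=> zf qf; exists (fun t => \row_i f i t); split.
- move=> i; rewrite (_ : (fun t => _) = f i); last first.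
    by apply/funext => t; rewrite mxE.
  apply: measurable_funTS.
  by have /measurable_EFinP := measurable_int mu (zf i).1.
- apply: ae_imp (ae_forall_fin qf) => t h tab.
  by apply/rowP => i; rewrite h// mxE.
- rewrite Lnorm1.
  have : mu.-integrable setT (fun t => \sum_i `|f i t|%:E)%E.
    by apply: integrable_sum => // i _; exact: (integrable_norm (zf i).1).
  move=> /integrableP[_]; apply: le_lt_trans; apply: ae_le_ge0_integralT => //.
  apply: nearW => t /=; rewrite sumEFin /= lee_fin [leRHS]ger0_norm; last by apply: sumr_ge0.
  rewrite patchE; case: ifP => _; last by rewrite normr0; apply: sumr_ge0.
  rewrite ger0_norm ?enorm_ge0//; apply: le_trans (enorm_le_sum _) _.
  by apply: ler_sum => i _; rewrite mxE.
Qed.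

Lemma integrable_ker_itvcc : mu.-integrable `[a, b] (fun t => (ker al (t - a))%:E).
Proof.
have /andP[al0 _] := al01.
have [C C0 [_ h]] := @integral_ker_itvcc R a b al al0.
apply/integrableP; split.
  by apply/measurable_EFinP; exact: measurable_kerB.
under eq_integral do rewrite gee0_abs ?lee_fin ?ker_ge0//.
by apply: le_lt_trans (h a (lexx a)) _; exact: ltry.
Qed.

(** [I^al] preserves integrability on [[a, b]]: this is kernel composition with the indicator of
    [[a, b]] as outer kernel, the composed kernel being the integral of [ker al (x - y)] over
    [[a, b]]. *)
Lemma integrable_Il_itvcc (f : R -> R) : mu.-integrable setT (EFin \o f) ->
  (forall x, x \notin `[a, b] -> f x = 0) ->
  mu.-integrable `[a, b] (fun t => (Il al f t)%:E).
Proof.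
move=> fi f0; have /andP[al0 _] := al01.
have [C C0 [_ h]] := @integral_ker_itvcc R a b al al0.
pose I (y : R) := (\int[mu]_(x in `[a, b]) (ker al (x - y))%:E)%E.
have I0 y : (0 <= I y)%E by apply: integral_ge0 => x _; rewrite lee_fin ker_ge0.
(* Truncating in [y] keeps the composed kernel below [C] for every [y], the bound [h] being
   available for [a <= y]. *)
pose K2 (x y : R) := ker al (x - y) * \1_`[a, b] y.
have := @integrable_compose_kernel R (fun x => \1_`[a, b] x) K2
  (fun y => fine (I y) * \1_`[a, b] y) f C.
move=> hK; have {hK} : mu.-integrable setT (fun x => (\1_`[a, b] x * \int[mu]_y (K2 x y * f y))%:E).
  apply: hK => //.
  - exact: measurable_indic.
  - apply: measurable_funM; first exact: measurable_kerB.
    by apply: measurableT_comp => //; exact: measurable_indic.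
  - by move=> x y; rewrite mulr_ge0 ?ker_ge0.
  - move=> y; rewrite indicE mem_setE; case: (boolP (y \in `[a, b])) => [yab|_]; last first.
      by rewrite /= mulr0.
    rewrite /= mulr1 -lee_fin fineK; first by apply: h; move: yab; rewrite in_itv/= => /andP[].
    rewrite ge0_fin_numE//; apply: le_lt_trans (h y _) _; rewrite ?ltry//.
    by move: yab; rewrite in_itv/= => /andP[].
  - move=> y; rewrite indicE mem_setE; case: (boolP (y \in `[a, b])) => yab /=; last first.
      by rewrite mulr0 integral0_eq// => x _; rewrite /K2 !indicE !mem_setE (negbTE yab) !mulr0.
    rewrite mulr1 fineK; last first.
      rewrite ge0_fin_numE//; apply: le_lt_trans (h y _) _; rewrite ?ltry//.
      by move: yab; rewrite in_itv/= => /andP[].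
    rewrite /I [RHS]integral_mkcond; apply: eq_integral => x _.
    rewrite patchE /K2 !indicE !mem_setE yab mulr1.
    by case: ifP; rewrite ?mul1r ?mul0r.
move=> hK; have hi := integrable_itvS (measurable_itv `[a, b]) hK.
have := integrableZl _ (Gamma al)^-1 hi => /(_ (measurable_itv _)).
apply: eq_integrable => [|x]; first exact: measurable_itv.
rewrite mem_setE => xab; rewrite -EFinM indicE mem_setE xab mul1r.
congr (_ * _)%:E; apply: eq_Rintegral => y _.
rewrite /K2 indicE mem_setE -mulrA; case: (boolP (y \in _)) => yab; first by rewrite mul1r.
by rewrite f0 ?mulr0.
Qed.

Lemma Rintegral_ltS (h : R -> R) t : (forall x, x \notin `[a, b] -> h x = 0) ->
  b <= t -> \int[mu]_(x in `]-oo, t[) h x = \int[mu]_(x in `]-oo, b[) h x.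
Proof.
move=> h0 bt; rewrite Rintegral_mkcond [RHS]Rintegral_mkcond.
apply: ae_eq_Rintegral; apply: ae_imp (ae_neq b) => x xb _.
rewrite !patchE !mem_setE !in_itv/=; case: (ltP x b) => [xb'|bx].
  by rewrite (lt_le_trans xb' bt).
case: ifP => // _; apply: h0; rewrite in_itv/= negb_and -!ltNge orbC.
by rewrite lt_neqAle eq_sym xb bx.
Qed.

(* Both [I^(1 - al) q] and [I^(1 - al) (c ker + I^al f)] equal [F]; applying
   [I^al] shows that [q] and the candidate have the same primitive. *)
Lemma AC_left_left_rep p q : AC_left a b al p q -> exists c f, left_rep q c f.
Proof.
move=> [q1 [F FAC] _]; have [aF Fq] := FAC.
have /choice[f hf] i := ac1_integral ab (abs_cont_ac1 i aF).
have zf : zint f by move=> i; have [fi f0 _] := hf i.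
exists (F a), f; split => // i.
have [g [zg qg]] := in_Lp1_zint q1.
pose r0 t := F a ord0 i / Gamma al * ker al (t - a) + Il al (f i) t.
pose r := r0 \_ `[a, b].
have ri : mu.-integrable setT (EFin \o r).
  rewrite /r -restrict_EFin; apply/integrable_restrict => //.
  rewrite (_ : _ `&` _ = `[a, b]%classic) ?setTI//.
  have h1 : mu.-integrable `[a, b]
      (fun t => (F a ord0 i / Gamma al)%:E * (ker al (t - a))%:E)%E.
    by apply: integrableZl => //; exact: integrable_ker_itvcc.
  have h2 := integrable_Il_itvcc (zf i).1 (zf i).2.
  have := integrableD _ h1 h2 => /(_ (measurable_itv _)).
  by apply: eq_integrable => //.
have r_out x : x \notin `[a, b] -> r x = 0.
  by move=> xab; rewrite /r patchE mem_setE (negbTE xab).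
have r00 x : x < a -> r0 x = 0.
  move=> xa; rewrite /r0 ker_le0 ?subr_le0 ?(ltW xa)// mulr0 add0r.
  by apply: (@Il_lt0 _ a); [move=> y; exact: zint_lt|exact: ltW].
have al01' : 0 < 1 - al < 1 by have /andP[al0 al1] := al01; rewrite subr_gt0 al1 gtrBl.
(* Points beyond [b] are left out because [I^al] at [t <= b] does not see them; to the left of [a]
   both sides vanish. *)
have inner : {ae mu, forall x, x <= b -> Il (1 - al) (g i) x = Il (1 - al) r x}.
  apply: ae_imp2 Fq (ae_neq a) => x Fx xa xb.
  have [xa'|ax] := ltP x a.
    rewrite !(@Il_lt0 _ a) ?(ltW xa')// => y ya; last exact: zint_lt.
    by rewrite r_out// in_itv/= leNgt ya.
  have xab : x \in `[a, b] by rewrite in_itv/= ax.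
  rewrite /r Il_patch// Il_frac_sum//; last 2 first.
  - by rewrite lt_neqAle eq_sym xa.
  - exact: (zf i).1.
  have [_ _ <-] := hf i; last by rewrite ax.
  rewrite Fx// (@RLint_leftE _ _ a b)//; apply: ae_eq_Il.
  rewrite -(zint_patch i zg); apply: ae_eq_patch.
  by apply: ae_imp (qg i) => y h yab; rewrite h.
have outer t : t <= b -> \int[mu]_(x in `]-oo, t[) g i x = \int[mu]_(x in `]-oo, t[) r x.
  move=> tb; rewrite -(Il_Il t al01 (zg i).1) -(Il_Il t al01 ri).
  congr (_ * _); apply: ae_eq_Rintegral; apply: ae_imp inner => x h _.
  have [xt|tx] := leP x t; first by rewrite h// (le_trans xt).
  by rewrite ker_le0 ?mul0r// subr_le0 ltW.
have gri : mu.-integrable setT (EFin \o (g i \- r)).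
  by have := integrableB measurableT (zg i).1 ri; apply: eq_integrable.
have gr0 t : \int[mu]_(x in `]-oo, t[) (g i \- r) x = 0.
  wlog tb : t / t <= b.
    move=> hw; have [tb|/ltW bt] := leP t b; first exact: hw.
    by rewrite Rintegral_ltS ?hw// => x xab /=; rewrite (zg i).2// r_out// subrr.
  rewrite RintegralB//; [|exact: integrable_itvS (zg i).1|exact: integrable_itvS].
  by rewrite outer// subrr.
apply: ae_imp2 (qg i) (ae_eq0_Rintegral gri gr0) => x h /= /eqP.
rewrite subr_eq0 => /eqP gr xab; rewrite h// gr /r patchE mem_setE xab//.
Qed.

Lemma left_rep_in_Lp p q c f : AC_left a b al p q -> left_rep q c f ->
  in_Lp a b p (fun t => \row_i f i t).
Proof.
move=> [_ _ qp] qr; apply: in_Lp_ae qp.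
by apply: ae_imp (left_rep_RLder qr) => t h /h.
Qed.

End Representation.

(** * Quasi-polynomial growth *)

Section PowerIntegrability.
Context {R : realType}.
Local Notation mu := (@lebesgue_measure R).
Variables (a b : R).
Hypothesis ab : a < b.
Implicit Types (G U W : R -> R) (M : \bar R) (r C : R).

(** Membership in L^M, for majorants. When [M] is [+oo] the bound holds at every point of [[a, b]],
    not merely almost everywhere, so that coefficients [c t v] can be bounded by compactness. *)
Definition powint M G : Prop := [/\ measurable_fun setT G, forall t, 0 <= G t
  & match M with
    | r%:E => (\int[mu]_(t in `[a, b]) (G t `^ r)%:E < +oo)%E
    | +oo%E => exists C, forall t, t \in `[a, b] -> G t <= C
    | -oo%E => False
    end].

Lemma powint_cst M C : (-oo < M)%E -> 0 <= C -> powint M (fun=> C).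
Proof.
case: M => [r| |]// _ C0; split => //; last by exists C.
rewrite integral_cst//= lebesgue_measure_itv/= lte_fin ab.
by rewrite -EFinB -EFinM ltry.
Qed.

Lemma integral_lty_le G U : measurable_fun setT G -> (forall t, 0 <= G t) ->
  measurable_fun setT U -> (forall t, t \in `[a, b] -> G t <= U t) ->
  (\int[mu]_(t in `[a, b]) (U t)%:E < +oo)%E ->
  (\int[mu]_(t in `[a, b]) (G t)%:E < +oo)%E.
Proof.
move=> mG G0 mU GU; apply: le_lt_trans; apply: ge0_le_integral => //.
- by move=> t _; rewrite lee_fin.
- by apply/measurable_EFinP; exact: measurable_funTS.
- by apply/measurable_EFinP; exact: measurable_funTS.
Qed.

Lemma integral_lty_add G U : measurable_fun setT G -> (forall t, 0 <= G t) ->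
  measurable_fun setT U -> (forall t, 0 <= U t) ->
  (\int[mu]_(t in `[a, b]) (G t)%:E < +oo)%E ->
  (\int[mu]_(t in `[a, b]) (U t)%:E < +oo)%E ->
  (\int[mu]_(t in `[a, b]) (G t + U t)%:E < +oo)%E.
Proof.
move=> mG G0 mU U0 Goo Uoo; under eq_integral do rewrite EFinD.
rewrite ge0_integralD//=.
- by rewrite lte_add_pinfty.
- by move=> t _; rewrite lee_fin.
- by apply/measurable_EFinP; exact: measurable_funTS.
- by move=> t _; rewrite lee_fin.
- by apply/measurable_EFinP; exact: measurable_funTS.
Qed.

Lemma integral_lty_scale G C : measurable_fun setT G -> (forall t, 0 <= G t) ->
  0 <= C -> (\int[mu]_(t in `[a, b]) (G t)%:E < +oo)%E ->
  (\int[mu]_(t in `[a, b]) (C * G t)%:E < +oo)%E.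
Proof.
move=> mG G0 C0 Goo; under eq_integral do rewrite EFinM.
rewrite ge0_integralZl//=.
- by rewrite lte_mul_pinfty.
- by apply/measurable_EFinP; exact: measurable_funTS.
- by move=> t _; rewrite lee_fin.
Qed.

Lemma integral_lty_cst C : (\int[mu]_(t in `[a, b]) C%:E < +oo)%E.
Proof.
rewrite integral_cst//= lebesgue_measure_itv/= lte_fin ab.
by rewrite -EFinB -EFinM ltry.
Qed.

Lemma powint_affine M U C D : (0%:E < M)%E -> 0 <= C -> 0 <= D -> powint M U ->
  powint M (fun t => C * U t + D).
Proof.
move=> M0 C0 D0 [mU U0 Uoo]; split.
- by apply: measurable_funD => //; exact: measurable_funM.
- by move=> t; rewrite addr_ge0// mulr_ge0.
case: M M0 Uoo => [r| |] M0; [move: M0|move=> [B UB]|by case]; last first.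
  by exists (C * B + D) => t /UB UBt; rewrite lerD2r ler_wpM2l.
rewrite lte_fin => r0 Uoo.
have mUr : measurable_fun setT (fun t => U t `^ r).
  exact: (measurableT_comp (measurable_powR _)).
(* A sum of two terms is at most twice the larger one. *)
apply: (@integral_lty_le _ (fun t => (C + C) `^ r * U t `^ r + (D + D) `^ r)).
- apply: (measurableT_comp (measurable_powR _)) => //.
  by apply: measurable_funD => //; exact: measurable_funM.
- by move=> t; exact: powR_ge0.
- by apply: measurable_funD => //; exact: measurable_funM.
- move=> t _; rewrite -powRM ?addr_ge0//.
  have [h|/ltW h] := leP (C * U t) D.
    apply: (@le_trans _ _ ((D + D) `^ r)); last by rewrite lerDr powR_ge0.
    by rewrite ge0_ler_powR ?nnegrE ?addr_ge0 ?mulr_ge0 ?(ltW r0)// lerD2r.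
  apply: (@le_trans _ _ (((C + C) * U t) `^ r)); last by rewrite lerDl powR_ge0.
  by rewrite ge0_ler_powR ?nnegrE ?addr_ge0 ?mulr_ge0 ?addr_ge0 ?(ltW r0)// mulrDl lerD2l.
- apply: integral_lty_add.
  + exact: measurable_funM.
  + by move=> t; rewrite mulr_ge0 ?powR_ge0.
  + exact: measurable_cst.
  + by move=> _; exact: powR_ge0.
  + apply: integral_lty_scale => //; last exact: powR_ge0.
    by move=> t; exact: powR_ge0.
  + exact: integral_lty_cst.
Qed.

Lemma powint_integral_lty M G : (1%:E <= M)%E -> powint M G ->
  (\int[mu]_(t in `[a, b]) (G t)%:E < +oo)%E.
Proof.
move=> + [mG G0]; case: M => [r| |]//; last first.
  move=> _ [C GC]; apply: (@integral_lty_le _ (fun=> C)) => //.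
  exact: integral_lty_cst.
rewrite lee_fin => r1 Goo.
have mGr : measurable_fun setT (fun t => G t `^ r).
  exact: (measurableT_comp (measurable_powR _)).
apply: (@integral_lty_le _ (fun t => 1 + G t `^ r)) => //.
- exact: measurable_funD.
- move=> t _; have [h|/ltW h] := leP (G t) 1.
    by apply: le_trans h _; rewrite lerDl powR_ge0.
  apply: (@le_trans _ _ (G t `^ r)); last by rewrite lerDr.
  exact: le1r_powR.
- apply: integral_lty_add => //; first by move=> t; exact: powR_ge0.
  exact: integral_lty_cst.
Qed.

(** A form of Young's inequality without its constants: comparing [y] with [x ^ (r - 1)] shows that
    one of the two powers already dominates the product. It replaces Hoelder's inequality where only
    a finite bound matters. *)
Lemma young_powR (r x y : R) : 1 < r -> 0 <= x -> 0 <= y ->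
  x * y <= x `^ r + y `^ (r / (r - 1)).
Proof.
move=> r1 x0 y0; have r0 : 0 < r - 1 by rewrite subr_gt0.
have [h|/ltW h] := leP y (x `^ (r - 1)).
  apply: (@le_trans _ _ (x `^ r)); last by rewrite lerDl powR_ge0.
  rewrite -(@mulr_powRB1 _ x r)//; first by rewrite ler_wpM2l.
  by rewrite (lt_trans ltr01).
apply: (@le_trans _ _ (y `^ (r / (r - 1)))); last by rewrite lerDr powR_ge0.
have -> : r / (r - 1) = (r - 1)^-1 + 1 by field; rewrite gt_eqF.
have {h} h : x <= y `^ (r - 1)^-1.
  have : (x `^ (r - 1)) `^ (r - 1)^-1 <= y `^ (r - 1)^-1.
    by rewrite ge0_ler_powR ?nnegrE ?powR_ge0// ltW// invr_gt0.
  by rewrite -powRrM divff ?gt_eqF// powRr1.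
rewrite powRD ?powRr1 ?ler_wpM2r//.
by rewrite gt_eqF// addr_gt0// invr_gt0.
Qed.

Lemma ker_powRr be r x : 0 < r -> ker be x `^ r = ker (1 - (1 - be) * r) x.
Proof.
move=> r0; rewrite /ker; case: ifP => x0; last by rewrite powR0// gt_eqF.
by rewrite -powRrM; congr (_ `^ _); ring.
Qed.

(** The kernel raised to the conjugate exponent is again a kernel, of an order that is positive
    exactly when [1/M < al]; its integrals over [[a, b]] are then bounded uniformly in [t]. *)
Lemma powint_ker_bounded al M U : 0 < al < 1 -> (al^-1%:E < M)%E -> powint M U ->
  exists2 C, 0 <= C & forall t, t \in `[a, b] ->
    (\int[mu]_(x in `[a, b]) (U x * ker al (t - x))%:E <= C%:E)%E /\
    (\int[mu]_(x in `[a, b]) (U x * ker al (x - t))%:E <= C%:E)%E.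
Proof.
move=> al01; have /andP[al0 al1] := al01.
have mk1 (be t : R) : measurable_fun setT (fun x : R => ker be (t - x)).
  exact: measurable_kerB.
have mk2 (be t : R) : measurable_fun setT (fun x : R => ker be (x - t)).
  exact: measurable_kerB.
case: M => [r| |]//; last first.
  move=> _ [mU U0 [B UB]]; have [C C0 [h1 h2]] := @integral_ker_itvcc R a b al al0.
  have key (k : R -> R) : measurable_fun setT k -> (forall x, 0 <= k x) ->
      (\int[mu]_(x in `[a, b]) (k x)%:E <= C%:E)%E ->
      (\int[mu]_(x in `[a, b]) (U x * k x)%:E <= (`|B| * C)%:E)%E.
    move=> mk k0 kC; apply: (@le_trans _ _ (\int[mu]_(x in `[a, b]) (`|B|%:E * (k x)%:E))%E).
      apply: ge0_le_integral => //.
      - by move=> x _; rewrite lee_fin mulr_ge0.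
      - by apply/measurable_EFinP/measurable_funTS; exact: measurable_funM.
      - by apply: emeasurable_funM => //; apply/measurable_EFinP/measurable_funTS.
      - by move=> x /UB Ux; rewrite -EFinM lee_fin ler_wpM2r// (le_trans Ux)// ler_norm.
    rewrite ge0_integralZl//=.
    - by rewrite EFinM lee_pmul ?integral_ge0// => x _; rewrite lee_fin.
    - by apply/measurable_EFinP/measurable_funTS.
    - by move=> x _; rewrite lee_fin.
  exists (`|B| * C); first by rewrite mulr_ge0.
  move=> t; rewrite in_itv/= => /andP[at_ tb]; split.
    by apply: key => //; [move=> x; exact: ker_ge0|exact: h1].
  by apply: key => //; [move=> x; exact: ker_ge0|exact: h2].
rewrite lte_fin => alr [mU U0 Uoo].
have alr1 : 1 < al * r by rewrite -(@mulfV _ al (lt0r_neq0 al0)) ltr_pM2l.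
have r1 : 1 < r by rewrite (lt_trans _ alr)// invf_gt1.
have r0 : 0 < r - 1 by rewrite subr_gt0.
have r'0 : 0 < r / (r - 1) by rewrite divr_gt0// (lt_trans ltr01).
(* The order of the kernel to the power [r / (r - 1)]; its positivity amounts to [1 < al * r]. *)
have be0 : 0 < 1 - (1 - al) * (r / (r - 1)).
  by rewrite subr_gt0 mulrA ltr_pdivrMr// mul1r; lra.
have [C C0 [h1 h2]] := @integral_ker_itvcc R a b _ be0.
have mUr : measurable_fun setT (fun t => U t `^ r).
  exact: (measurableT_comp (measurable_powR _)).
set I := (\int[mu]_(t in _) _)%E in Uoo.
have I0 : (0 <= I)%E by apply: integral_ge0 => x _; rewrite lee_fin powR_ge0.
have Ifin : I = (fine I)%:E by rewrite fineK// ge0_fin_numE.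
have key (k : R -> R) : measurable_fun setT k -> (forall x, 0 <= k x) ->
    (\int[mu]_(x in `[a, b]) (k x `^ (r / (r - 1)))%:E <= C%:E)%E ->
    (\int[mu]_(x in `[a, b]) (U x * k x)%:E <= (fine I + C)%:E)%E.
  move=> mk k0 kC.
  have mkr : measurable_fun setT (fun t => k t `^ (r / (r - 1))).
    exact: (measurableT_comp (measurable_powR _)).
  apply: (@le_trans _ _ (\int[mu]_(x in `[a, b]) ((U x `^ r)%:E + (k x `^ (r / (r - 1)))%:E))%E).
    apply: ge0_le_integral => //.
    - by move=> x _; rewrite lee_fin mulr_ge0.
    - by apply/measurable_EFinP/measurable_funTS; exact: measurable_funM.
    - by apply: emeasurable_funD => //; apply/measurable_EFinP/measurable_funTS.
    - by move=> x _; rewrite -EFinD lee_fin young_powR.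
  rewrite ge0_integralD//=.
  - by rewrite EFinD -Ifin leeD2l.
  - by move=> x _; rewrite lee_fin powR_ge0.
  - by apply/measurable_EFinP/measurable_funTS.
  - by move=> x _; rewrite lee_fin powR_ge0.
  - by apply/measurable_EFinP/measurable_funTS.
exists (fine I + C); first by rewrite addr_ge0// fine_ge0.
move=> t; rewrite in_itv/= => /andP[at_ tb]; split.
  apply: key => //; [move=> x; exact: ker_ge0|].
  by under eq_integral do rewrite ker_powRr//; exact: h1.
apply: key => //; [move=> x; exact: ker_ge0|].
by under eq_integral do rewrite ker_powRr//; exact: h2.
Qed.

(** The exponent [rho] of [Z] is shared out: [rho - B] pays for [X ^ A], which is
    [(X ^ ga) ^ (rho - B)], and [B] pays for [W ^ B]. *)
Lemma powR_mul_le (A B rho ga X W Z : R) : 1 <= Z -> X `^ ga <= Z -> 0 <= W <= Z ->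
  0 <= B <= rho -> A = ga * (rho - B) -> X `^ A * W `^ B <= Z `^ rho.
Proof.
move=> Z1 XZ /andP[W0 WZ] /andP[B0 Br] ->; have Z0 := lt_le_trans ltr01 Z1.
rewrite -[in leRHS](subrK B rho) powRD; last by rewrite (gt_eqF Z0) implybT.
rewrite powRrM ler_pM ?powR_ge0//.
  by rewrite ge0_ler_powR ?nnegrE ?powR_ge0 ?subr_ge0 ?(ltW Z0).
by rewrite ge0_ler_powR ?nnegrE ?(ltW Z0).
Qed.

(* The [k]-th term is at most a multiple of [Z `^ r^-1], where
   [Z = 1 + \sum_k (t - a) `^ - ga k + W] with [ga k < 1] is integrable. *)
Lemma powint_dominate r (N : nat) (Ck A B : 'I_N -> R) W : 1 <= r ->
  (forall k, 0 <= Ck k) -> (forall k, 0 <= A k) -> (forall k, 0 <= B k) ->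
  (forall k, A k = 0 -> B k <= r^-1) -> (forall k, 0 < A k -> A k + B k < r^-1) ->
  measurable_fun setT W -> (forall t, 0 <= W t) ->
  (\int[mu]_(t in `[a, b]) (W t)%:E < +oo)%E ->
  exists2 G, powint r%:E G & forall t, a < t ->
    \sum_k Ck k * ((t - a)^-1 `^ A k * W t `^ B k) <= G t.
Proof.
move=> r1 Ck0 A0 B0 AB0 AB mW W0 Woo; have r0 := lt_le_trans ltr01 r1.
(* If [B k = r^-1] the hypotheses force [A k = 0], so the division by 0 gives the right value 0. *)
pose ga k := A k / (r^-1 - B k).
have Br k : B k <= r^-1.
  have [/AB0//|] := eqVneq (A k) 0 => Ak.
  have /AB : 0 < A k by rewrite lt_neqAle eq_sym Ak A0.
  by move/ltW; apply: le_trans; rewrite lerDr.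
have ga1 k : ga k < 1.
  have [Ak|Ak] := eqVneq (A k) 0; first by rewrite /ga Ak mul0r.
  have /AB Ak1 : 0 < A k by rewrite lt_neqAle eq_sym Ak A0.
  rewrite /ga ltr_pdivrMr ?mul1r; first by rewrite ltrBrDr.
  by rewrite subr_gt0 (le_lt_trans _ Ak1)// lerDr.
have Aga k : A k = ga k * (r^-1 - B k).
  have [Ak|Ak] := eqVneq (A k) 0; first by rewrite /ga Ak !mul0r.
  have /AB Ak1 : 0 < A k by rewrite lt_neqAle eq_sym Ak A0.
  by rewrite /ga divfK// gt_eqF// subr_gt0 (le_lt_trans _ Ak1)// lerDr.
pose Z t := 1 + \sum_k ker (1 - ga k) (t - a) + W t.
pose S := \sum_k Ck k.
have S0 : 0 <= S by apply: sumr_ge0.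
have K0 t : 0 <= \sum_k ker (1 - ga k) (t - a) by apply: sumr_ge0 => k _; exact: ker_ge0.
have Z1 t : 1 <= Z t by rewrite /Z -addrA lerDl addr_ge0.
have Z0 t : 0 <= Z t by rewrite (le_trans ler01).
have mK : measurable_fun setT (fun t : R => \sum_k ker (1 - ga k) (t - a)).
  by apply: measurable_sum => k; exact: measurable_kerB.
have mZ : measurable_fun setT Z.
  by apply: measurable_funD => //; exact: measurable_funD.
exists (fun t => S * Z t `^ r^-1); first split.
- by apply: measurable_funM => //; exact: (measurableT_comp (measurable_powR _)).
- by move=> t; rewrite mulr_ge0 ?powR_ge0.
- under eq_integral => t _.
    rewrite powRM ?powR_ge0// -powRrM mulVf ?gt_eqF// powRr1//.
    over.
  apply: integral_lty_scale; rewrite ?powR_ge0//.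
  apply: integral_lty_add => //.
  + exact: measurable_funD.
  + by move=> t; rewrite addr_ge0.
  apply: integral_lty_add => //; first exact: integral_lty_cst.
  under eq_integral do rewrite -sumEFin.
  rewrite ge0_integral_sum//=.
  + apply/lte_sum_pinfty => k _.
    have ga0 : 0 < 1 - ga k by rewrite subr_gt0.
    have [C C0 [_ h]] := @integral_ker_itvcc R a b _ ga0.
    exact: le_lt_trans (h a (lexx a)) (ltry _).
  + by move=> k; apply/measurable_EFinP/measurable_kerB.
  + by move=> k t _; rewrite lee_fin ker_ge0.
- move=> t ta; rewrite /S mulr_suml; apply: ler_sum => k _; rewrite ler_wpM2l//.
  apply: (@powR_mul_le _ _ _ (ga k)) => //.
  + apply: le_trans (_ : ker (1 - ga k) (t - a) <= _).
      rewrite /ker subr_gt0 ta -powR_inv1 ?subr_ge0 ?(ltW ta)// -powRrM.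
      by have -> : -1 * ga k = 1 - ga k - 1 by ring.
    rewrite /Z (bigD1 k)//= addrCA -addrA -addrA lerDl !addr_ge0//.
    by apply: sumr_ge0 => j _; exact: ker_ge0.
  + by rewrite W0/= /Z lerDr addr_ge0.
  + by rewrite B0 Br.
Qed.

Variable m : nat.
Local Notation V := 'rV[R]_m.

Lemma coef_t_bounded (c : R -> R) : coef_t a b c ->
  exists2 C, 0 <= C & forall t, a <= t <= b -> c t <= C.
Proof.
move=> [cc c0]; have [t0 t0ab h] := EVT_max (ltW ab) cc.
exists (c t0); first by apply: c0; move: t0ab; rewrite in_itv.
by move=> t tab; apply: h; rewrite in_itv.
Qed.

Lemma coef_tv_bounded (c : R -> V -> R) D : 0 <= D -> coef_tv a b c ->
  exists2 C, 0 <= C & forall t v, a <= t <= b -> enorm v <= D -> c t v <= C.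
Proof.
move=> D0 [cc c0].
pose B := [set v : V | forall i, `[- D, D]%classic (v ord0 i)].
have cB : compact (`[a, b]%classic `*` B).
  apply: compact_setX; first exact: segment_compact.
  apply: (@rV_compact R m (fun=> `[- D, D]%classic)) => i.
  exact: segment_compact.
have B0 : `[a, b]%classic `*` B !=set0.
  exists (a, 0); split => /=; first by rewrite in_itv/= lexx ltW.
  by move=> i; rewrite mxE /= in_itv/= oppr_le0 D0.
have cc' : {within `[a, b]%classic `*` B, continuous (fun z : R * V => c z.1 z.2)}.
  by apply: continuous_subspaceW cc => z [/=]; rewrite in_itv.
have [[t0 v0] /set_mem[/= t0ab _] h] := compact_EVT_max B0 cB cc'.
exists (c t0 v0); first by apply: c0; move: t0ab; rewrite in_itv.
move=> t v tab vD; apply: (h (t, v)); apply/mem_set; split; first by rewrite /= in_itv.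
move=> i /=; rewrite in_itv/= -ler_norml; apply: le_trans vD.
exact: coord_le_enorm.
Qed.

Lemma recipE r : 0 < r -> recip r%:E = r^-1.
Proof. by move=> r0; rewrite /recip inver gt_eqF. Qed.

(** On curves below [K * ker al (t - a)], a factor [|x| ^ s1] costs [(t - a)^-1] to the power
    [(1 - al) * s1], and [|v| ^ s2] is at most [U ^ p] to the power [s2 / p]. For finite [p] and
    [M], the conditions defining [quasipoly] are then precisely those of [powint_dominate] with
    [r = M]. *)
Lemma quasipoly_powint al p M K U (P : R -> V -> V -> R) : 0 < al < 1 ->
  (1%:E <= p)%E -> (1%:E <= M)%E -> 0 <= K -> powint p U ->
  quasipoly a b al p M P ->
  exists2 G, powint M G & forall t x v, a < t <= b ->
    enorm x <= K * ker al (t - a) -> enorm v <= U t -> P t x v <= G t.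
Proof.
move=> /andP[al0 al1] p1 M1 K0 pU.
have xpow (s : R) t (x : V) : 0 <= s -> a < t -> enorm x <= K * ker al (t - a) ->
    enorm x `^ s <= K `^ s * (t - a)^-1 `^ ((1 - al) * s).
  move=> s0 ta xK.
  have -> : (t - a)^-1 `^ ((1 - al) * s) = ker al (t - a) `^ s.
    have <- : (t - a) `^ (-1) = (t - a)^-1 by rewrite powR_inv1// subr_ge0 ltW.
    rewrite /ker subr_gt0 ta -(powRrM (t - a) (-1)) -(powRrM (t - a) (al - 1)).
    by congr (_ `^ _); ring.
  rewrite -powRM ?ker_ge0// ge0_ler_powR ?nnegrE ?enorm_ge0//.
  by rewrite mulr_ge0 ?ker_ge0.
have [UD|pfin] := eqVneq p +oo%E.
  (* For infinite [p] the velocities stay in a fixed ball, on which the coefficients [c t v] are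
     bounded by compactness. *)
  move: pU; rewrite UD => -[mU U0 [D UltD]].
  have UD' t (v : V) : a < t <= b -> enorm v <= U t -> enorm v <= `|D|.
    move=> /andP[/ltW ta tb] vU; rewrite (le_trans vU)// (le_trans (UltD t _)) ?ler_norm//.
    by rewrite in_itv/= ta.
  have D0 := normr_ge0 D.
  rewrite /quasipoly ltxx; case: ifP => Moo; last first.
    move=> [c cc PE]; have [C C0 cC] := coef_tv_bounded D0 cc.
    exists (fun=> C); first by apply: powint_cst => //; rewrite (lt_le_trans _ M1)// ltNyr.
    move=> t x v tab _ vU; have tab' : a <= t <= b by case/andP: tab => /ltW ->.
    by rewrite PE// cC// (UD' t).
  move=> [N [c [s1 [cc s10 s1M PE]]]].
  have /choice[C hC] k : exists C, 0 <= C /\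
      forall t v, a <= t <= b -> enorm v <= `|D| -> c k t v <= C.
    by have [C C0 h] := coef_tv_bounded D0 (cc k); exists C.
  case: M M1 Moo s1M => [r| |]// + _ s1M; rewrite lee_fin => r1.
  have r0 : 0 < r := lt_le_trans ltr01 r1.
  have [||||||||G pG hG] := @powint_dominate r N.+1 (fun k => C k * K `^ s1 k)
      (fun k => (1 - al) * s1 k) (fun=> 0) (fun=> 0) r1 => //.
  - by move=> k; rewrite mulr_ge0 ?powR_ge0//; case: (hC k).
  - by move=> k; rewrite mulr_ge0// subr_ge0 ltW.
  - by move=> k _; rewrite invr_ge0 ltW.
  - by move=> k _; rewrite addr0 -recipE//; exact: s1M.
  - exact: integral_lty_cst.
  exists G => // t x v tab xK vU; have /andP[ta tb] := tab.
  have tab' : a <= t <= b by rewrite ltW.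
  apply: le_trans (hG t ta); rewrite PE//; apply: ler_sum => k _.
  rewrite powRr0 mulr1 -mulrA ler_pM ?powR_ge0//.
  - exact: (cc k).2.
  - by apply: (hC k).2 => //; exact: UD' vU.
  - exact: xpow.
have poo : (p < +oo)%E by rewrite ltey.
case: p p1 pU pfin poo => [r'| |]// + [mU U0 Uoo] _ _; rewrite lee_fin => r'1.
have r'0 : 0 < r' := lt_le_trans ltr01 r'1.
rewrite /quasipoly ltry recipE//; case: ifP => Moo; last first.
  move=> [c cc PE]; have [C C0 cC] := coef_t_bounded cc.
  exists (fun=> C); first by apply: powint_cst => //; rewrite (lt_le_trans _ M1)// ltNyr.
  move=> t x v tab _ vU; have tab' : a <= t <= b by case/andP: tab => /ltW ->.
  by rewrite PE// cC.
move=> [N [c [s1 [s2 [cc s120 s1M0 s1M PE]]]]].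
have /choice[C hC] k : exists C, 0 <= C /\ forall t, a <= t <= b -> c k t <= C.
  by have [C C0 h] := coef_t_bounded (cc k); exists C.
case: M M1 Moo s1M0 s1M => [r| |]// + _; rewrite lee_fin => r1.
have r0 : 0 < r := lt_le_trans ltr01 r1.
rewrite recipE// => s1M0 s1M.
have al1' : 0 < 1 - al by rewrite subr_gt0.
have [||||||||G pG hG] := @powint_dominate r N.+1 (fun k => C k * K `^ s1 k)
    (fun k => (1 - al) * s1 k) (fun k => s2 k / r') (fun t => U t `^ r') r1 => //.
- by move=> k; rewrite mulr_ge0 ?powR_ge0//; case: (hC k).
- by move=> k; rewrite mulr_ge0 ?(ltW al1')//; case: (s120 k).
- by move=> k; rewrite divr_ge0 ?(ltW r'0)//; case: (s120 k).
- move=> k /eqP; rewrite mulf_eq0 (gt_eqF al1')/= => /eqP; exact: s1M0.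
- by move=> k; rewrite pmulr_rgt0// => /s1M.
- exact: (measurableT_comp (measurable_powR _)).
- by move=> t; exact: powR_ge0.
exists G => // t x v tab xK vU; have /andP[ta tb] := tab.
have tab' : a <= t <= b by rewrite ltW.
have [s10 s20] := (fun k => (s120 k).1, fun k => (s120 k).2).
apply: le_trans (hG t ta); rewrite PE//; apply: ler_sum => k _.
rewrite -(powRrM (U t)) (_ : r' * _ = s2 k); last by field; rewrite gt_eqF.
rewrite [leRHS]mulrA.
rewrite ler_pM ?mulr_ge0 ?powR_ge0//.
- exact: (cc k).2.
- rewrite -mulrA ler_pM ?powR_ge0//; first exact: (cc k).2.
  + exact: (hC k).2.
  + exact: xpow.
- by rewrite ge0_ler_powR ?nnegrE ?enorm_ge0.
Qed.

Lemma measurable_enorm (g : 'I_m -> R -> R) : (forall i, measurable_fun setT (g i)) ->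
  measurable_fun setT (fun t : R => enorm (\row_i g i t)).
Proof.
move=> mg; rewrite /enorm.
apply: (measurableT_comp (continuous_measurable_fun (@sqrt_continuous R))).
apply: measurable_sum => i; under eq_fun do rewrite mxE.
exact: measurable_funX.
Qed.

Lemma Lnorm_patch r (h : R -> R) : 0 < r -> (forall t, 0 <= h t) ->
  ('N[mu]_(r%:E)[EFin \o (h \_ `[a, b])] =
  (\int[mu]_(t in `[a, b]) (h t `^ r)%:E) `^ r^-1)%E.
Proof.
move=> r0 h0; rewrite unlock; congr (_ `^ _)%E; rewrite [RHS]integral_mkcond.
apply: eq_integral => t _ /=; rewrite !patchE; case: ifP => _; last first.
  by rewrite /= normr0 powR0// gt_eqF.
by rewrite /= ger0_norm.
Qed.

Lemma in_Lp_powint p (q : R -> V) : (1%:E <= p)%E -> in_Lp a b p q ->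
  exists g : 'I_m -> R -> R, [/\ forall i, measurable_fun setT (g i),
    forall i x, x \notin `[a, b] -> g i x = 0,
    {ae mu, forall t, t \in `[a, b] -> q t = \row_i g i t} &
    powint p (fun t => enorm (\row_i g i t))].
Proof.
move=> p1 [g [mg qg gp]].
pose g0 i := (fun t => g t ord0 i) \_ `[a, b].
have mg0 i : measurable_fun setT (g0 i).
  by apply/(measurable_restrictT _ (measurable_itv _)).
have me := measurable_enorm mg0.
have g0E t : t \in `[a, b] -> \row_i g0 i t = g t.
  by move=> tab; apply/rowP => i; rewrite mxE /g0 patchE mem_setE tab.
case: p p1 gp => [r| |]//.
  rewrite lee_fin => r1; have r0 := lt_le_trans ltr01 r1.
  rewrite Lnorm_patch// => [goo|t]; last exact: enorm_ge0.
  exists g0; split => //.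
  - by move=> i x xab; rewrite /g0 patchE mem_setE (negbTE xab).
  - by apply: ae_imp qg => t h tab; rewrite h// g0E.
  - split => //; first by move=> t; exact: enorm_ge0.
    have := lty_poweRy _ goo; rewrite invr_eq0 gt_eqF// => /(_ isT).
    apply: le_lt_trans; rewrite le_eqVlt; apply/orP; left; apply/eqP.
    by apply: eq_integral => t; rewrite mem_setE => tab; rewrite g0E.
move=> _; rewrite unlock.
have -> : (0 < mu [set: R])%E.
  apply: (@lt_le_trans _ _ (mu `[0%R, 1%R])).
    by rewrite lebesgue_measure_itv/= lte_fin ltr01 -EFinB subr0 lte_fin ltr01.
  by apply: le_measure; rewrite ?inE.
set B := ess_sup_inf.ess_sup _ _ => Boo.
have /ess_sup_inf.ess_supP hB : (B <= B)%E by [].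
pose C := fine B.
have BC : {ae mu, forall t, t \in `[a, b] -> enorm (g t) <= C}.
  apply: ae_imp hB => t /= + tab; rewrite patchE mem_setE tab ger0_norm ?enorm_ge0//.
  by rewrite /C; case: (B) Boo => [x| |]//=.
(* An essential supremum bounds [g] almost everywhere only; cutting [g0] off above it gives the
   pointwise bound asked by [powint]. *)
pose h i t := if enorm (\row_i g0 i t) <= `|C| then g0 i t else 0.
have hE t : \row_i h i t = if enorm (\row_i g0 i t) <= `|C| then \row_i g0 i t else 0.
  by apply/rowP => i; rewrite mxE /h; case: ifP => _; rewrite mxE.
have mh i : measurable_fun setT (h i).
  by apply: measurable_fun_ifT => //; exact: measurable_fun_ler.
exists h; split => //.
- by move=> i x xab; rewrite /h /g0 patchE mem_setE (negbTE xab) if_same.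
- apply: ae_imp2 qg BC => t E1 E2 tab; rewrite E1// hE g0E//.
  by rewrite (le_trans (E2 tab)) ?ler_norm.
- split; [exact: measurable_enorm|by move=> t; exact: enorm_ge0|].
  exists `|C| => t _; rewrite hE; case: ifP => // _.
  rewrite /enorm big1 ?sqrtr0// => i _; by rewrite mxE expr0n.
Qed.

Lemma powint_in_Lp p G (g : 'I_m -> R -> R) : (1%:E <= p)%E -> powint p G ->
  (forall i, measurable_fun setT (g i)) ->
  (forall i t, t \in `[a, b] -> `|g i t| <= G t) ->
  in_Lp a b p (fun t => \row_i g i t).
Proof.
move=> p1 pG mg gG; exists (fun t => \row_i g i t); split => //.
- move=> i; rewrite (_ : (fun t => _) = g i); last by apply/funext => t; rewrite mxE.
  exact: measurable_funTS.
- exact: aeW.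
have p0 : (0%:E < p)%E by rewrite (lt_le_trans _ p1)// lte_fin.
have [mG G0 hG] := @powint_affine p G m%:R 0 p0 (ler0n _ _) (lexx 0) pG.
have eG t : t \in `[a, b] -> enorm (\row_i g i t) <= m%:R * G t + 0.
  move=> tab; rewrite addr0; apply: le_trans (enorm_le_sum _) _.
  apply: (@le_trans _ _ (\sum_(i < m) G t)); last first.
    by rewrite sumr_const card_ord mulr_natl.
  by apply: ler_sum => i _; rewrite mxE gG.
have me := measurable_enorm mg.
case: p p1 p0 hG {pG} => [r| |]//.
  rewrite lee_fin => r1; have r0 := lt_le_trans ltr01 r1.
  move=> _ hG; rewrite Lnorm_patch// => [|t]; last exact: enorm_ge0.
  apply: poweR_lty; apply: integral_lty_le hG.
  - exact: (measurableT_comp (measurable_powR _)).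
  - by move=> t; exact: powR_ge0.
  - exact: (measurableT_comp (measurable_powR _)).
  - move=> t tab; rewrite ge0_ler_powR ?nnegrE ?enorm_ge0 ?(ltW r0)//; exact: eG.
move=> _ _ [C hC]; rewrite unlock; case: ifP => // _.
apply: (@le_lt_trans _ _ `|C|%:E); last exact: ltry.
apply/ess_sup_inf.ess_supP; apply: aeW => t /=; rewrite lee_fin patchE; case: ifPn => [|_].
  rewrite mem_setE => tab; rewrite ger0_norm ?enorm_ge0//.
  by rewrite (le_trans (eG t tab))// (le_trans (hC t tab))// ler_norm.
by rewrite normr0.
Qed.

End PowerIntegrability.

(** * First variation *)

Section Curves.
Context {R : realType}.
Variable m : nat.
Local Notation V := 'rV[R]_m.

(* The preimage of an open set is a countable union over the rational balls
   that [F] maps into it. *)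
Lemma measurable_curve (S : set (R * V * V)) (F : R * V * V -> R)
    (z1 : R -> R) (z2 z3 : 'I_m -> R -> R) : {within S, continuous F} ->
  measurable_fun setT z1 -> (forall i, measurable_fun setT (z2 i)) ->
  (forall i, measurable_fun setT (z3 i)) ->
  (forall t, S (z1 t, \row_i z2 i t, \row_i z3 i t)) ->
  measurable_fun setT (fun t => F (z1 t, \row_i z2 i t, \row_i z3 i t)).
Proof.
move=> /subspace_continuousP cF mz1 mz2 mz3 Sz.
set z := fun t => (z1 t, \row_i z2 i t, \row_i z3 i t).
apply: (measurability _ (RGenOInfty.measurableE R)) => //.
move=> _ [_ [y ->] <-]; rewrite setTI.
pose I := (rat * 'rV[rat]_m * 'rV[rat]_m * nat)%type.
pose ctr (k : I) : R * V * V :=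
  (ratr k.1.1.1, map_mx ratr k.1.1.2, map_mx ratr k.1.2).
pose rad (k : I) : R := k.2.+1%:R^-1.
have rad0 k : 0 < rad k by rewrite /rad invr_gt0.
pose B (k : I) := [set t | ball (ctr k) (rad k) (z t)].
have mB k : measurable (B k).
  have mb (h : R -> R) (c : rat) : measurable_fun setT h ->
      measurable [set t | ball (ratr c : R) (rad k) (h t)].
    move=> mh; rewrite -[X in measurable X]setTI.
    by apply: mh => //; apply: open_measurable; exact: ball_open.
  have -> : B k = [set t | ball (ratr k.1.1.1 : R) (rad k) (z1 t)] `&`
     ((\bigcap_i [set t | ball (ratr (k.1.1.2 ord0 i) : R) (rad k) (z2 i t)]) `&`
      (\bigcap_i [set t | ball (ratr (k.1.2 ord0 i) : R) (rad k) (z3 i t)])).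
    apply/seteqP; split => t.
      move=> [[/= h1 [_ h2]] [_ h3]]; split => //; split => i _ /=.
        by have := h2 ord0 i; rewrite !mxE.
      by have := h3 ord0 i; rewrite !mxE.
    move=> [/= h1 [h2 h3]]; split => /=; first split => //=.
      by split => // j i; rewrite (ord1 j) !mxE; exact: h2.
    by split => // j i; rewrite (ord1 j) !mxE; exact: h3.
  apply: measurableI; first exact: mb.
  by apply: measurableI; apply: fin_bigcap_measurable => // i _; exact: mb.
have -> : (fun t => F (z1 t, \row_i z2 i t, \row_i z3 i t)) @^-1` `]y, +oo[ =
    \bigcup_(k : I) (if `[< forall w, S w -> ball (ctr k) (rad k) w -> y < F w >]
      then B k else set0).
  apply/seteqP; split => t /=; last first.
    move=> [k _]; case: ifPn => // /asboolP h Bk; rewrite in_itv/= andbT.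
    exact: h.
  rewrite in_itv/= andbT => yF.
  have : nbhs (z t) [set w | S w -> y < F w].
    by apply: (cF (z t) (Sz t) [set u | y < u]); exact: open_nbhs_nbhs (conj (@open_gt R y) yF).
  rewrite -nbhs_ballE => -[e /= e0 he].
  (* With radius below [e / 2], the ball around a rational centre that contains [z t] stays within
     [e] of [z t]. *)
  have [n ne] : exists n : nat, n.+1%:R^-1 < e / 2.
    have [n _ hn] := @near_infty_natSinv_lt R (PosNum (divr_gt0 e0 (ltr0n R 2))).
    by exists n; exact: (hn n (leqnn _)).
  have n0 : 0 < n.+1%:R^-1 :> R by rewrite invr_gt0.
  have dens (x : R) : exists c : rat, ball (ratr c : R) n.+1%:R^-1 x.
    have [|c] := @rat_in_itvoo R (x - n.+1%:R^-1) (x + n.+1%:R^-1).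
      by rewrite ltrBlDr -addrA ltrDl addr_gt0.
    by rewrite in_itv/= => h; exists c; rewrite /ball/= ltr_distl.
  have [c1 h1] := dens (z1 t).
  have /choice[c2 h2] i := dens (z2 i t).
  have /choice[c3 h3] i := dens (z3 i t).
  exists (c1, \row_i c2 i, \row_i c3 i, n) => //.
  have Bt : B (c1, \row_i c2 i, \row_i c3 i, n) t.
    split => /=; first split => //=.
      by split => // j i; rewrite (ord1 j) !mxE; exact: h2.
    by split => // j i; rewrite (ord1 j) !mxE; exact: h3.
  rewrite ifT//; apply/asboolP => w Sw bw; apply: he => //.
  have /ball_sym Bt' : ball (ctr (c1, \row_i c2 i, \row_i c3 i, n)) n.+1%:R^-1 (z t) := Bt.
  have := ball_triangle Bt' bw; apply: le_ball.
  by rewrite (splitr e) lerD// ltW.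
apply: (@countable_bigcupT_measurable _ _ I) => [|k]; first exact: countableP.
by case: ifP => // _.
Qed.

Lemma derive_eq (U1 U2 : normedModType R) (f : U1 -> R) (g : U2 -> R) x u y v :
  (forall h : R, f (h *: u + x) - f x = g (h *: v + y) - g y) -> 'D_u f x = 'D_v g y.
Proof.
move=> fg; rewrite /derive.
suff -> : (fun h : R => h^-1 *: ((f \o shift x) (h *: u) - f x)) =
  (fun h : R => h^-1 *: ((g \o shift y) (h *: v) - g y)) by [].
by apply/funext => h /=; rewrite fg.
Qed.

Lemma is_derive_line (F : V * V -> R) (z k : V * V) (l : R) :
  (forall z, differentiable F z) ->
  is_derive l 1 (fun l : R => F (z + l *: k)) ('d F (z + l *: k) k).
Proof.
move=> dF.
have dl : differentiable (fun l : R => z + l *: k) l.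
  by apply: differentiableD => //; exact: differentiableZl.
apply: DeriveDef.
  by apply/derivable1_diffP; exact: (differentiable_comp dl (dF _)).
rewrite -deriveE//; apply: derive_eq => h.
have -> : h%:A = h by rewrite /GRing.scale/= mulr1.
by rewrite scalerDl addrCA.
Qed.

Lemma diff_gradient1 (F : V * V -> R) (z : V * V) i : differentiable F z ->
  'd F z (delta_mx ord0 i, 0) = gradient (fun y => F (y, z.2)) z.1 ord0 i.
Proof.
move=> dF; rewrite mxE -deriveE//; apply: derive_eq => h.
suff -> : h *: (delta_mx ord0 i, 0) + z = (h *: delta_mx ord0 i + z.1, z.2).
  by rewrite -surjective_pairing.
by case: z {dF} => z1 z2; congr pair; rewrite /= scaler0 add0r.
Qed.

Lemma diff_gradient2 (F : V * V -> R) (z : V * V) i : differentiable F z ->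
  'd F z (0, delta_mx ord0 i) = gradient (fun w => F (z.1, w)) z.2 ord0 i.
Proof.
move=> dF; rewrite mxE -deriveE//; apply: derive_eq => h.
suff -> : h *: (0, delta_mx ord0 i) + z = (z.1, h *: delta_mx ord0 i + z.2).
  by rewrite -surjective_pairing.
by case: z {dF} => z1 z2; congr pair; rewrite /= scaler0 add0r.
Qed.

(** Expanding [(x, v)] on unit vectors of the two factors translates the differential on [V * V]
    into the partial gradients of the growth conditions. *)
Lemma diff_gradient (F : V * V -> R) (z : V * V) (x v : V) : differentiable F z ->
  'd F z (x, v) =
  \sum_i x ord0 i * gradient (fun y => F (y, z.2)) z.1 ord0 i +
  \sum_i v ord0 i * gradient (fun w => F (z.1, w)) z.2 ord0 i.
Proof.
move=> dF.
have -> : (x, v) = \sum_i x ord0 i *: (delta_mx ord0 i, 0) +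
    \sum_i v ord0 i *: (0, delta_mx ord0 i) :> V * V.
  have h1 (u : V) : \sum_i u ord0 i *: (delta_mx ord0 i, 0) = (u, 0) :> V * V.
    rewrite [in RHS](row_sum_delta u).
    rewrite (big_morph (fun w : V => (w, 0) : V * V) (id1 := 0) (op1 := +%R))//.
      by apply: eq_bigr => i _; congr pair; rewrite /= scaler0.
    by move=> y w; congr pair; rewrite /= addr0.
  have h2 (u : V) : \sum_i u ord0 i *: (0, delta_mx ord0 i) = (0, u) :> V * V.
    rewrite [in RHS](row_sum_delta u).
    rewrite (big_morph (fun w : V => (0, w) : V * V) (id1 := 0) (op1 := +%R))//.
      by apply: eq_bigr => i _; congr pair; rewrite /= scaler0.
    by move=> y w; congr pair; rewrite /= addr0.
  by rewrite h1 h2; congr pair; rewrite /= ?addr0 ?add0r.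
rewrite linearD !linear_sum/=; congr (_ + _); apply: eq_bigr => i _; rewrite linearZ/=.
  by rewrite diff_gradient1.
by rewrite diff_gradient2.
Qed.

(** Steps in []0, 1]], so that the perturbed curves remain below one common majorant. *)
Definition lam (n : nat) : R := n.+1%:R^-1.

Lemma lam_gt0 n : 0 < lam n.
Proof. by rewrite /lam invr_gt0. Qed.

Lemma lam_le1 n : lam n <= 1.
Proof. by rewrite /lam invf_le1// ler1n. Qed.

Lemma lam_cvg0 : lam n @[n --> \oo] --> (0 : R).
Proof. exact: (@cvg_harmonic R). Qed.

Lemma cvg_lam_dnbhs (g : R -> R) (l : R) :
  g x @[x --> (0 : R)^'] --> l -> g (lam n) @[n --> \oo] --> l.
Proof.
move=> /cvgr_dnbhsP; apply; split; last exact: lam_cvg0.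
by move=> n; rewrite gt_eqF// lam_gt0.
Qed.

Lemma diff_quotient_cvg (F : V * V -> R) (z k : V * V) :
  (forall z, differentiable F z) ->
  (F (z + lam n *: k) - F z) / lam n @[n --> \oo] --> 'd F z k.
Proof.
move=> dF; apply: (@cvg_lam_dnbhs (fun x => (F (z + x *: k) - F z) / x)).
have dk : derivable F z k := diff_derivable (dF z).
rewrite -deriveE//; apply: cvg_trans dk.
apply: near_eq_cvg; apply: nearW => x /=.
by rewrite [x *: k + z]addrC [RHS]mulrC.
Qed.

Lemma norm_dot_le (x y : V) :
  `|\sum_i x ord0 i * y ord0 i| <= enorm y * \sum_i `|x ord0 i|.
Proof.
apply: le_trans (ler_norm_sum _ _ _) _; rewrite mulr_sumr; apply: ler_sum => i _.
by rewrite normrM mulrC ler_wpM2r// coord_le_enorm.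
Qed.

End Curves.

(** * Comparison and sums of majorants *)

Section PowintMonotone.
Context {R : realType}.
Local Notation mu := (@lebesgue_measure R).
Variables (a b : R).
Hypothesis ab : a < b.

Lemma powint_le M (G U : R -> R) : (0%:E < M)%E -> measurable_fun setT G ->
  (forall t, 0 <= G t) -> (forall t, t \in `[a, b] -> G t <= U t) ->
  powint a b M U -> powint a b M G.
Proof.
move=> + mG G0 GU [mU U0]; case: M => [r| |].
- rewrite lte_fin => r0 Uoo; split; [exact: mG|exact: G0|].
  apply: integral_lty_le Uoo.

  + exact: (measurableT_comp (measurable_powR _)).
  + by move=> t; exact: powR_ge0.
  + exact: (measurableT_comp (measurable_powR _)).
  + by move=> t tab; rewrite ge0_ler_powR ?nnegrE ?(ltW r0)// GU.
- move=> _ [C UC]; split; [exact: mG|exact: G0|].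
  by exists C => t tab; rewrite (le_trans (GU t tab))// UC.
- by [].
Qed.

Lemma powintD M (U W : R -> R) : (0%:E < M)%E -> powint a b M U -> powint a b M W ->
  powint a b M (fun t => U t + W t).
Proof.
move=> M0 pU pW; have [mU U0 hU] := pU; have [mW W0 hW] := pW; split.
- exact: measurable_funD.
- by move=> t; rewrite addr_ge0.
have [_ _] := powint_affine ab M0 (ler0n R 2) (lexx 0) pU.
have [_ _] := powint_affine ab M0 (ler0n R 2) (lexx 0) pW.
case: M M0 {pU pW} hU hW => [r| |]; [|move=> _ [C1 h1] [C2 h2] _ _|by []]; last first.
  by exists (C1 + C2) => t tab; rewrite lerD ?h1 ?h2.
rewrite lte_fin => r0 _ _ h2 h1.
have mp (u : R -> R) : measurable_fun setT u ->
    measurable_fun setT (fun t => (2%:R * u t + 0) `^ r).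
  move=> mu_; apply: (measurableT_comp (measurable_powR _)).
  by apply: measurable_funD => //; exact: measurable_funM.
have h3 := integral_lty_add (mp _ mU) (fun t => powR_ge0 _ _) (mp _ mW)
  (fun t => powR_ge0 _ _) h1 h2.
apply: integral_lty_le h3.
- by apply: (measurableT_comp (measurable_powR _)); exact: measurable_funD.
- by move=> t; exact: powR_ge0.
- by apply: measurable_funD; exact: mp.
- move=> t _; rewrite !addr0; have x0 := U0 t; have y0 := W0 t.
  have [h|/ltW h] := leP (W t) (U t).
    apply: (@le_trans _ _ ((2 * U t) `^ r)); last by rewrite lerDl powR_ge0.
    by rewrite ge0_ler_powR ?nnegrE ?mulr_ge0 ?addr_ge0 ?(ltW r0)//; lra.
  apply: (@le_trans _ _ ((2 * W t) `^ r)); last by rewrite lerDr powR_ge0.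
  by rewrite ge0_ler_powR ?nnegrE ?mulr_ge0 ?addr_ge0 ?(ltW r0)//; lra.
Qed.

End PowintMonotone.

(** * Densities and the curves that they generate *)

Section Densities.
Context {R : realType}.
Local Notation mu := (@lebesgue_measure R).
Variables (m : nat) (a b al : R) (p : \bar R).
Hypotheses (ab : a < b) (al01 : 0 < al < 1) (p1 : (1%:E <= p)%E).
Hypothesis alp : (al^-1%:E < p)%E.
Local Notation V := 'rV[R]_m.
Implicit Types (c d : V) (f phi : 'I_m -> R -> R).

(** A Borel version of a fractional derivative in L^p, extended by 0. *)
Definition density f : Prop := [/\ forall i, measurable_fun setT (f i),
  forall i x, x \notin `[a, b] -> f i x = 0 &
  powint a b p (fun t => enorm (\row_i f i t))].

Definition RLcurve c f (t : R) : V :=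
  \row_i (c ord0 i / Gamma al * ker al (t - a) + Il al (f i) t).

Lemma integrable_off_itv (h G : R -> R) : measurable_fun setT h ->
  (forall x, x \notin `[a, b] -> h x = 0) -> measurable_fun setT G ->
  (forall x, x \in `[a, b] -> `|h x| <= G x) ->
  (\int[mu]_(x in `[a, b]) (G x)%:E < +oo)%E -> mu.-integrable setT (EFin \o h).
Proof.
move=> mh h0 mG hG Goo; apply/integrableP; split; first exact/measurable_EFinP.
rewrite (_ : (\int[mu]_x _)%E = \int[mu]_(x in `[a, b]) (`|h x|)%:E)%E.
  apply: le_lt_trans Goo; apply: ge0_le_integral => //.
  - by apply/measurable_EFinP/measurable_funTS; exact: measurableT_comp.
  - by apply/measurable_EFinP/measurable_funTS.
rewrite [RHS]integral_mkcond; apply: eq_integral => x _; rewrite patchE mem_setE.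
by case: ifPn => // xab; rewrite /= h0// normr0.
Qed.

(** Serves for three exponents: [p] for the density of a curve, [s] for [L_x], and [+oo] for
    indicators. *)
Lemma Il_Ir_bounded M (U h : R -> R) : (al^-1%:E < M)%E -> powint a b M U ->
  measurable_fun setT h -> (forall x, x \notin `[a, b] -> h x = 0) ->
  (forall x, x \in `[a, b] -> `|h x| <= U x) ->
  exists2 C, 0 <= C & forall t, t \in `[a, b] ->
    [/\ mu.-integrable setT (fun x => (ker al (t - x) * h x)%:E),
        mu.-integrable setT (fun x => (ker al (x - t) * h x)%:E),
        `|Il al h t| <= C & `|Ir al h t| <= C].
Proof.
move=> alM pU mh h0 hU; have [mU U0 _] := pU.
have [C C0 hC] := powint_ker_bounded al01 alM pU.
exists (`|(Gamma al)^-1| * C); first by rewrite mulr_ge0.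
move=> t tab; have [h1 h2] := hC t tab.
have key (k : R -> R) : measurable_fun setT k -> (forall x, 0 <= k x) ->
    (\int[mu]_(x in `[a, b]) (U x * k x)%:E <= C%:E)%E ->
    mu.-integrable setT (fun x => (k x * h x)%:E) /\
    `|\int[mu]_x (k x * h x)| <= C.
  move=> mk k0 kC.
  have mkh : measurable_fun setT (fun x => k x * h x) by exact: measurable_funM.
  have mUk : measurable_fun setT (fun x => U x * k x) by exact: measurable_funM.
  have khU x : x \in `[a, b] -> `|k x * h x| <= U x * k x.
    by move=> xab; rewrite normrM (ger0_norm (k0 x)) mulrC ler_wpM2r// hU.
  have kh0 x : x \notin `[a, b] -> k x * h x = 0 by move=> xab; rewrite h0// mulr0.
  have ki := integrable_off_itv mkh kh0 mUk khU (le_lt_trans kC (ltry _)).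
  split => //; apply: le_trans (le_normr_Rintegral _ ki) _ => //.
  rewrite -lee_fin fineK; last first.
    by have /integrableP[_] := ki; rewrite ge0_fin_numE// integral_ge0.
  apply: le_trans kC.
  rewrite [leRHS]integral_mkcond; apply: ge0_le_integral => //.
  - by apply/measurable_EFinP; exact: measurableT_comp.
  - apply/(measurable_restrictT _ (measurable_itv _)).
    by apply/measurable_EFinP/measurable_funTS.
  - move=> x _; rewrite patchE mem_setE; case: ifPn => xab; first by rewrite lee_fin khU.
    by rewrite kh0// normr0.
have mk1 : measurable_fun setT (fun x : R => ker al (t - x)) by exact: measurable_kerB.
have mk2 : measurable_fun setT (fun x : R => ker al (x - t)) by exact: measurable_kerB.
have [i1 b1] := key _ mk1 (fun x => ker_ge0 _ _) h1.
have [i2 b2] := key _ mk2 (fun x => ker_ge0 _ _) h2.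
by split; [exact: i1|exact: i2| |]; rewrite normrM ler_wpM2l.
Qed.

Lemma density_le f i t : `|f i t| <= enorm (\row_i f i t).
Proof. by apply: le_trans (coord_le_enorm _ i); rewrite mxE. Qed.

Lemma density_zint f : density f -> zint a b f.
Proof.
move=> [mf f0 pf] i; split; last exact: f0.
have [mU U0 _] := pf.
apply: (integrable_off_itv (mf i) (f0 i) mU) => [x _|]; first exact: density_le.
exact: powint_integral_lty p1 pf.
Qed.

Lemma density_Il f i : density f -> exists2 C, 0 <= C & forall t, t \in `[a, b] ->
  mu.-integrable setT (fun x => (ker al (t - x) * f i x)%:E) /\
  `|Il al (f i) t| <= C.
Proof.
move=> [mf f0 pf].
have [C C0 hC] := Il_Ir_bounded alp pf (mf i) (f0 i) (fun x _ => density_le f i x).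
by exists C => // t tab; have [] := hC t tab.
Qed.

Lemma measurable_RLcurve c f i : density f ->
  measurable_fun setT (fun t => RLcurve c f t ord0 i).
Proof.
move=> [mf _ _]; rewrite /RLcurve; under eq_fun do rewrite mxE.
apply: measurable_funD; last exact: measurable_Il.
by apply: measurable_funM => //; exact: measurable_kerB.
Qed.

Lemma RLcurve_bound c f : density f -> exists2 K, 0 <= K & forall t, a < t <= b ->
  forall i, `|RLcurve c f t ord0 i| <= K * ker al (t - a).
Proof.
move=> df; have /andP[al0 al1] := al01.
have /choice[C hC] i : exists C, 0 <= C /\ forall t, t \in `[a, b] -> `|Il al (f i) t| <= C.
  have [C C0 h] := density_Il i df; exists C; split => // t /h[] //.
(* The kernel decreases, so this is its minimum on []a, b]]; dividing by it absorbs the bounded term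
   [I^al f] into a multiple of the kernel. *)
pose k0 := ker al (b - a).
have k00 : 0 < k0 by rewrite /k0 /ker subr_gt0 ab powR_gt0// subr_gt0.
pose K i := `|c ord0 i / Gamma al| + C i / k0.
have K0 i : 0 <= K i by rewrite addr_ge0// divr_ge0 ?(ltW k00)//; case: (hC i).
exists (\sum_i K i); first by apply: sumr_ge0.
move=> t /andP[ta tb] i; rewrite mxE.
have kt : k0 <= ker al (t - a).
  rewrite /k0 /ker !subr_gt0 ab ta -[al - 1]opprB !powRN lef_pV2 ?posrE ?powR_gt0 ?subr_gt0//.
  by rewrite ge0_ler_powR ?nnegrE ?subr_ge0 ?(ltW al1) ?(ltW ab) ?(ltW ta)// lerD2r.
apply: (@le_trans _ _ (K i * ker al (t - a))); last first.
  by rewrite ler_wpM2r ?ker_ge0// (bigD1 i)//= lerDl sumr_ge0.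
apply: le_trans (ler_normD _ _) _; rewrite /K mulrDl lerD//.
  by rewrite normrM (ger0_norm (ker_ge0 _ _)).
have [C0 hCi] := hC i.
apply: (@le_trans _ _ (C i)); first by apply: hCi; rewrite in_itv/= (ltW ta).
by rewrite -mulrA ler_peMr// mulrC ler_pdivlMr// mul1r.
Qed.

Lemma densityD f phi l : density f -> density phi ->
  density (fun i x => f i x + l * phi i x).
Proof.
move=> [mf f0 pf] [mp p0 pp].
have mfp i : measurable_fun setT (fun x => f i x + l * phi i x).
  by apply: measurable_funD => //; exact: measurable_funM.
split => //; first by move=> i x xab; rewrite f0// p0// mulr0 addr0.
have p0' : (0%:E < p)%E by rewrite (lt_le_trans _ p1)// lte_fin.
have pU := powint_affine ab p0' (ler0n R m) (lexx 0) pf.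
have ml0 : 0 <= m%:R * `|l| by rewrite mulr_ge0.
have pW := powint_affine ab p0' ml0 (lexx 0) pp.
apply: powint_le (powintD ab p0' pU pW) => //.
- exact: measurable_enorm.
- by move=> t; exact: enorm_ge0.
- move=> t _; rewrite !addr0; apply: le_trans (enorm_le_sum _) _.
  rewrite -mulrA -mulrDr mulr_natl -[X in _ *+ X]card_ord -sumr_const.
  apply: ler_sum => i _; rewrite mxE; apply: le_trans (ler_normD _ _) _.
  by rewrite normrM lerD ?ler_wpM2l// density_le.
Qed.

(** Additivity relies on the convergence of both integrals at [t] itself, which the condition
    [1/p < al] gives throughout [[a, b]]. *)
Lemma RLcurveD c d f phi l t : density f -> density phi -> t \in `[a, b] ->
  RLcurve (c + l *: d) (fun i x => f i x + l * phi i x) t =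
  RLcurve c f t + l *: RLcurve d phi t.
Proof.
move=> df dp tab; apply/rowP => i; rewrite !mxE.
have [C1 _ /(_ t tab)[i1 _]] := density_Il i df.
have [C2 _ /(_ t tab)[i2 _]] := density_Il i dp.
have -> : Il al (fun x => f i x + l * phi i x) t = Il al (f i) t + l * Il al (phi i) t.
  rewrite /Il mulrCA -mulrDr; congr (_ * _).
  rewrite -RintegralZl// -RintegralD//; last first.
    by have := integrableZl measurableT l i2; apply: eq_integrable.
  by apply: eq_Rintegral => x _; ring.
by ring.
Qed.

Lemma left_rep_RLcurve c f : density f -> left_rep a b al (RLcurve c f) c f.
Proof.
move=> df; split; first exact: density_zint.
by move=> i; apply: aeW => t _; rewrite mxE.
Qed.

Lemma left_rep_ae q c f g : left_rep a b al q c f -> zint a b g ->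
  (forall i, {ae mu, forall t, t \in `[a, b] -> f i t = g i t}) ->
  left_rep a b al q c g.
Proof.
move=> [zf qE] zg fg; split => // i; apply: ae_imp (qE i) => t h tab.
rewrite h//; congr (_ + _); apply: ae_eq_Il.
rewrite -(zint_patch i zf) -(zint_patch i zg); exact: ae_eq_patch.
Qed.

Lemma AC_left_density q : AC_left a b al p q ->
  exists c f, density f /\ left_rep a b al q c f.
Proof.
move=> qAC; have [c [f qr]] := AC_left_left_rep ab al01 qAC.
have [g [mg g0 fg pg]] := in_Lp_powint p1 (left_rep_in_Lp ab al01 qAC qr).
have dg : density g by [].
exists c, g; split => //; apply: left_rep_ae qr (density_zint dg) _ => i.
by apply: ae_imp fg => t h tab; have /rowP/(_ i) := h tab; rewrite !mxE.
Qed.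

Lemma RLcurve_AC_left c f : density f -> AC_left a b al p (RLcurve c f).
Proof.
move=> df; apply: (left_rep_AC_left ab al01 (left_rep_RLcurve c df)); last first.
  have [mf _ pf] := df; apply: powint_in_Lp pf mf _ => // i t _.
  exact: density_le.
pose r i := (fun t => RLcurve c f t ord0 i) \_ `[a, b].
have zr : zint a b r.
  move=> i; split; last by move=> x xab; rewrite /r patchE mem_setE (negbTE xab).
  have [K K0 hK] := RLcurve_bound c df.
  have /andP[al0 _] := al01.
  have [C C0 [_ hC]] := @integral_ker_itvcc R a b al al0.
  (* The added constant takes care of [t = a], where the kernel is 0 by convention. *)
  apply: (@integrable_off_itv _ (fun t => K * ker al (t - a) + `|RLcurve c f a ord0 i|)).
  - by apply/(measurable_restrictT _ (measurable_itv _))/measurable_funTS; exact: measurable_RLcurve.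
  - by move=> x xab; rewrite /r patchE mem_setE (negbTE xab).
  - by apply: measurable_funD => //; apply: measurable_funM => //; exact: measurable_kerB.
  - move=> x xab; rewrite /r patchE mem_setE xab.
    move: (xab); rewrite in_itv/= le_eqVlt => /andP[/predU1P[<-|ax] xb].
      by rewrite lerDr mulr_ge0 ?ker_ge0.
    by apply: le_trans (hK x _ i) _; rewrite ?ax// lerDl.
  - apply: integral_lty_add => //; last exact: integral_lty_cst.
    + by apply: measurable_funM => //; exact: measurable_kerB.
    + by move=> t; rewrite mulr_ge0 ?ker_ge0.
    + apply: integral_lty_scale => //; [exact: measurable_kerB|by move=> t; exact: ker_ge0|].
      exact: le_lt_trans (hC a (lexx a)) (ltry _).
apply: (zint_in_Lp1 zr) => i; apply: aeW => t tab.
by rewrite /r patchE mem_setE tab.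
Qed.

(** Removes the choice operators from the functional: all its ingredients are computed from [c] and
    [f], up to null sets that the integral ignores. *)
Lemma bolza_left_rep L ell q c f : left_rep a b al q c f ->
  bolza a b al L ell q =
  \int[mu]_(t in `[a, b]) L t (RLcurve c f t) (\row_i f i t) + ell c (RLcurve c f b).
Proof.
move=> qr; rewrite /bolza (left_rep_RLac ab al01 qr) (left_rep_RLval ab al01 qr).
congr (_ + _); apply: ae_eq_Rintegral.
apply: ae_imp2 (left_rep_RLder ab al01 qr) (ae_forall_fin qr.2) => t h1 h2 tab.
by rewrite h1//; congr (L t _ _); apply/rowP => i; rewrite mxE h2.
Qed.

End Densities.

(** * Dominated convergence for the first variation *)

Section Variation.
Context {R : realType}.
Local Notation mu := (@lebesgue_measure R).
Variables (m : nat) (a b al : R) (p s : \bar R).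
Hypotheses (ab : a < b) (al01 : 0 < al < 1) (p1 : (1%:E <= p)%E).
Hypothesis alp : (al^-1%:E < p)%E.
Local Notation V := 'rV[R]_m.
Variables (L : R -> V -> V -> R) (hL : lagrangian a b L).

Local Notation LF t := (fun z : V * V => L t z.1 z.2).

Lemma lagrangian_diff t z : a <= t <= b -> differentiable (LF t) z.
Proof. by move=> tab; have [_ /(_ t tab)[]] := hL. Qed.

Lemma measurable_lagrangian_curve (z2 z3 : 'I_m -> R -> R) :
  (forall i, measurable_fun setT (z2 i)) -> (forall i, measurable_fun setT (z3 i)) ->
  measurable_fun `]a, b] (fun t => L t (\row_i z2 i t) (\row_i z3 i t)).
Proof.
move=> mz2 mz3; have [cL _] := hL.
(* [L] is continuous only over [[a, b]], so the time is clamped to keep the curve in that set. *)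
pose z1 (t : R) := Num.max a (Num.min b t).
have mz1 : measurable_fun setT z1.
  by apply: measurable_maxr => //; exact: measurable_minr.
have Sz t : a <= z1 t <= b.
  by rewrite /z1 le_max lexx/= ge_max (ltW ab)/= ge_min lexx.
have := measurable_curve cL mz1 mz2 mz3 Sz => /(measurable_funTS (D := `]a, b]%classic)).
apply: eq_measurable_fun => t; rewrite inE/= in_itv/= => /andP[ta tb].
by rewrite /z1 min_r// max_r// ltW.
Qed.

(** A pointwise limit of difference quotients of [L], each of them measurable by joint continuity of
    [L]; choosing unit directions then gives [L_x] and [L_v]. *)
Lemma measurable_diff_curve (z2 z3 k2 k3 : 'I_m -> R -> R) :
  (forall i, measurable_fun setT (z2 i)) -> (forall i, measurable_fun setT (z3 i)) ->
  (forall i, measurable_fun setT (k2 i)) -> (forall i, measurable_fun setT (k3 i)) ->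
  measurable_fun `]a, b] (fun t : R => 'd (LF t) (\row_i z2 i t, \row_i z3 i t)
    (\row_i k2 i t, \row_i k3 i t)).
Proof.
move=> mz2 mz3 mk2 mk3.
apply: (@measurable_fun_cvg _ _ _ _ (fun n t =>
  (LF t ((\row_i z2 i t, \row_i z3 i t) + lam n *: (\row_i k2 i t, \row_i k3 i t))
   - LF t (\row_i z2 i t, \row_i z3 i t)) / lam n)) => [n|t]; last first.
  rewrite /= in_itv/= => /andP[ta tb]; apply: diff_quotient_cvg => z.
  by apply: lagrangian_diff; rewrite (ltW ta).
apply: measurable_funM => //; apply: measurable_funB.
  have mD (u v : 'I_m -> R -> R) : (forall i, measurable_fun setT (u i)) ->
      (forall i, measurable_fun setT (v i)) ->
      forall i, measurable_fun setT (fun t => u i t + lam n * v i t).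
    by move=> mu_ mv i; apply: measurable_funD => //; exact: measurable_funM.
  have := measurable_lagrangian_curve (mD _ _ mz2 mk2) (mD _ _ mz3 mk3).
  apply: eq_measurable_fun => t _ /=.
  by congr (L t _ _); apply/rowP => i; rewrite !mxE.
exact: measurable_lagrangian_curve.
Qed.

Lemma diff_lagrangian t (x v y w : V) : a <= t <= b ->
  'd (LF t) (x, v) (y, w) = \sum_i y ord0 i * L_x L t x v ord0 i +
    \sum_i w ord0 i * L_v L t x v ord0 i.
Proof. by move=> tab; rewrite diff_gradient//; exact: lagrangian_diff. Qed.

Lemma measurable_L_x (z2 z3 : 'I_m -> R -> R) i :
  (forall i, measurable_fun setT (z2 i)) -> (forall i, measurable_fun setT (z3 i)) ->
  measurable_fun `]a, b] (fun t : R => L_x L t (\row_i z2 i t) (\row_i z3 i t) ord0 i).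
Proof.
move=> mz2 mz3.
have := measurable_diff_curve mz2 mz3 (fun j => measurable_cst (delta_mx (ord0 : 'I_1) i ord0 j : R))
  (fun j => measurable_cst (0 : R)).
apply: eq_measurable_fun => t; rewrite inE/= in_itv/= => /andP[ta tb].
have -> : (\row_j (cst (delta_mx (ord0 : 'I_1) i ord0 j : R) t), \row_j (cst (0 : R) t)) =
    (delta_mx ord0 i, 0) :> V * V.
  by congr pair; apply/rowP => j; rewrite !mxE.
rewrite diff_gradient1//; apply: lagrangian_diff; by rewrite (ltW ta).
Qed.

Lemma measurable_L_v (z2 z3 : 'I_m -> R -> R) i :
  (forall i, measurable_fun setT (z2 i)) -> (forall i, measurable_fun setT (z3 i)) ->
  measurable_fun `]a, b] (fun t : R => L_v L t (\row_i z2 i t) (\row_i z3 i t) ord0 i).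
Proof.
move=> mz2 mz3.
have := measurable_diff_curve mz2 mz3 (fun j => measurable_cst (0 : R))
  (fun j => measurable_cst (delta_mx (ord0 : 'I_1) i ord0 j : R)).
apply: eq_measurable_fun => t; rewrite inE/= in_itv/= => /andP[ta tb].
have -> : (\row_j (cst (0 : R) t), \row_j (cst (delta_mx (ord0 : 'I_1) i ord0 j : R) t)) =
    (0, delta_mx ord0 i) :> V * V.
  by congr pair; apply/rowP => j; rewrite !mxE.
rewrite diff_gradient2//; apply: lagrangian_diff; by rewrite (ltW ta).
Qed.

(** The mean value theorem on the segment from [(x, v)] to [(x + l *: y, v + l *: w)]. *)
Lemma lagrangian_quotient_le t (x v y w : V) (l C1 C2 : R) : a <= t <= b -> 0 < l <= 1 ->
  (forall th, 0 <= th <= 1 -> enorm (L_x L t (x + th *: y) (v + th *: w)) <= C1) ->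
  (forall th, 0 <= th <= 1 -> enorm (L_v L t (x + th *: y) (v + th *: w)) <= C2) ->
  `|(L t (x + l *: y) (v + l *: w) - L t x v) / l| <=
  C1 * \sum_i `|y ord0 i| + C2 * \sum_i `|w ord0 i|.
Proof.
move=> tab /andP[l0 l1] hC1 hC2.
pose g (r : R) := LF t ((x, v) + r *: (y, w)).
have dg (r : R) : is_derive r 1 g ('d (LF t) ((x, v) + r *: (y, w)) (y, w)).
  by apply: is_derive_line => z; exact: lagrangian_diff.
have cg : {within `[0, l], continuous g}.
  apply: derivable_within_continuous => r _; exact: (@ex_derive _ _ _ _ _ _ _ (dg r)).
have [r rl gE] := MVT_segment (ltW l0) (fun r _ => dg r) cg.
have r01 : 0 <= r <= 1.
  by move: rl; rewrite in_itv/= => /andP[-> /le_trans ->].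
have -> : L t (x + l *: y) (v + l *: w) - L t x v = g l - g 0.
  by rewrite /g /= !scale0r !addr0.
rewrite gE subr0 mulfK ?gt_eqF// diff_lagrangian//=.
apply: le_trans (ler_normD _ _) _; apply: lerD.
  apply: le_trans (norm_dot_le _ _) _.
  by rewrite ler_wpM2r ?sumr_ge0//; exact: hC1.
apply: le_trans (norm_dot_le _ _) _.
by rewrite ler_wpM2r ?sumr_ge0//; exact: hC2.
Qed.

Hypothesis hgr : qp_controlled a b al p s L.

Lemma s_ge1 : (1%:E <= s)%E.
Proof.
have [als _] := hgr; apply: le_trans (ltW als); rewrite lee_fin.
by have /andP[al0 al1] := al01; rewrite invf_ge1// ltW.
Qed.

Lemma growth_dominated K U : 0 <= K -> powint a b p U -> exists G0 G1 G2,
  [/\ powint a b 1%:E G0, powint a b s G1, powint a b (hoelder_conjugate p) G2 &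
    forall t x v, a < t <= b -> enorm x <= K * ker al (t - a) -> enorm v <= U t ->
    [/\ `|L t x v| <= G0 t, enorm (L_x L t x v) <= G1 t & enorm (L_v L t x v) <= G2 t]].
Proof.
move=> K0 pU; have [_ [P0 [P1 [P2 [q0 q1 q2 h]]]]] := hgr.
have [G0 pG0 h0] := quasipoly_powint ab al01 p1 (lexx 1%:E) K0 pU q0.
have [G1 pG1 h1] := quasipoly_powint ab al01 p1 s_ge1 K0 pU q1.
have [G2 pG2 h2] := quasipoly_powint ab al01 p1 (hoelder_conj_ge1 p1) K0 pU q2.
exists G0, G1, G2; split => // t x v tab xK vU.
have tab' : a <= t <= b by case/andP: tab => /ltW ->.
have [l0 l1 l2] := h t x v tab'; split.
- exact: le_trans l0 (h0 t x v tab xK vU).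
- exact: le_trans l1 (h1 t x v tab xK vU).
- exact: le_trans l2 (h2 t x v tab xK vU).
Qed.

Variables (c : V) (f : 'I_m -> R -> R) (df : density a b p f).
Let Q := RLcurve a al c f.
Let F (t : R) : V := \row_i f i t.

(** The point [a] is excluded because the growth estimates along [Q] hold only for [t > a]. *)
Definition wx i := (fun t => L_x L t (Q t) (F t) ord0 i) \_ `]a, b].
Definition wv i := (fun t => L_v L t (Q t) (F t) ord0 i) \_ `]a, b].

Lemma Q_row t : Q t = \row_i (fun x => Q x ord0 i) t.
Proof. by apply/rowP => i; rewrite mxE. Qed.

Let mQ i : measurable_fun setT (fun x => Q x ord0 i).
Proof. exact: measurable_RLcurve df. Qed.

Let mf i : measurable_fun setT (f i).
Proof. by case: df. Qed.

Lemma measurable_wx i : measurable_fun setT (wx i).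
Proof.
apply/(measurable_restrictT _ (measurable_itv _)).
have := @measurable_L_x (fun i x => Q x ord0 i) f i mQ mf.
by apply: eq_measurable_fun => t _; rewrite -Q_row.
Qed.

Lemma measurable_wv i : measurable_fun setT (wv i).
Proof.
apply/(measurable_restrictT _ (measurable_itv _)).
have := @measurable_L_v (fun i x => Q x ord0 i) f i mQ mf.
by apply: eq_measurable_fun => t _; rewrite -Q_row.
Qed.

Lemma wx_out i x : x \notin `[a, b] -> wx i x = 0.
Proof.
move=> xab; rewrite /wx patchE mem_setE; case: ifPn => //.
by rewrite in_itv/= => /andP[/ltW ax xb]; move: xab; rewrite in_itv/= ax xb.
Qed.

Lemma wv_out i x : x \notin `[a, b] -> wv i x = 0.
Proof.
move=> xab; rewrite /wv patchE mem_setE; case: ifPn => //.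
by rewrite in_itv/= => /andP[/ltW ax xb]; move: xab; rewrite in_itv/= ax xb.
Qed.

Lemma enorm_le_cst (x : V) C : (forall i, `|x ord0 i| <= C) -> enorm x <= m%:R * C.
Proof.
move=> xC; apply: le_trans (enorm_le_sum _) _.
by rewrite mulr_natl -[X in _ *+ X]card_ord -sumr_const; apply: ler_sum => i _.
Qed.

Lemma wx_wv_dominated : exists G1 G2,
  [/\ powint a b s G1, powint a b (hoelder_conjugate p) G2,
    forall i t, `|wx i t| <= G1 t & forall i t, `|wv i t| <= G2 t].
Proof.
have [K K0 hK] := RLcurve_bound ab al01 alp c df.
have [_ _ pf] := df.
have mK0 : 0 <= m%:R * K by rewrite mulr_ge0.
have [G0 [G1 [G2 [_ pG1 pG2 h]]]] := growth_dominated mK0 pf.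
have [_ G10 _] := pG1; have [_ G20 _] := pG2.
have key t : a < t <= b -> [/\ `|L t (Q t) (F t)| <= G0 t,
    enorm (L_x L t (Q t) (F t)) <= G1 t & enorm (L_v L t (Q t) (F t)) <= G2 t].
  move=> tab; apply: h => //; rewrite -mulrA; apply: enorm_le_cst => i.
  exact: hK.
exists G1, G2; split => // i t.
  rewrite /wx patchE mem_setE in_itv/=; case: ifPn => [/key[_ h1 _]|]; last by rewrite normr0.
  exact: le_trans (coord_le_enorm _ _) h1.
rewrite /wv patchE mem_setE in_itv/=; case: ifPn => [/key[_ _ h1]|]; last by rewrite normr0.
exact: le_trans (coord_le_enorm _ _) h1.
Qed.

Lemma wx_in_Lp : exists2 G, powint a b s G & forall i t, `|wx i t| <= G t.
Proof. by have [G1 [_ [pG1 _ h _]]] := wx_wv_dominated; exists G1. Qed.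

Lemma zint_wx : zint a b wx.
Proof.
have [G1 [_ [pG1 _ h _]]] := wx_wv_dominated => i; split; last exact: wx_out.
have [mG1 _ _] := pG1.
apply: (integrable_off_itv (measurable_wx i) (@wx_out i) mG1) => //.
exact: powint_integral_lty s_ge1 pG1.
Qed.

Lemma zint_wv : zint a b wv.
Proof.
have [_ [G2 [_ pG2 _ h]]] := wx_wv_dominated => i; split; last exact: wv_out.
have [mG2 _ _] := pG2.
apply: (integrable_off_itv (measurable_wv i) (@wv_out i) mG2) => //.
exact: powint_integral_lty (hoelder_conj_ge1 p1) pG2.
Qed.

Variables (d : V) (phi : 'I_m -> R -> R) (B : R).
Hypotheses (dp : density a b p phi) (phiB : forall i x, `|phi i x| <= B).
Let H := RLcurve a al d phi.
Let Ph (t : R) : V := \row_i phi i t.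

Let mH i : measurable_fun setT (fun x => H x ord0 i).
Proof. exact: measurable_RLcurve dp. Qed.

Let mp i : measurable_fun setT (phi i).
Proof. by case: dp. Qed.

Let m0 (l : R) : measurable_fun `]a, b] (fun t => L t (Q t + l *: H t) (F t + l *: Ph t)).
Proof.
have mD (u v : 'I_m -> R -> R) : (forall i, measurable_fun setT (u i)) ->
    (forall i, measurable_fun setT (v i)) ->
    forall i, measurable_fun setT (fun t => u i t + l * v i t).
  by move=> mu_ mv i; apply: measurable_funD => //; exact: measurable_funM.
have := measurable_lagrangian_curve (mD _ _ mQ mH) (mD _ _ mf mp).
apply: eq_measurable_fun => t _.
by congr (L t _ _); apply/rowP => i; rewrite !mxE.
Qed.

(** The integrands on the left are difference quotients that converge to the differential of [L]; by
    the mean value theorem they are dominated by an integrable function independent of [n]. *)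
Lemma variation_cvg :
  (\int[mu]_(t in `]a, b]) L t (Q t + lam n *: H t) (F t + lam n *: Ph t)
   - \int[mu]_(t in `]a, b]) L t (Q t) (F t)) / lam n @[n --> \oo] -->
  \int[mu]_t (\sum_i H t ord0 i * wx i t + \sum_i phi i t * wv i t).
Proof.
have [K1 K10 hK1] := RLcurve_bound ab al01 alp c df.
have [K2 K20 hK2] := RLcurve_bound ab al01 alp d dp.
have B0 : 0 <= `|B| by [].
have [_ _ pf] := df.
have p0 : (0%:E < p)%E by rewrite (lt_le_trans _ p1)// lte_fin.
have mB0 : 0 <= m%:R * `|B| by rewrite mulr_ge0.
have pU := powint_affine ab p0 (ler0n R m) mB0 pf.
have mK0 : 0 <= m%:R * (K1 + K2) by rewrite mulr_ge0// addr_ge0.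
have [G0 [G1 [G2 [pG0 pG1 pG2 hG]]]] := growth_dominated mK0 pU.
(* Uniform in [l], so the majorants of [hG] hold on the whole segment to which the mean value
   theorem is applied. *)
have bd (l t : R) : 0 <= l <= 1 -> a < t <= b ->
    enorm (Q t + l *: H t) <= m%:R * (K1 + K2) * ker al (t - a) /\
    enorm (F t + l *: Ph t) <= m%:R * enorm (F t) + m%:R * `|B|.
  move=> /andP[l0 l1] tab; split.
    rewrite -mulrA; apply: enorm_le_cst => i; rewrite mxE [X in _ + X]mxE.
    apply: le_trans (ler_normD _ _) _; rewrite mulrDl; apply: lerD; first exact: hK1.
    rewrite normrM (ger0_norm l0); apply: le_trans (hK2 t tab i).
    by rewrite ler_piMl.
  rewrite -mulrDr; apply: enorm_le_cst => i; rewrite !mxE.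
  apply: le_trans (ler_normD _ _) _; apply: lerD; first exact: density_le.
  rewrite normrM (ger0_norm l0); apply: (@le_trans _ _ `|phi i t|); first by rewrite ler_piMl.
  exact: le_trans (phiB i t) (ler_norm _).
have [mG0 G00 _] := pG0; have [mG1 G10 _] := pG1; have [mG2 G20 _] := pG2.
have int_oc (G : R -> R) : measurable_fun setT G -> (forall t, 0 <= G t) ->
    (\int[mu]_(t in `[a, b]) (G t)%:E < +oo)%E ->
    mu.-integrable `]a, b] (EFin \o G).
  move=> mG Gp Goo; apply/integrableP; split.
    by apply/measurable_EFinP/measurable_funTS.
  apply: le_lt_trans Goo; under eq_integral do rewrite gee0_abs ?lee_fin//.
  apply: ge0_subset_integral => //.
  - by apply/measurable_EFinP/measurable_funTS.
  - by move=> x _; rewrite lee_fin.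
  - by move=> x; rewrite /= !in_itv/= => /andP[/ltW -> ->].
have Lint (l : R) : 0 <= l <= 1 ->
    mu.-integrable `]a, b] (fun t => (L t (Q t + l *: H t) (F t + l *: Ph t))%:E).
  move=> l01.
  have G0i := int_oc G0 mG0 G00 (powint_integral_lty ab (lexx 1%:E) pG0).
  apply: (le_integrable _ _ _ G0i) => //; first by apply/measurable_EFinP; exact: m0.
  move=> t; rewrite /= in_itv/= => tab; rewrite lee_fin (ger0_norm (G00 t)).
  by have [e1 e2] := bd l t l01 tab; have [] := hG t _ _ tab e1 e2.
have lam01 n : (0 : R) <= lam n <= 1 by rewrite ltW ?lam_gt0//= lam_le1.
have Lint0 : mu.-integrable `]a, b] (fun t => (L t (Q t) (F t))%:E).
  have := Lint 0; rewrite lexx ler01 => /(_ isT).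
  by apply: eq_integrable => // t _; rewrite !scale0r !addr0.
pose q_ (n : nat) t := (L t (Q t + lam n *: H t) (F t + lam n *: Ph t) - L t (Q t) (F t)) / lam n.
(* [H] contributes the kernel and [phi] its bound; the factors [m%:R] pass from one coordinate to
   the sum of all. *)
pose G t := G1 t * (m%:R * K2 * ker al (t - a)) + G2 t * (m%:R * `|B|).
have mG : measurable_fun setT G.
  apply: measurable_funD; last exact: measurable_funM.
  by apply: measurable_funM => //; apply: measurable_funM => //; exact: measurable_kerB.
have Gp t : 0 <= G t by rewrite addr_ge0// !mulr_ge0 ?ker_ge0.
have Gi : mu.-integrable `]a, b] (EFin \o G).
  apply: int_oc => //; apply: integral_lty_add.
  - by apply: measurable_funM => //; apply: measurable_funM => //; exact: measurable_kerB.
  - by move=> t; rewrite !mulr_ge0 ?ker_ge0.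
  - exact: measurable_funM.
  - by move=> t; rewrite mulr_ge0.
  (* [G1] is of class L^s with [1/s < al], hence integrable against the kernel based at [a]. *)
  - have [als _] := hgr; have [C C0 hC] := powint_ker_bounded al01 als pG1.
    under eq_integral do rewrite mulrCA.
    apply: integral_lty_scale.
    + by apply: measurable_funM => //; exact: measurable_kerB.
    + by move=> t; rewrite mulr_ge0 ?ker_ge0.
    + by rewrite mulr_ge0.
    + have aab : a \in `[a, b] by rewrite in_itv/= lexx ltW.
      by apply: le_lt_trans (hC a aab).2 _; exact: ltry.
  - under eq_integral do rewrite mulrC.
    apply: integral_lty_scale => //.
    exact: powint_integral_lty (hoelder_conj_ge1 p1) pG2.
have qG n t : a < t <= b -> `|q_ n t| <= G t.
  move=> tab; have tab' : a <= t <= b by case/andP: tab => /ltW ->.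
  have l01 : (0 < lam n :> R) && (lam n <= 1 :> R) by rewrite lam_gt0; exact: lam_le1.
  apply: le_trans (@lagrangian_quotient_le t (Q t) (F t) (H t) (Ph t) (lam n) (G1 t) (G2 t) tab' l01 _ _) _.
  - by move=> th th01; have [e1 e2] := bd th t th01 tab; have [] := hG t _ _ tab e1 e2.
  - by move=> th th01; have [e1 e2] := bd th t th01 tab; have [] := hG t _ _ tab e1 e2.
  have sumC (x : V) C : (forall i, `|x ord0 i| <= C) -> \sum_i `|x ord0 i| <= m%:R * C.
    by move=> xC; rewrite mulr_natl -[X in _ *+ X]card_ord -sumr_const; apply: ler_sum => i _.
  apply: lerD; apply: ler_wpM2l => //.
    by rewrite -mulrA; apply: sumC => i; exact: hK2.
  by apply: sumC => i; rewrite mxE; exact: le_trans (phiB i t) (ler_norm _).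
pose D t := 'd (LF t) (Q t, F t) (H t, Ph t).
have mD : measurable_fun `]a, b] D.
  have := measurable_diff_curve mQ mf mH mp; apply: eq_measurable_fun => t _.
  have HE : \row_i H t ord0 i = H t by apply/rowP => i; rewrite mxE.
  by rewrite /= -Q_row HE.
have mq n : measurable_fun `]a, b] (q_ n).
  apply: measurable_funM => //; apply: measurable_funB; first exact: m0.
  have := m0 0; apply: eq_measurable_fun => t _; by rewrite !scale0r !addr0.
have qD t : a < t <= b -> q_ ^~ t @ \oo --> D t.
  move=> tab; have tab' : a <= t <= b by case/andP: tab => /ltW ->.
  apply: (@diff_quotient_cvg _ _ (LF t) (Q t, F t) (H t, Ph t)) => z.
  exact: lagrangian_diff.
have tabP (t : R) : `]a, b]%classic t -> a < t <= b by rewrite /= in_itv.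
have [|||||Di _ cvgI] := @dominated_convergence _ _ _ mu `]a, b]%classic (measurable_itv _)
  (fun n t => (q_ n t)%:E) (EFin \o D) (EFin \o G).
- by move=> n; apply/measurable_EFinP; exact: mq.
- by apply/measurable_EFinP.
- apply: aeW => t /tabP tab; apply: cvg_EFin; last exact: qD.
  exact: nearW.
- exact: Gi.
- by apply: aeW => t n /tabP tab; rewrite lee_fin qG.
have IE n : (\int[mu]_(t in `]a, b]) L t (Q t + lam n *: H t) (F t + lam n *: Ph t)
   - \int[mu]_(t in `]a, b]) L t (Q t) (F t)) / lam n = \int[mu]_(t in `]a, b]) q_ n t.
  have mL0 : measurable_fun `]a, b] (fun t => L t (Q t) (F t)).
    by have := m0 0; apply: eq_measurable_fun => t _; rewrite !scale0r !addr0.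
  rewrite RintegralMr//; last by apply: measurable_funB => //; exact: m0.
  by rewrite RintegralB//; exact: Lint.
under eq_fun do rewrite IE.
have -> : \int[mu]_t (\sum_i H t ord0 i * wx i t + \sum_i phi i t * wv i t) =
    \int[mu]_(t in `]a, b]) D t.
  rewrite [RHS]Rintegral_mkcond; apply: eq_Rintegral => t _.
  rewrite patchE mem_setE; case: ifPn => tab; last first.
    by rewrite !big1 ?addr0// => i _; rewrite /wx /wv patchE mem_setE (negbTE tab) mulr0.
  have tab' : a <= t <= b by move: tab; rewrite in_itv/= => /andP[/ltW -> ->].
  rewrite /D diff_lagrangian//; congr (_ + _); apply: eq_bigr => i _.
    by rewrite /wx patchE mem_setE tab.
  by rewrite /wv patchE mem_setE tab; congr (_ * _); rewrite mxE.
apply: fine_cvg; rewrite /Rintegral fineK//; last exact: integrable_fin_num Di.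
Qed.

End Variation.

(** * Euler-Lagrange equation *)

Section EulerLagrange.
Context {R : realType}.
Local Notation mu := (@lebesgue_measure R).
Variables (m : nat) (a b al : R) (p s : \bar R).
Hypotheses (ab : a < b) (al01 : 0 < al < 1) (p1 : (1%:E <= p)%E).
Hypothesis alp : (al^-1%:E < p)%E.
Local Notation V := 'rV[R]_m.
Variables (L : R -> V -> V -> R) (ell : V -> V -> R).
Hypotheses (hL : lagrangian a b L) (hell : is_C1 (fun z : V * V => ell z.1 z.2)).
Hypothesis hgr : qp_controlled a b al p s L.
Variables (c : V) (f : 'I_m -> R -> R) (df : density a b p f).
Local Notation Q := (RLcurve a al c f).
Local Notation wx := (wx a b al L c f).
Local Notation wv := (wv a b al L c f).
Local Notation x2 := (RLcurve a al c f b).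

Lemma Rintegral_itv_cc_oc (g : R -> R) :
  \int[mu]_(t in `[a, b]) g t = \int[mu]_(t in `]a, b]) g t.
Proof.
rewrite Rintegral_mkcond [RHS]Rintegral_mkcond; apply: ae_eq_Rintegral.
apply: ae_imp (ae_neq a) => t ta _.
by rewrite !patchE !mem_setE !in_itv/= lt_neqAle eq_sym ta.
Qed.

(** Along [lam n] the quotients of the functional tend to 0 by criticality and to the left-hand side
    by [variation_cvg] and the differentiability of [ell]; limits are unique. *)
Lemma first_variation_eq0 q d phi B : left_rep a b al q c f ->
  critical_point a b al p (bolza a b al L ell) q ->
  density a b p phi -> (forall i x, `|phi i x| <= B) ->
  \int[mu]_t (\sum_i RLcurve a al d phi t ord0 i * wx i t + \sum_i phi i t * wv i t) +
  (\sum_i d ord0 i * ell_1 ell c x2 ord0 i +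
   \sum_i RLcurve a al d phi b ord0 i * ell_2 ell c x2 ord0 i) = 0.
Proof.
move=> qr [_ qcrit] dp phiB; pose H := RLcurve a al d phi.
have /cvg_lam_dnbhs cv0 := qcrit H (RLcurve_AC_left ab al01 p1 alp d dp).
have bab : b \in `[a, b] by rewrite in_itv/= lexx ltW.
have Jl (l : R) : bolza a b al L ell (fun t => q t + l *: H t) =
    \int[mu]_(t in `]a, b]) L t (Q t + l *: H t) (\row_i f i t + l *: \row_i phi i t) +
    ell (c + l *: d) (x2 + l *: H b).
  have dfp := densityD ab p1 l df dp.
  have qlr : left_rep a b al (fun t => q t + l *: H t) (c + l *: d) (fun i x => f i x + l * phi i x).
    split; first exact: density_zint dfp.
    move=> i; apply: ae_imp (qr.2 i) => t qE tab.
    have /rowP/(_ i) := RLcurveD al01 alp c d l df dp tab.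
    by rewrite mxE => ->; rewrite mxE qE// !mxE.
  rewrite (bolza_left_rep ab al01 L ell qlr) -Rintegral_itv_cc_oc; congr (_ + _).
    apply: eq_Rintegral => t; rewrite inE/= => tab.
    rewrite (RLcurveD al01 alp c d l df dp tab); congr (L t _ _).
    by apply/rowP => i; rewrite !mxE.
  by rewrite (RLcurveD al01 alp c d l df dp bab).
have J0 : bolza a b al L ell q =
    \int[mu]_(t in `]a, b]) L t (Q t) (\row_i f i t) + ell c x2.
  by rewrite (bolza_left_rep ab al01 L ell qr) Rintegral_itv_cc_oc.
have cv1 := @variation_cvg R m a b al p s ab al01 p1 alp L hL hgr c f df d phi B dp phiB.
have cv2 := @diff_quotient_cvg R m (fun z => ell z.1 z.2) (c, x2) (d, H b) hell.1.
have := cvgD cv1 cv2; rewrite diff_gradient; last exact: hell.1.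
set E := (X in _ -> X = _) => cv3.
pose S (n : nat) := (bolza a b al L ell (fun t => q t + lam n *: H t) - bolza a b al L ell q) / lam n.
have cvS : S n @[n --> \oo] --> E.
  apply: cvg_trans (cv3 _); apply: near_eq_cvg; apply: nearW => n.
  by rewrite /S Jl J0 opprD addrACA mulrDl.
have cv0' : S n @[n --> \oo] --> (0 : R) := cv0.
exact: (@cvg_unique _ (@norm_hausdorff _ R) _ _ _ _ cvS cv0').
Qed.

Lemma indic_le1 (A : set R) (b1 : bool) x : `|b1%:R * \1_A x| <= 1 :> R.
Proof.
rewrite indicE; case: b1; case: (_ \in _);
by rewrite ?mulr1 ?mul0r ?mulr0 ?normr1 ?normr0.
Qed.

Lemma density_indic (A : set R) (j : 'I_m) : measurable A -> A `<=` `[a, b] ->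
  density a b p (fun i x => (i == j)%:R * \1_A x).
Proof.
move=> mA Aab; have mphi i : measurable_fun setT (fun x => (i == j)%:R * \1_A x : R).
  by apply: measurable_funM => //; exact: measurable_indic.
split => // [i x xab|].
  by rewrite indicE memNset ?mulr0// => /Aab; exact/negP.
have pc : powint a b p (fun=> m%:R * 1).
  by apply: powint_cst => //; rewrite ?mulr_ge0// (lt_le_trans _ p1)// ltNyr.
apply: powint_le pc => //; first by rewrite (lt_le_trans _ p1)// lte_fin.
- exact: measurable_enorm.
- by move=> t; exact: enorm_ge0.
- move=> t _; apply: enorm_le_cst => i; rewrite mxE.
  exact: indic_le1.
Qed.

Lemma Il_scale (k : R) (g : R -> R) t : measurable_fun setT g ->
  Il al (fun x => k * g x) t = k * Il al g t.
Proof.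
move=> mg; rewrite /Il mulrCA; congr (_ * _); rewrite -RintegralMl//.
  by apply: eq_Rintegral => x _; rewrite mulrCA.
by apply: measurable_funM => //; exact: measurable_kerB.
Qed.

Lemma Ir_scale (k : R) (g : R -> R) t : measurable_fun setT g ->
  Ir al (fun x => k * g x) t = k * Ir al g t.
Proof.
move=> mg; rewrite /Ir mulrCA; congr (_ * _); rewrite -RintegralMl//.
  by apply: eq_Rintegral => x _; rewrite mulrCA.
by apply: measurable_funM => //; exact: measurable_kerB.
Qed.

Let mwx j : measurable_fun setT (wx j).
Proof. exact (measurable_wx al ab hL c df j). Qed.

Let mwv j : measurable_fun setT (wv j).
Proof. exact (measurable_wv al ab hL c df j). Qed.

(** [L_x] along the curve is of class L^s with [1/s < al]. *)
Lemma Ir_wx_bounded j : exists2 C, 0 <= C & forall t, t \in `[a, b] -> `|Ir al (wx j) t| <= C.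
Proof.
have [als _] := hgr.
have [G pG wG] := wx_in_Lp ab al01 p1 alp hgr c df.
have [C C0 hC] := Il_Ir_bounded al01 als pG (mwx j) (@wx_out _ _ a b al L c f j) (fun x _ => wG j x).
by exists C => // t tab; have [] := hC t tab.
Qed.

Lemma Il_indic_bounded (A : set R) : measurable A -> A `<=` `[a, b] ->
  exists2 C, 0 <= C & forall t, t \in `[a, b] -> `|Il al (\1_A) t| <= C.
Proof.
move=> mA Aab; have p1' : powint a b +oo%E (fun=> 1 : R) by exact: powint_cst.
have [||||C C0 hC] := @Il_Ir_bounded _ a b al al01 +oo%E (fun=> 1) (\1_A) _ p1'.
- exact: ltry.
- exact: measurable_indic.
- by move=> x xab; rewrite indicE memNset// => /Aab; exact/negP.
- by move=> x _; have := indic_le1 A true x; rewrite mul1r.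
by exists C => // t tab; have [] := hC t tab.
Qed.

Let integrable_bounded (g : R -> R) C : measurable_fun setT g ->
  (forall x, x \notin `[a, b] -> g x = 0) ->
  (forall x, x \in `[a, b] -> `|g x| <= C) -> mu.-integrable setT (EFin \o g).
Proof.
move=> mg g0 gC; apply: (@integrable_off_itv _ a b g (fun=> C)) => //.
exact: integral_lty_cst.
Qed.

Let ker_b_integrable : mu.-integrable setT (EFin \o (fun x => ker al (b - x) * \1_`[a, b] x)).
Proof.
have /andP[al0 _] := al01; have [C C0 [hC _]] := @integral_ker_itvcc R a b al al0.
apply: (@integrable_off_itv _ a b _ (fun x => ker al (b - x))).
- apply: measurable_funM; [exact: measurable_kerB|exact: measurable_indic].
- by move=> x xab; rewrite indicE mem_setE (negbTE xab) mulr0.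
- exact: measurable_kerB.
- by move=> x xab; rewrite indicE mem_setE xab mulr1 ger0_norm// ker_ge0.
- exact: le_lt_trans (hC b (lexx b)) (ltry _).
Qed.

(** Besides duality, the point is that the endpoint value [Il al (\1_A) b] is itself an integral
    against the indicator, of the kernel [ker al (b - x)]; the singular term of [L_v] comes from
    there. *)
Lemma euler_lagrange_weak q j (A : set R) : left_rep a b al q c f ->
  critical_point a b al p (bolza a b al L ell) q -> measurable A -> A `<=` `[a, b] ->
  \int[mu]_x ((Ir al (wx j) x + wv j x + ell_2 ell c x2 ord0 j / Gamma al * ker al (b - x))
    * \1_A x) = 0.
Proof.
move=> qr qc mA Aab.
have mI : measurable_fun setT (\1_A : R -> R) by exact: measurable_indic.
have A0 x : x \notin `[a, b] -> \1_A x = 0 :> R.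
  by move=> xab; rewrite indicE memNset// => /Aab; exact/negP.
have A1 x : `|\1_A x| <= 1 :> R.
  by have := indic_le1 A true x; rewrite mul1r.
have := first_variation_eq0 0 qr qc (density_indic j mA Aab)
  (fun i x => indic_le1 A (i == j) x).
have HE t i : RLcurve a al 0 (fun i x => (i == j)%:R * \1_A x) t ord0 i =
    (i == j)%:R * Il al (\1_A) t.
  by rewrite !mxE !mul0r add0r Il_scale.
have sumj (F G : 'I_m -> R) : (forall i, F i = (i == j)%:R * G i) -> \sum_i F i = G j.
  move=> FG; rewrite (bigD1 j)//= big1 ?addr0.
    by rewrite FG eqxx mul1r.
  by move=> i /negbTE ij; rewrite FG ij mul0r.
rewrite [X in _ + (X + _)]big1 ?add0r; last by move=> i _; rewrite mxE mul0r.
rewrite (@sumj _ (fun i => Il al (\1_A) b * ell_2 ell c x2 ord0 i)); last first.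
  by move=> i; rewrite HE; ring.
have -> : \int[mu]_t (\sum_i RLcurve a al 0 (fun i x => (i == j)%:R * \1_A x) t ord0 i * wx i t +
      \sum_i (i == j)%:R * \1_A t * wv i t) =
    \int[mu]_t (wx j t * Il al (\1_A) t + \1_A t * wv j t).
  apply: eq_Rintegral => t _.
  rewrite (@sumj _ (fun i => wx i t * Il al (\1_A) t)); last first.
    by move=> i; rewrite HE; ring.
  by rewrite (@sumj _ (fun i => \1_A t * wv i t))// => i; rewrite mulrA.
have [C C0 hC] := Il_indic_bounded mA Aab.
have [G1 [G2 [pG1 pG2 hG1 hG2]]] := wx_wv_dominated ab al01 p1 alp hgr c df.
have [mG1 G10 _] := pG1; have [mG2 G20 _] := pG2.
have mIl : measurable_fun setT (Il al (\1_A)) by exact: measurable_Il.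
have i1 : mu.-integrable setT (EFin \o (fun t => wx j t * Il al (\1_A) t)).
  apply: (@integrable_off_itv _ a b _ (fun x => C * G1 x)).
  - exact: measurable_funM.
  - by move=> x xab; rewrite wx_out// mul0r.
  - exact: measurable_funM.
  - by move=> x xab; rewrite normrM mulrC ler_pM// ?hC.
  - apply: integral_lty_scale => //; exact: powint_integral_lty (s_ge1 al01 hgr) pG1.
have i2 : mu.-integrable setT (EFin \o (fun t => \1_A t * wv j t)).
  apply: (@integrable_off_itv _ a b _ G2) => //.
  - exact: measurable_funM.
  - by move=> x xab; rewrite A0// mul0r.
  - by move=> x xab; rewrite normrM -[leRHS]mul1r ler_pM.
  - exact: powint_integral_lty (hoelder_conj_ge1 p1) pG2.
rewrite RintegralD//.
have [B B0 hB] := Ir_wx_bounded j.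
rewrite (@Il_Ir_duality R a b al 1 (wx j) (\1_A))//; last 3 first.
- by have /andP[] := al01.
- by have [] := zint_wx ab al01 p1 alp hL hgr c df j.
- exact: wx_out.
have mIr : measurable_fun setT (Ir al (wx j)) by exact: measurable_Ir.
have i3 : mu.-integrable setT (EFin \o (fun t => Ir al (wx j) t * \1_A t)).
  apply: (@integrable_bounded _ B).
  - exact: measurable_funM.
  - by move=> x xab; rewrite A0// mulr0.
  - by move=> x xab; rewrite normrM -[leRHS]mulr1 ler_pM// hB.
have i4 : mu.-integrable setT (EFin \o (fun t => ker al (b - t) * \1_A t)).
  have mk : measurable_fun setT (fun x : R => ker al (b - x)) by exact: measurable_kerB.
  apply: (le_integrable _ _ _ ker_b_integrable) => //.
    by apply/measurable_EFinP; exact: measurable_funM.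
  move=> x _; rewrite lee_fin !normrM ler_wpM2l//.
  have [xab|xab] := boolP (x \in `[a, b]); last by rewrite A0// normr0.
  by rewrite [in leRHS]indicE mem_setE xab normr1.
have i4' : mu.-integrable setT (EFin \o (fun t =>
    ell_2 ell c x2 ord0 j / Gamma al * (ker al (b - t) * \1_A t))).
  have := integrableZl measurableT (ell_2 ell c x2 ord0 j / Gamma al) i4.
  by apply: eq_integrable.
have i32 : mu.-integrable setT (EFin \o (fun t => Ir al (wx j) t * \1_A t + \1_A t * wv j t)).
  by have := integrableD measurableT i3 i2; apply: eq_integrable.
move=> <-; rewrite -RintegralD//.
transitivity (\int[mu]_t (Ir al (wx j) t * \1_A t + \1_A t * wv j t) +
    \int[mu]_t (ell_2 ell c x2 ord0 j / Gamma al * (ker al (b - t) * \1_A t))).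
  by rewrite -RintegralD//; apply: eq_Rintegral => x _; ring.
by congr (_ + _); rewrite RintegralZl// /Il; ring.
Qed.

Lemma euler_lagrange_ae q j : left_rep a b al q c f ->
  critical_point a b al p (bolza a b al L ell) q ->
  {ae mu, forall t, t \in `[a, b] ->
    wv j t = - ell_2 ell c x2 ord0 j / Gamma al * ker al (b - t) + Ir al (fun x => - wx j x) t}.
Proof.
move=> qr qc.
pose r x := (Ir al (wx j) x + wv j x + ell_2 ell c x2 ord0 j / Gamma al * ker al (b - x))
    * \1_`[a, b] x.
have ri : mu.-integrable setT (EFin \o r).
  have mIr : measurable_fun setT (Ir al (wx j)) by exact: measurable_Ir.
  have [B B0 hB] := Ir_wx_bounded j.
  have i3 : mu.-integrable setT (EFin \o (fun t => Ir al (wx j) t * \1_`[a, b] t)).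
    apply: (@integrable_bounded _ B).
    - by apply: measurable_funM => //; exact: measurable_indic.
    - by move=> x xab; rewrite indicE mem_setE (negbTE xab) mulr0.
    - by move=> x xab; rewrite indicE mem_setE xab mulr1 hB.
  have [i2 _] := zint_wv ab al01 p1 alp hL hgr c df j.
  have i4 := integrableZl measurableT (ell_2 ell c x2 ord0 j / Gamma al) ker_b_integrable.
  have := integrableD measurableT (integrableD measurableT i3 i2) i4.
  apply: eq_integrable => // x _; rewrite /r; congr EFin.
  have -> : wv j x = wv j x * \1_`[a, b] x.
    rewrite indicE mem_setE; case: (boolP (x \in `[a, b])) => [_|xab].
      by rewrite mulr1.
    by rewrite wv_out// mul0r.
  by rewrite !mulrDl mulrA -!mulrA !indicE; case: (_ \in _); rewrite ?mulr1 ?mulr0.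
(* Testing on the part of [[a, b]] below [t] shows that the primitive of the residual [r]
   vanishes. *)
have r0 t : \int[mu]_(x in `]-oo, t[) r x = 0.
  have mA : measurable (`]-oo, t[ `&` `[a, b] : set R) by exact: measurableI.
  rewrite -(euler_lagrange_weak j qr qc mA (@subIsetr _ _ _)).
  rewrite Rintegral_mkcond; apply: eq_Rintegral => x _.
  rewrite patchE /r indicI /= !indicE; case: (_ \in `]-oo, t[%classic).
    by rewrite mul1r.
  by rewrite mul0r mulr0.
apply: ae_imp (ae_eq0_Rintegral ri r0) => t + tab.
rewrite /r indicE mem_setE tab mulr1 => h.
have -> : Ir al (fun x => - wx j x) t = - Ir al (wx j) t.
  by rewrite -mulN1r -Ir_scale//; congr (Ir al _ t); apply/funext => x; rewrite mulN1r.
by apply/eqP; rewrite -subr_eq0 -h; apply/eqP; ring.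
Qed.

(** The test curve is the singular kernel based at [a], in direction [j]. That kernel is also the
    one of the right fractional integral evaluated at [a], so integrating it against [wx j] gives
    [Ir al (wx j) a]. *)
Lemma natural_condition_left q j : left_rep a b al q c f ->
  critical_point a b al p (bolza a b al L ell) q ->
  - ell_2 ell c x2 ord0 j / Gamma al * ker al (b - a) + Ir al (fun x => - wx j x) a =
  ell_1 ell c x2 ord0 j.
Proof.
move=> qr qc.
(* The zero density is written as the indicator of the empty set, so that [density_indic]
   applies. *)
have := @first_variation_eq0 q (delta_mx ord0 j) (fun i x => (i == j)%:R * \1_set0 x) 1 qr qc
  (density_indic j measurable0 (@sub0set _ _)) (fun i x => indic_le1 set0 (i == j) x).
have HE t i : RLcurve a al (delta_mx ord0 j) (fun i x => (i == j)%:R * \1_set0 x) t ord0 i =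
    (i == j)%:R * (ker al (t - a) / Gamma al).
  rewrite !mxE eqxx/= (_ : Il al _ t = 0); last first.
    rewrite /Il /Rintegral integral0_eq ?mulr0// => x _.
    by rewrite indic0 !mulr0.
  by rewrite addr0; ring.
have sumj (F G : 'I_m -> R) : (forall i, F i = (i == j)%:R * G i) -> \sum_i F i = G j.
  move=> FG; rewrite (bigD1 j)//= big1 ?addr0.
    by rewrite FG eqxx mul1r.
  by move=> i /negbTE ij; rewrite FG ij mul0r.
rewrite (@sumj _ (fun i => ell_1 ell c x2 ord0 i)); last first.
  by move=> i; rewrite mxE eqxx.
rewrite (@sumj _ (fun i => ker al (b - a) / Gamma al * ell_2 ell c x2 ord0 i)); last first.
  by move=> i; rewrite HE; ring.
have -> : \int[mu]_t (\sum_i RLcurve a al (delta_mx ord0 j) (fun i x => (i == j)%:R * \1_set0 x) t ord0 i * wx i t +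
      \sum_i (i == j)%:R * \1_set0 t * wv i t) = Ir al (wx j) a.
  have mk : measurable_fun setT (fun x : R => ker al (x - a)) by exact: measurable_kerB.
  rewrite /Ir -RintegralMl//; last exact: (measurable_funM mk (mwx j)).
  apply: eq_Rintegral => t _.
  rewrite (@sumj _ (fun i => ker al (t - a) / Gamma al * wx i t)); last first.
    by move=> i; rewrite HE; ring.
  rewrite big1 ?addr0; first by ring.
  by move=> i _; rewrite indic0 mulr0 mul0r.
have -> : Ir al (fun x => - wx j x) a = - Ir al (wx j) a.
  by rewrite -mulN1r -Ir_scale//; congr (Ir al _ a); apply/funext => x; rewrite mulN1r.
by move=> /eqP; rewrite addrCA addr_eq0 => /eqP ->; ring.
Qed.

End EulerLagrange.

Theorem theorem3 (R : realType) (m : nat) (a b alpha : R) (p s : \bar R)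
    (L : R -> 'rV[R]_m -> 'rV[R]_m -> R) (ell : 'rV[R]_m -> 'rV[R]_m -> R)
    (q : R -> 'rV[R]_m)
    (hm : (0 < m)%N) (hab : a < b)
    (halpha : 0 < alpha < 1)
    (hp : (1%:E <= p)%E) (hpalpha : 0 <= recip p < alpha)
    (hL : lagrangian a b L)
    (hell : is_C1 (fun z : 'rV[R]_m * 'rV[R]_m => ell z.1 z.2))
    (hgrowth : qp_controlled a b alpha p s L)
    (hq : critical_point a b alpha p (bolza a b alpha L ell) q) :
  let u := RLder_left a b alpha q in
  let Lv := fun t => L_v L t (q t) (u t) in
  let x1 := RLac_left a b alpha q a in
  let x2 := RLval_left a b alpha q b in
  [/\ AC_right a b alpha s Lv,
      \forall t \ae (@lebesgue_measure R), t \in `[a, b] ->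
        RLder_right a b alpha Lv t = - L_x L t (q t) (u t),
      RLval_right a b alpha Lv a = ell_1 ell x1 x2
    & RLac_right a b alpha Lv b = - ell_2 ell x1 x2].
Proof.
have alp : (alpha^-1%:E < p)%E.
  have /andP[al0 _] := halpha; have /andP[_] := hpalpha.
  case: (p) hp => [r| |] // r1; rewrite ?ltry//.
  have r0 : 0 < r by rewrite (lt_le_trans ltr01).
  by rewrite recipE// lte_fin => h; rewrite -[r]invrK ltf_pV2 ?posrE ?invr_gt0.
have [c [f [df qr]]] := AC_left_density hab halpha hp hq.1.
move=> u Lv; rewrite (left_rep_RLac hab halpha qr) (left_rep_RLval hab halpha qr).
move=> x1 x2.
have uE := left_rep_RLder hab halpha qr.
have qE := ae_forall_fin qr.2.
(* [wx] and [wv] are built on the explicit curve over []a, b]]; this identifies them with [L_x] and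
   [Lv] along [q] off a null set. *)
have curveE : {ae @lebesgue_measure R, forall t, t \in `[a, b] ->
    a < t /\ q t = RLcurve a alpha c f t /\ u t = \row_i f i t}.
  have h := ae_imp2 (fun t => @conj (t != a) _) (ae_neq a) qE.
  apply: ae_imp2 h uE => t [ta h1] h2 tab; split.
    by move: tab; rewrite in_itv/= lt_neqAle eq_sym ta => /andP[->].
  by split; [apply/rowP => i; rewrite mxE h1|rewrite /u h2].
have tabP t : t \in `[a, b] -> a < t -> t \in `]a, b].
  by rewrite !in_itv/= => /andP[_ ->] ->.
have LvE i : {ae @lebesgue_measure R, forall t, t \in `[a, b] ->
    Lv t ord0 i = wv a b alpha L c f i t}.
  apply: ae_imp curveE => t h tab; have [ta [q1 u1]] := h tab.
  by rewrite /wv patchE mem_setE tabP// /Lv q1 u1.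
have LxE : {ae @lebesgue_measure R, forall t, t \in `[a, b] ->
    \row_i (- wx a b alpha L c f i t) = - L_x L t (q t) (u t)}.
  apply: ae_imp curveE => t h tab; have [ta [q1 u1]] := h tab.
  by apply/rowP => i; rewrite mxE [RHS]mxE /wx patchE mem_setE tabP// q1 u1.
have zw : zint a b (fun i t => - wx a b alpha L c f i t).
  move=> i; have [wi w0] := zint_wx hab halpha hp alp hL hgrowth c df i; split.
    by have := integrableN wi; apply: eq_integrable.
  by move=> t tab; rewrite w0// oppr0.
(* The almost everywhere equation says exactly that [Lv] has this right representation. Its
   regularity, its derivative and its value at [b] are read off from it; the value at [a] also uses
   [natural_condition_left]. *)
have rr : right_rep a b alpha Lv (- ell_2 ell x1 x2) (fun i t => - wx a b alpha L c f i t).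
  split => // i.
  have hEL := euler_lagrange_ae hab halpha hp alp hL hell hgrowth df i qr hq.
  apply: ae_imp2 (LvE i) hEL => t h1 h2 tab.
  by rewrite h1// h2// [(- ell_2 _ _ _) ord0 i]mxE.
split.
- apply: (right_rep_AC_right hab halpha rr).
    exact: zint_in_Lp1 (zint_wv hab halpha hp alp hL hgrowth c df) LvE.
  have [G pG hG] := wx_in_Lp hab halpha hp alp hgrowth c df.
  apply: (powint_in_Lp hab (s_ge1 halpha hgrowth) pG) => i.
    by apply: measurableT_comp => //; exact (measurable_wx alpha hab hL c df i).
  by move=> t _; rewrite normrN.
- by apply: ae_imp2 (right_rep_RLder hab halpha rr) LxE => t h1 h2 tab; rewrite h1// h2.
- rewrite (right_rep_RLval hab halpha rr); apply/rowP => i; rewrite mxE.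
  rewrite [(- ell_2 _ _ _) ord0 i]mxE.
  exact: (natural_condition_left hab halpha hp alp hL hell hgrowth df i qr hq).
- by rewrite (right_rep_RLac hab halpha rr).
Qed.
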